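(* Let $K$ be a field with $\operatorname{char} K \neq 2$, let $a,b,c \in K^\times$, $\varepsilon_1,\varepsilon_2,\varepsilon_3 \in \{1,-1\}$, and let $x_1,x_2,x_3$ be independent indeterminates over $K$. Let $G$ be the group of $K$-automorphisms of $F = K(x_1,x_2,x_3)$ generated by $$\sigma_1: x_1 \mapsto \varepsilon_1 x_1,\ x_2 \mapsto \frac{b}{x_2},\ x_3 \mapsto \frac{c}{x_3},\qquad \sigma_2: x_1 \mapsto \frac{a}{x_1},\ x_2 \mapsto \varepsilon_2 x_2,\ x_3 \mapsto \frac{\varepsilon_3 c}{x_3}.$$ For $u,v,w \in K^\times$ write $\mathcal{R}(u,v,w)$ for the statement ''$F^{\langle\sigma_{u,v,w}\rangle}$ is rational over $K$'', where $\sigma_{u,v,w}$ is the $K$-automorphism of $F$ given by $x_1 \mapsto -x_1$, $x_2 \mapsto \frac{u}{x_2}$, $x_3 \mapsto \frac{-vx_1^2+w}{x_3}$. Then: (1) If $\varepsilon_1=\varepsilon_2=\varepsilon_3=1$, then $F^G$ is rational over $K$ iff $\mathcal{R}(a,b,c)$ holds. (2) If $\varepsilon_1=\varepsilon_2=-1,\varepsilon_3=1$, then $F^G$ is rational over $K$ iff $\mathcal{R}(a,b,c)$; if $\varepsilon_1=\varepsilon_3=-1,\varepsilon_2=1$, then iff $\mathcal{R}(-a,b,c)$; if $\varepsilon_2=\varepsilon_3=-1,\varepsilon_1=1$, then iff $\mathcal{R}(a,-b,-c)$. (3) If exactly one of $\varepsilon_1,\varepsilon_2,\varepsilon_3$ equals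 $-1$, then $F^G$ is rational over $K$. (4) Suppose $\varepsilon_1=\varepsilon_2=\varepsilon_3=-1$. (i) If $a=\pm1$ (resp. $b=\pm1$, resp. $c=\pm1$), then $F^G$ is rational over $K$ iff $\mathcal{R}(b,-1,c)$ (resp. $\mathcal{R}(a,-1,-c)$, resp. $\mathcal{R}(a,-1,b)$) holds. (ii) If $ab=1$ (resp. $ac=-1$, resp. $bc=1$), then $F^G$ is rational over $K$ iff $\mathcal{R}(a,c,-ac)$ (resp. $\mathcal{R}(-a,b,ab)$, resp. $\mathcal{R}(-b,a,ab)$) holds. (iii) If none of $\pm a,\pm b,\pm c, ab, -ac, bc$ belongs to $K^{\times 2}$, then $F^G$ is not rational over $K$.
   Context: Rational over $K$ means purely transcendental over $K$. $K^{\times 2}$ is the set of nonzero squares of $K$. For a group $H$ of automorphisms of $F$, $F^H$ is the fixed subfield. The group $G$ is isomorphic to $C_2\times C_2$. *)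

(* Defs.v *)
From HB Require Import structures.
From mathcomp Require Import all_boot all_algebra.
From mathcomp Require Import ring.
From mathcomp.multinomials Require Import mpoly.

Set Implicit Arguments.
Unset Strict Implicit.
Unset Printing Implicit Defensive.

Import GRing.Theory.
Local Open Scope ring_scope.

Notation "p %:F" := (@FracField.tofrac _ p) : ring_scope.

(* Subfields of [F] are Prop-valued predicates; the base field [K] is embedded
   in [F] by [iota]. *)
Record is_subfield (F : fieldType) (L : F -> Prop) : Prop := IsSubfield {
  subfield1 : L 1;
  subfieldB : forall f g, L f -> L g -> L (f - g);
  subfieldM : forall f g, L f -> L g -> L (f * g);
  subfieldV : forall f, L f -> L f^-1
}.

(* K(B) *)
Definition adjoin (K F : fieldType) (iota : {rmorphism K -> F})
    (B : F -> Prop) : F -> Prop := fun f =>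
  forall L : F -> Prop, is_subfield L -> (forall k, L (iota k)) ->
    (forall g, B g -> L g) -> L f.

Definition alg_independent (K F : fieldType) (iota : {rmorphism K -> F})
    (B : F -> Prop) : Prop :=
  forall (n : nat) (y : 'I_n -> F), injective y -> (forall i, B (y i)) ->
    forall p : {mpoly K[n]}, mmap iota y p = 0 -> p = 0.

Definition purely_transcendental (K F : fieldType) (iota : {rmorphism K -> F})
    (L : F -> Prop) : Prop :=
  exists B : F -> Prop,
    alg_independent iota B /\ forall f, L f <-> adjoin iota B f.

Inductive generated (T : Type) (S : (T -> T) -> Prop) : (T -> T) -> Prop :=
| gen_mem g : S g -> generated S g
| gen_id : generated S id
| gen_comp g h : generated S g -> generated S h -> generated S (g \o h)
| gen_inv g h : generated S g -> cancel g h -> cancel h g -> generated S h.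

Definition fixed_by (T : Type) (H : (T -> T) -> Prop) : T -> Prop :=
  fun f => forall g, H g -> g f = f.

Definition is_Kautomorphism (K F : fieldType) (iota : {rmorphism K -> F})
    (s : F -> F) : Prop :=
  [/\ zmod_morphism s, monoid_morphism s, (forall k, s (iota k) = iota k)
    & bijective s].

Definition ratF (K : fieldType) : fieldType := {fraction {mpoly K[3]}}.

Definition constF (K : fieldType) : K -> ratF K :=
  (@FracField.tofrac {mpoly K[3]}) \o (@mpolyC 3 K).
HB.instance Definition _ (K : fieldType) :=
  GRing.RMorphism.copy (@constF K)
    ((@FracField.tofrac {mpoly K[3]}) \o (@mpolyC 3 K)).

Definition varF (K : fieldType) (i : 'I_3) : ratF K := ('X_i)%:F.
Definition x1 (K : fieldType) : ratF K := varF K (@Ordinal 3 0 isT).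
Definition x2 (K : fieldType) : ratF K := varF K (@Ordinal 3 1 isT).
Definition x3 (K : fieldType) : ratF K := varF K (@Ordinal 3 2 isT).

(* p(x1,x2,x3)/q(x1,x2,x3) |-> p(y)/q(y), on the chosen representative (p, q)
   of the fraction.  It does not depend on that choice when the [y i] are
   algebraically independent, which is the case for the three substitutions
   below: see [sigma1_Kaut], [sigma2_Kaut] and [sigma_uvw_Kaut]. *)
Definition ratsubst (K : fieldType) (y : 'I_3 -> ratF K) (f : ratF K) : ratF K :=
  mmap (@constF K) y \n_(repr f) / mmap (@constF K) y \d_(repr f).

Definition subst3 (K : fieldType) (y1 y2 y3 : ratF K) : ratF K -> ratF K :=
  ratsubst (fun i : 'I_3 => nth 0 [:: y1; y2; y3] i).

Definition sigma1 (K : fieldType) (b c e1 : K) : ratF K -> ratF K :=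
  subst3 (constF e1 * x1 K) (constF b / x2 K) (constF c / x3 K).

Definition sigma2 (K : fieldType) (a c e2 e3 : K) : ratF K -> ratF K :=
  subst3 (constF a / x1 K) (constF e2 * x2 K) (constF (e3 * c) / x3 K).

Definition sigma_uvw (K : fieldType) (u v w : K) : ratF K -> ratF K :=
  subst3 (- x1 K) (constF u / x2 K)
    ((- constF v * x1 K ^+ 2 + constF w) / x3 K).

Definition groupG (K : fieldType) (a b c e1 e2 e3 : K) :
    (ratF K -> ratF K) -> Prop :=
  generated (fun g => g = sigma1 b c e1 \/ g = sigma2 a c e2 e3).

Definition rational (K : fieldType) (L : ratF K -> Prop) : Prop :=
  purely_transcendental (@constF K) L.

Definition Ruvw (K : fieldType) (u v w : K) : Prop :=
  rational (fixed_by (generated (fun g => g = sigma_uvw u v w))).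

Definition nonzero_square (K : fieldType) (t : K) : Prop :=
  exists2 s : K, s != 0 & t = s ^+ 2.

Lemma frac_numden (R : idomainType) (f : {fraction R}) :
  f = (\n_(repr f))%:F / (\d_(repr f))%:F.
Proof.
have dn0 : (\d_(repr f)) != 0 by exact: denom_ratioP.
apply/(mulIf (x := (\d_(repr f))%:F)); first by rewrite tofrac_eq0.
rewrite mulfVK ?tofrac_eq0 //.
rewrite -{1}[f]reprK; move: (repr f) dn0 => r dn0.
transitivity (\pi_({fraction R})%qT (FracField.mulf r (Ratio \d_r 1))).
  by rewrite FracField.pi_mul; congr (FracField.mul _ _); rewrite !piE.
rewrite !piE; apply/eqmodP; rewrite /= FracField.equivfE /FracField.mulf.
by rewrite !numden_Ratio ?mulf_neq0 ?oner_neq0 // !mulr1 mulrC.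
Qed.

Section Invertible.
Variables (R : comNzRingType) (F : fieldType) (tau phi : {rmorphism R -> F}).

(* [phi], extended to those fractions whose denominator it does not kill, sends
   [phi p] back to [tau p]. *)
Definition ext_inv (p : R) := exists n d : R,
  [/\ phi d != 0, tau d * phi p = tau n & phi n = tau p * phi d].

Lemma ext_invM p1 p2 : ext_inv p1 -> ext_inv p2 -> ext_inv (p1 * p2).
Proof.
move=> [n1 [d1 [h1 e1 f1]]] [n2 [d2 [h2 e2 f2]]].
exists (n1 * n2), (d1 * d2); rewrite !rmorphM /= mulf_neq0 //; split=> //.
- by rewrite -e1 -e2; ring.
- by rewrite f1 f2; ring.
Qed.

Lemma ext_invD p1 p2 : ext_inv p1 -> ext_inv p2 -> ext_inv (p1 + p2).
Proof.
move=> [n1 [d1 [h1 e1 f1]]] [n2 [d2 [h2 e2 f2]]].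
exists (n1 * d2 + n2 * d1), (d1 * d2).
rewrite !rmorphD !rmorphM /= mulf_neq0 //; split=> //.
- by rewrite -e1 -e2; ring.
- by rewrite f1 f2; ring.
Qed.

Lemma ext_inv_const p : phi p = tau p -> ext_inv p.
Proof. by move=> e; exists p, 1; rewrite !rmorph1 oner_neq0 mul1r mulr1 e. Qed.

Lemma ext_inv_scale e p :
  phi e = tau e -> e ^+ 2 = 1 -> phi p = tau e * tau p -> ext_inv p.
Proof.
move=> ce e2 hp; exists (e * p), 1.
rewrite !rmorph1 oner_neq0 mul1r mulr1 !rmorphM ce hp; split=> //.
by rewrite mulrA -rmorphM -expr2 e2 rmorph1 mul1r.
Qed.

Lemma ext_inv_div m p : phi m = tau m -> tau m != 0 -> tau p != 0 ->
  phi p = tau m / tau p -> ext_inv p.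
Proof.
move=> hm m0 p0 hp; exists m, p; rewrite hm hp mulf_neq0 ?invr_eq0 //.
by rewrite mulrC divfK.
Qed.

Lemma ext_inv_inj p : injective tau -> ext_inv p -> phi p = 0 -> p = 0.
Proof.
move=> itau [n [d [h e f]]] p0; apply: (itau); rewrite rmorph0.
have n0 : n = 0.
  by apply: (itau); rewrite rmorph0 -e p0 mulr0.
by move: f; rewrite n0 rmorph0 => /esym/eqP; rewrite mulf_eq0 (negPf h) orbF => /eqP.
Qed.

End Invertible.

Section FracExtension.
Variables (R : idomainType) (F : fieldType) (phi : {rmorphism R -> F}).
Hypothesis phi_inj : forall p, phi p = 0 -> p = 0.

Definition frac_ext (f : {fraction R}) : F :=
  phi \n_(repr f) / phi \d_(repr f).

Lemma phi_neq0 (p : R) : p != 0 -> phi p != 0.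
Proof. by apply: contra => /eqP/phi_inj->. Qed.

Lemma frac_extE (n d : R) : d != 0 -> frac_ext (n%:F / d%:F) = phi n / phi d.
Proof.
move=> dn0; rewrite /frac_ext; set f := n%:F / d%:F.
have dn : (\d_(repr f)) != 0 by exact: denom_ratioP.
have := frac_numden f; rewrite {1}/f => /eqP.
rewrite eqr_div ?tofrac_eq0 // -!tofracM tofrac_eq => /eqP e.
by apply/eqP; rewrite eqr_div ?phi_neq0 // -!rmorphM e.
Qed.

Lemma frac_ext_poly (p : R) : frac_ext p%:F = phi p.
Proof.
by rewrite -[p%:F]divr1 -tofrac1 frac_extE ?oner_neq0 // rmorph1 divr1.
Qed.

Lemma frac_ext_zmod : zmod_morphism frac_ext.
Proof.
move=> f g; rewrite (frac_numden f) (frac_numden g).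
have := denom_ratioP (repr f); have := denom_ratioP (repr g).
set a := (\n_(repr f)); set b := (\d_(repr f)); set c := (\n_(repr g)).
set d := (\d_(repr g)) => d0 b0.
rewrite -mulNr addf_div ?tofrac_eq0 // mulNr -!tofracM -tofracB.
rewrite !frac_extE ?mulf_neq0 // -[in RHS]mulNr addf_div ?phi_neq0 //.
by rewrite mulNr rmorphB !rmorphM.
Qed.

Lemma frac_ext_monoid : monoid_morphism frac_ext.
Proof.
split; first by rewrite -tofrac1 frac_ext_poly rmorph1.
move=> f g; rewrite (frac_numden f) (frac_numden g).
have := denom_ratioP (repr f); have := denom_ratioP (repr g).
set a := (\n_(repr f)); set b := (\d_(repr f)); set c := (\n_(repr g)).
set d := (\d_(repr g)) => d0 b0.
by rewrite mulf_div -!tofracM !frac_extE ?mulf_neq0 // mulf_div !rmorphM.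
Qed.

End FracExtension.

Section Subst.
Variables (K : fieldType) (y : 'I_3 -> ratF K).

Let phi : {rmorphism {mpoly K[3]} -> ratF K} := mmap (@constF K) y.
Let tau : {rmorphism {mpoly K[3]} -> ratF K} := @FracField.tofrac {mpoly K[3]}.

Hypothesis hy : forall i, ext_inv tau phi 'X_i.

Lemma subst_ext_inv (p : {mpoly K[3]}) : ext_inv tau phi p.
Proof.
have PC (k : K) : ext_inv tau phi k%:MP.
  by apply: ext_inv_const; rewrite /phi /= mmapC.
have P1 : ext_inv tau phi 1 by exact: PC 1.
have PXm m : ext_inv tau phi 'X_[m].
  rewrite mpolyXE_id; elim/big_ind: _ => //; first exact: ext_invM.
  move=> i _.
  by elim: (m i) => [|k IH]; rewrite ?expr0 // exprS; apply: ext_invM.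
elim/mpolyind: p => [|k m p _ _ IH]; first exact: PC 0.
by apply: ext_invD => //; rewrite -mul_mpolyC; apply: ext_invM.
Qed.

Lemma subst_inj p : phi p = 0 -> p = 0.
Proof.
apply: (@ext_inv_inj _ _ tau phi); last exact: subst_ext_inv.
by move=> q r /eqP; rewrite tofrac_eq => /eqP.
Qed.

Lemma ratsubst_zmod : zmod_morphism (ratsubst y).
Proof. exact: (frac_ext_zmod subst_inj). Qed.

Lemma ratsubst_monoid : monoid_morphism (ratsubst y).
Proof. exact: (frac_ext_monoid subst_inj). Qed.

Lemma ratsubst_poly p : ratsubst y p%:F = mmap (@constF K) y p.
Proof. exact: (frac_ext_poly subst_inj). Qed.

Lemma ratsubst_const k : ratsubst y (constF k) = constF k.
Proof. by rewrite /constF /= ratsubst_poly mmapC. Qed.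

Lemma ratsubst_var i : ratsubst y (varF K i) = y i.
Proof. by rewrite /varF ratsubst_poly mmapX mmap1U. Qed.

Lemma ratsubst_invol : involutive (ratsubst y).
Proof.
move=> f.
pose s : ratF K -> ratF K := ratsubst y.
pose sZ := GRing.isZmodMorphism.Build _ _ s ratsubst_zmod.
pose sM := GRing.isMonoidMorphism.Build _ _ s ratsubst_monoid.
pose S : {rmorphism ratF K -> ratF K} := HB.pack s sZ sM.
have hi i : S (y i) = tau 'X_i.
  have [n [d [h]]] := hy i; have -> : phi 'X_i = y i by rewrite /phi /= mmapX mmap1U.
  move=> e1 e2.
  have : S (tau d * y i) = S (tau n) by rewrite e1.
  rewrite (rmorphM S).
  have -> : S (tau d) = phi d by exact: ratsubst_poly.
  have -> : S (tau n) = phi n by exact: ratsubst_poly.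
  by rewrite e2 mulrC => /(mulIf h).
have key p : S (phi p) = tau p.
  elim/mpolyind: p => [|k m p _ _ IH]; first by rewrite !rmorph0.
  rewrite (rmorphD phi) (rmorphD S) (rmorphD tau) IH; congr (_ + _).
  rewrite -mul_mpolyC (rmorphM phi) (rmorphM S) (rmorphM tau); congr (_ * _).
    by rewrite /phi /= mmapC; exact: ratsubst_const.
  rewrite mpolyXE_id (rmorph_prod phi) (rmorph_prod S) (rmorph_prod tau).
  apply: eq_bigr => i _.
  rewrite (rmorphXn phi) (rmorphXn S) (rmorphXn tau); congr (_ ^+ _).
  by rewrite /phi /= mmapX mmap1U.
have -> : ratsubst y (ratsubst y f) =
          S (phi \n_(repr f) / phi \d_(repr f)) by [].
by rewrite (fmorph_div S) !key [RHS]frac_numden.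
Qed.

Lemma ratsubst_Kaut : is_Kautomorphism (@constF K) (ratsubst y).
Proof.
split; [exact: ratsubst_zmod|exact: ratsubst_monoid|exact: ratsubst_const|].
by exists (ratsubst y); apply: ratsubst_invol.
Qed.

End Subst.

Lemma forall_ord3 (P : 'I_3 -> Prop) : P (@Ordinal 3 0 isT) ->
  P (@Ordinal 3 1 isT) -> P (@Ordinal 3 2 isT) -> forall i, P i.
Proof.
move=> P0 P1 P2 [[|[|[|m]]] hm] //.
- by rewrite (_ : Ordinal _ = Ordinal (isT : 0 < 3)%N) //; apply: val_inj.
- by rewrite (_ : Ordinal _ = Ordinal (isT : 1 < 3)%N) //; apply: val_inj.
- by rewrite (_ : Ordinal _ = Ordinal (isT : 2 < 3)%N) //; apply: val_inj.
Qed.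

Lemma constF_eq0 (K : fieldType) (k : K) : (constF k == 0) = (k == 0).
Proof. by rewrite /constF /= tofrac_eq0 mpolyC_eq0. Qed.

Lemma varF_neq0 (K : fieldType) i : varF K i != 0.
Proof.
rewrite /varF tofrac_eq0; apply/eqP => /(congr1 (fun p => p@_U_(i)%MM)).
by rewrite mcoeffX eqxx mcoeff0 => /eqP; rewrite oner_eq0.
Qed.

Definition Kaut_with_values (K : fieldType) (s : ratF K -> ratF K)
    (y1 y2 y3 : ratF K) : Prop :=
  is_Kautomorphism (@constF K) s /\
  [/\ s (x1 K) = y1, s (x2 K) = y2 & s (x3 K) = y3].

Section Concrete.
Variable K : fieldType.
Local Notation tau := (@FracField.tofrac {mpoly K[3]}).
Local Notation phi y := (mmap (@constF K) y).

Lemma subst3_Kaut (y1 y2 y3 : ratF K) :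
  let y (i : 'I_3) := nth 0 [:: y1; y2; y3] i in
  (forall i, ext_inv tau (phi y) 'X_i) ->
  Kaut_with_values (subst3 y1 y2 y3) y1 y2 y3.
Proof.
move=> y hy; split; first exact: ratsubst_Kaut.
by split; rewrite /subst3 /x1 /x2 /x3 ratsubst_var.
Qed.

Lemma ext_inv_var_scale (y : 'I_3 -> ratF K) (e : K) i :
  e ^+ 2 = 1 -> y i = constF e * varF K i -> ext_inv tau (phi y) 'X_i.
Proof.
move=> e2 hi; apply: (@ext_inv_scale _ _ _ _ e%:MP).
- by rewrite /= mmapC.
- by rewrite -rmorphXn e2 rmorph1.
- by rewrite /= mmapX mmap1U hi.
Qed.

Lemma ext_inv_var_div (y : 'I_3 -> ratF K) (k : K) i :
  k != 0 -> y i = constF k / varF K i -> ext_inv tau (phi y) 'X_i.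
Proof.
move=> k0 hi; apply: (@ext_inv_div _ _ _ _ k%:MP).
- by rewrite /= mmapC.
- by rewrite /= tofrac_eq0 mpolyC_eq0.
- exact: varF_neq0.
- by rewrite /= mmapX mmap1U hi.
Qed.

Lemma sigma1_Kaut (b c e1 : K) : b != 0 -> c != 0 -> e1 ^+ 2 = 1 ->
  Kaut_with_values (sigma1 b c e1)
    (constF e1 * x1 K) (constF b / x2 K) (constF c / x3 K).
Proof.
move=> b0 c0 he; apply: subst3_Kaut; apply: forall_ord3.
- exact: (ext_inv_var_scale (e := e1)).
- exact: (ext_inv_var_div (k := b)).
- exact: (ext_inv_var_div (k := c)).
Qed.

Lemma sigma2_Kaut (a c e2 e3 : K) :
  a != 0 -> c != 0 -> e2 ^+ 2 = 1 -> e3 != 0 ->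
  Kaut_with_values (sigma2 a c e2 e3)
    (constF a / x1 K) (constF e2 * x2 K) (constF (e3 * c) / x3 K).
Proof.
move=> a0 c0 he h3; apply: subst3_Kaut; apply: forall_ord3.
- exact: (ext_inv_var_div (k := a)).
- exact: (ext_inv_var_scale (e := e2)).
- by apply: (ext_inv_var_div (k := e3 * c)) => //; rewrite mulf_neq0.
Qed.

Lemma sigma_uvw_Kaut (u v w : K) : u != 0 -> v != 0 -> w != 0 ->
  Kaut_with_values (sigma_uvw u v w)
    (- x1 K) (constF u / x2 K) ((- constF v * x1 K ^+ 2 + constF w) / x3 K).
Proof.
move=> u0 v0 w0; apply: subst3_Kaut; apply: forall_ord3.
- by apply: (ext_inv_var_scale (e := -1)); rewrite ?sqrrN ?expr1n // rmorphN1 mulN1r.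
- exact: (ext_inv_var_div (k := u)).
- pose i0 := @Ordinal 3 0 isT.
  pose m : {mpoly K[3]} := - v%:MP * 'X_i0 ^+ 2 + w%:MP.
  have taum : tau m = - constF v * x1 K ^+ 2 + constF w.
    by rewrite /m tofracD tofracM tofracN tofracXn.
  apply: (@ext_inv_div _ _ _ _ m).
  + rewrite /= taum /m rmorphD rmorphM rmorphN rmorphXn /= !mmapC mmapX mmap1U.
    by rewrite sqrrN.
  + rewrite /= tofrac_eq0; apply/eqP => /(congr1 (fun p => p@_0%MM)) /eqP.
    rewrite mcoeff0 /m mcoeffD mcoeffC eqxx mulr1 -mpolyCN mcoeffCM.
    rewrite mpolyXn mcoeffX.
    have -> : (U_(i0) *+ 2 == 0 :> 'X_{1..3})%MM = false.
      apply/negP => /eqP/(congr1 (fun m : 'X_{1..3} => m i0)).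
      by rewrite mulmnE mnm1E eqxx mnm0E.
    by rewrite mulr0 add0r (negPf w0).
  + exact: varF_neq0.
  + by rewrite /= taum mmapX mmap1U.
Qed.

End Concrete.

(* Main.v *)
Require Import Defs.
From HB Require Import structures.
From mathcomp Require Import all_boot all_order all_algebra all_field.
From mathcomp Require Import ring zify.
From mathcomp Require Import perm.
From Stdlib Require Import Classical.
From mathcomp.multinomials Require Import mpoly.

(* Parts (1)-(4)(ii).  For a suitable involution s of G the field F^<s> is again
   purely transcendental, with explicit generators X1, X2, X3 on which the other
   involution acts as some sigma_{u,v,w}; in part (3) it fixes X1 instead, and the
   same coordinates, used a second time, make F^G rational.  The X_i are
   algebraically independent because the x_i can be recovered in a quadratic
   extension of K(X1, X2, X3).  The resulting parameters are matched with those of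
   the statement by R(u,v,w) <-> R(v,u,w) <-> R(u,w,v) and R(u,v,w) <-> R(u,uv,uw).

   Part (4)(iii).  Put s_i = x_i + a_i/x_i and d_i = x_i - a_i/x_i, where (a_i) is
   (a, b, c), and P = s_1^2, Q = s_2^2.  The identities s_i^2 - d_i^2 = 4 a_i say
   that (aP, Q), (bQ, P) and (cQ, PQ) split over F^G.  After adjoining sqrt(-1) or
   sqrt(-ab) to K, they force b to be a square in the residue field at every prime
   where P has odd valuation.  So if F^G = K(B) were purely transcendental, then P
   would be kappa times a norm from F^G(sqrt b) with kappa in K; kappa is itself a
   norm since P is a square in F, and exchanging the two slots of (b, P) gives h
   with h sigma_1(h) = b and sigma_2(h) = h.  Comparing coprime numerators and
   denominators of h as a function of x3, then of x1, then of x2, with Hilbert 90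
   in between, makes one of a, b, -c, -ac a square in K. *)

Set Implicit Arguments.
Unset Strict Implicit.
Unset Printing Implicit Defensive.

Import Order.TTheory GRing.Theory.
Local Open Scope ring_scope.


(** The obstruction in (4)(iii) is a Brauer class: (b, P) is unramified, and over K(B) such a class
    comes from K. It is phrased through norms, so that only polynomials in one variable at a time
    are needed. At a prime where P has odd and Q even valuation, the first two relations make the
    unit parts of Q and bQ squares in the residue field, hence b. If both valuations are odd, the
    three residues only give that -a and -b are squares; a root of -1 or of -ab in the ground field
    then makes b a square. The adjunction must keep a, b, -c, -ac non-squares. For sqrt(-1) this
    requires ac to be a non-square, which the hypotheses do not say; if ac is a square, sqrt(-ab) is
    adjoined instead, and multiplying the four by -ab gives -b, -a, b, bc up to squares. In the
    descent of h, a fraction of degree N, the actions of sigma_1 and sigma_2 on polynomials of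
    degree at most N commute only up to (-1)^N. Odd N is excluded by the hypotheses; for even N the
    sign vanishes, and Hilbert 90 can remove the variable. *)

Lemma eq_mmap n (R S : comNzRingType) (f1 f2 : R -> S) (y1 y2 : 'I_n -> S) :
  f1 =1 f2 -> y1 =1 y2 -> mmap f1 y1 =1 mmap f2 y2.
Proof.
move=> ef ey p; rewrite /mmap; apply: eq_bigr => m _; rewrite ef.
by congr (_ * _); apply: mmap1_eq.
Qed.

Lemma rmorph_mmap n (R S S' : comNzRingType) (f : R -> S) (y : 'I_n -> S)
    (g : {rmorphism S -> S'}) p :
  g (mmap f y p) = mmap (g \o f) (g \o y) p.
Proof.
rewrite /mmap rmorph_sum; apply: eq_bigr => m _; rewrite rmorphM; congr (_ * _).
by rewrite /mmap1 rmorph_prod; apply: eq_bigr => i _; rewrite rmorphXn.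
Qed.

(** * Subfields, adjunction and purely transcendental extensions *)

Section Subfield.
Variables (F : fieldType) (L : F -> Prop).
Hypothesis sL : is_subfield L.

Lemma subfield0 : L 0.
Proof. by rewrite -(subrr 1); apply: subfieldB => //; apply: subfield1. Qed.

Lemma subfieldN f : L f -> L (- f).
Proof. by move=> Lf; rewrite -sub0r; apply: subfieldB => //; apply: subfield0. Qed.

Lemma subfieldD f g : L f -> L g -> L (f + g).
Proof. by move=> Lf Lg; rewrite -(opprK g); apply: subfieldB => //; apply: subfieldN. Qed.

Lemma subfield_div f g : L f -> L g -> L (f / g).
Proof. by move=> Lf Lg; apply: subfieldM => //; apply: subfieldV. Qed.

Lemma subfieldX f n : L f -> L (f ^+ n).
Proof.
move=> Lf; elim: n => [|n IH]; first by rewrite expr0; apply: subfield1.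
by rewrite exprS; apply: subfieldM.
Qed.

Lemma subfield_nat n : L n%:R.
Proof.
elim: n => [|n IH]; first exact: subfield0.
by rewrite -addn1 natrD; apply: subfieldD => //; apply: subfield1.
Qed.

Lemma subfield_mmap (K : fieldType) (iota : K -> F) n (y : 'I_n -> F) p :
  (forall k, L (iota k)) -> (forall i, L (y i)) -> L (mmap iota y p).
Proof.
move=> Lk Ly; rewrite /mmap.
elim/big_ind: _ => [|f g|m _]; [exact: subfield0|exact: subfieldD|].
apply: subfieldM => //; rewrite /mmap1.
elim/big_ind: _ => [|f g|i _]; [exact: subfield1|exact: subfieldM|].
exact: subfieldX.
Qed.

End Subfield.

Section Adjoin.
Variables (K F : fieldType) (iota : {rmorphism K -> F}).

Lemma adjoin_subfield B : is_subfield (adjoin iota B).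
Proof.
split=> [L sL _ _|f g Lf Lg L sL Lk LB|f g Lf Lg L sL Lk LB|f Lf L sL Lk LB].
- exact: subfield1.
- by apply: subfieldB => //; [apply: Lf|apply: Lg].
- by apply: subfieldM => //; [apply: Lf|apply: Lg].
- by apply: subfieldV => //; apply: Lf.
Qed.

Lemma adjoin_const B k : adjoin iota B (iota k).
Proof. by move=> L _ Lk _; apply: Lk. Qed.

Lemma adjoin_mem (B : F -> Prop) f : B f -> adjoin iota B f.
Proof. by move=> Bf L _ _; apply. Qed.

Lemma adjoin_le (B C : F -> Prop) f :
  (forall g, B g -> adjoin iota C g) -> adjoin iota B f -> adjoin iota C f.
Proof. by move=> BC; apply=> //; [apply: adjoin_subfield|apply: adjoin_const]. Qed.

Lemma fixed_subfield (S : {rmorphism F -> F}) : is_subfield (fun f => S f = f).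
Proof.
split=> [|f g Sf Sg|f g Sf Sg|f Sf]; first exact: rmorph1.
- by rewrite rmorphB Sf Sg.
- by rewrite rmorphM Sf Sg.
- by rewrite fmorphV Sf.
Qed.

End Adjoin.

(** * Embeddings of K(x1,x2,x3) and transport of rationality along them *)

Definition indep (K F : fieldType) (iota : {rmorphism K -> F}) n
    (y : 'I_n -> F) : Prop :=
  forall p : {mpoly K[n]}, mmap iota y p = 0 -> p = 0.

Section Embedding.
Variables (K E : fieldType) (iota : {rmorphism K -> E}) (X : 'I_3 -> E).
Hypothesis iX : indep iota X.

Lemma rat_emb : exists Phi : {rmorphism ratF K -> E},
  (forall k, Phi (constF k) = iota k) /\ (forall i, Phi (varF K i) = X i).
Proof.
pose phi : {rmorphism {mpoly K[3]} -> E} := mmap iota X.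
pose s : ratF K -> E := frac_ext phi.
pose sZ := GRing.isZmodMorphism.Build _ _ s (frac_ext_zmod iX).
pose sM := GRing.isMonoidMorphism.Build _ _ s (frac_ext_monoid iX).
pose S : {rmorphism ratF K -> E} := HB.pack s sZ sM.
have Sp p : S p%:F = mmap iota X p by exact: (frac_ext_poly iX).
exists S; split=> [k|i]; first by rewrite -(mmapC X iota); apply: Sp.
by rewrite -(mmap1U X i) -(mmapX X iota); apply: Sp.
Qed.

End Embedding.

Lemma tofrac_mmap (K : fieldType) (p : {mpoly K[3]}) :
  p%:F = mmap (@constF K) (varF K) p :> ratF K.
Proof.
elim/mpolyind: p => [|k m p _ _ IH]; first by rewrite !rmorph0.
rewrite tofracD rmorphD /= IH -mul_mpolyC tofracM rmorphM /= mmapC mmapX.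
congr (_ * _ + _); rewrite {1}mpolyXE_id rmorph_prod; apply: eq_bigr => i _.
by rewrite rmorphXn.
Qed.

Lemma ratF_gen (K : fieldType) (f : ratF K) :
  adjoin (@constF K) (fun g => exists i, g = varF K i) f.
Proof.
move=> L sL Lk LX; rewrite (frac_numden f).
have Lp (p : {mpoly K[3]}) : L p%:F.
  by rewrite tofrac_mmap; apply: subfield_mmap => // i; apply: LX; exists i.
exact: subfield_div.
Qed.

Lemma indep_varF (K : fieldType) : indep (@constF K) (varF K).
Proof.
by move=> p; rewrite -tofrac_mmap => /eqP; rewrite tofrac_eq0 => /eqP.
Qed.

Lemma rat_ext (K E : fieldType) (Phi Psi : {rmorphism ratF K -> E}) :
  (forall k, Phi (constF k) = Psi (constF k)) ->
  (forall i, Phi (varF K i) = Psi (varF K i)) -> Phi =1 Psi.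
Proof.
move=> ek ev f; apply: (@ratF_gen K f (fun f => Phi f = Psi f)) => // [|g [i ->]] //.
split=> [|g h eg eh|g h eg eh|g eg]; first by rewrite !rmorph1.
- by rewrite !rmorphB eg eh.
- by rewrite !rmorphM eg eh.
- by rewrite !fmorphV eg.
Qed.

Section Transfer.
Variables (K E1 E2 : fieldType).
Variables (iota1 : {rmorphism K -> E1}) (iota2 : {rmorphism K -> E2}).
Variable Phi : {rmorphism E1 -> E2}.
Hypothesis Phik : forall k, Phi (iota1 k) = iota2 k.

Lemma adjoin_image B f :
  adjoin iota2 (fun g => exists2 h, B h & g = Phi h) f <->
  exists2 g, adjoin iota1 B g & f = Phi g.
Proof.
split=> [Bf|[g Bg ->]].
- apply: (Bf (fun f => exists2 g, adjoin iota1 B g & f = Phi g)) => [|k|g [h Bh ->]].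
  + have sB := adjoin_subfield iota1 B.
    split=> [|_ _ [f1 B1 ->] [f2 B2 ->]|_ _ [f1 B1 ->] [f2 B2 ->]|_ [f1 B1 ->]].
    * by exists 1; rewrite ?rmorph1 //; apply: (subfield1 sB).
    * by exists (f1 - f2); rewrite ?rmorphB //; apply: (subfieldB sB).
    * by exists (f1 * f2); rewrite ?rmorphM //; apply: (subfieldM sB).
    * by exists f1^-1; rewrite ?fmorphV //; apply: (subfieldV sB).
  + by exists (iota1 k); rewrite ?Phik //; apply: adjoin_const.
  + by exists h => //; apply: adjoin_mem.
- pose L g := adjoin iota2 (fun g0 => exists2 h, B h & g0 = Phi h) (Phi g).
  apply: (Bg L) => [|k|h Bh]; rewrite /L.
  + have sB := adjoin_subfield iota2 (fun g0 => exists2 h, B h & g0 = Phi h).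
    split=> [|f1 f2 B1 B2|f1 f2 B1 B2|f1 B1]; rewrite ?rmorph1 ?rmorphB ?rmorphM ?fmorphV.
    * exact: (subfield1 sB).
    * exact: (subfieldB sB).
    * exact: (subfieldM sB).
    * exact: (subfieldV sB).
  + by rewrite Phik; apply: adjoin_const.
  + by apply: adjoin_mem; exists h.
Qed.

Lemma mmap_image n (y : 'I_n -> E1) p :
  Phi (mmap iota1 y p) = mmap iota2 (Phi \o y) p.
Proof. by rewrite rmorph_mmap; apply: eq_mmap. Qed.

(** A transcendence basis of [L1] is pushed forward by [Phi]. Conversely, a basis of [L2] lies in
    [L2], hence in the image of [Phi], and can be pulled back. *)
Lemma purely_transcendental_image (L1 : E1 -> Prop) (L2 : E2 -> Prop) :
  (forall f, L2 f <-> exists2 g, L1 g & f = Phi g) ->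
  purely_transcendental iota1 L1 <-> purely_transcendental iota2 L2.
Proof.
move=> L12; split=> [[B [iB hB]]|[B [iB hB]]].
- exists (fun g => exists2 h, B h & g = Phi h); split=> [n y iy By p py|f].
    have [z hz] : exists z : 'I_n -> E1, forall i, B (z i) /\ y i = Phi (z i).
      apply: (fin_all_exists (P := fun i z => B z /\ y i = Phi z)) => i.
      by have [h Bh e] := By i; exists h.
    apply: (iB n z) => [i j e|i|].
    + by apply: iy; rewrite (hz i).2 (hz j).2 e.
    + exact: (hz i).1.
    + apply: (fmorph_inj Phi); rewrite rmorph0 mmap_image -py.
      by apply: eq_mmap => // i; rewrite (hz i).2.
  rewrite adjoin_image L12; split=> [] [g Lg ->]; exists g => //; exact/hB.
- have BL f : B f -> exists2 g, L1 g & f = Phi g.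
    by move=> Bf; apply/L12/hB; apply: adjoin_mem.
  exists (fun g => B (Phi g)); split=> [n y iy By p py|f].
    apply: (iB n (Phi \o y)) => // [i j /fmorph_inj/iy //|].
    by rewrite -mmap_image py rmorph0.
  have -> : L1 f <-> L2 (Phi f).
    split=> [Lf|/L12 [g Lg /fmorph_inj->] //]; apply/L12; by exists f.
  rewrite hB.
  split=> [Bf|Bf].
    suff /adjoin_image [g Bg /fmorph_inj->] : adjoin iota2
      (fun g => exists2 h, B (Phi h) & g = Phi h) (Phi f) by [].
    apply: adjoin_le Bf => g Bg; apply: adjoin_mem.
    have [h Lh e] := BL g Bg; exists h => //; by rewrite -e.
  have : adjoin iota2 (fun g => exists2 h, B (Phi h) & g = Phi h) (Phi f).
    by apply/adjoin_image; exists f.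
  by apply: adjoin_le => g [h Bh ->]; apply: adjoin_mem.
Qed.

End Transfer.


Lemma indep_reindex (K F : fieldType) (iota : {rmorphism K -> F}) m n
    (x : 'I_m -> F) (f : 'I_n -> 'I_m) :
  injective f -> indep iota x -> indep iota (x \o f).
Proof.
move=> fI ix p px.
pose q : {mpoly K[m]} := mmap (@mpolyC m K) (fun i => 'X_(f i)) p.
have q0 : q = 0.
  apply: ix; rewrite /q rmorph_mmap -px; apply: eq_mmap => [k|i] /=.
    by rewrite mmapC.
  by rewrite mmapX mmap1U.
(* A left inverse on polynomials: X_(f i) goes back to X_i and the variables outside the image of
   [f] go to 0. So [q = 0] forces [p = 0]. *)
pose g (j : 'I_m) : {mpoly K[n]} := if [pick i | f i == j] is Some i then 'X_i else 0.
have gf i : g (f i) = 'X_i.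
  by rewrite /g; case: pickP => [k /eqP/fI->//|/(_ i)]; rewrite eqxx.
have : mmap (@mpolyC n K) g q = p; last by rewrite q0 rmorph0.
rewrite /q rmorph_mmap.
have -> : mmap (mmap (@mpolyC n K) g \o @mpolyC m K)
   (mmap (@mpolyC n K) g \o (fun i => 'X_(f i))) p = mmap (@mpolyC n K) (fun i => 'X_i) p.
  by apply: eq_mmap => [k|i] /=; rewrite ?mmapC ?mmapX ?mmap1U.
elim/mpolyind: p {px q q0} => [|k e p _ _ IH]; first by rewrite rmorph0.
rewrite rmorphD /= IH -mul_mpolyC rmorphM /= mmapC mmapX; congr (_ * _ + _).
by rewrite mmap1_id.
Qed.

Lemma rational_full (K : fieldType) (L : ratF K -> Prop) :
  (forall f, L f) -> rational L.
Proof.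
move=> LT; exists (fun g => exists i, g = varF K i); split=> [n y iy By|f]; last first.
  by split=> // _; apply: ratF_gen.
have [f hf] : exists f : 'I_n -> 'I_3, forall i, y i = varF K (f i).
  by apply: (fin_all_exists (P := fun i j => y i = varF K j)) => i; apply: By.
have fI : injective f by move=> i j e; apply: iy; rewrite !hf e.
move=> p py; apply: (indep_reindex fI (@indep_varF K)).
by rewrite -py; apply: eq_mmap => // i; rewrite hf.
Qed.


(** * Specialization of fractions *)

Section Specialization.
Variables (R : comNzRingType) (E E' : fieldType).
Variables (tau : {rmorphism R -> E}) (phi : {rmorphism R -> E'}).
Hypothesis tau_inj : forall p, tau p = 0 -> p = 0.

(* [f = tau p / tau q] has the value [v = phi p / phi q] under the partial
   homomorphism [phi \o tau^-1]. *)
Definition spec f v := exists p q,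
  [/\ phi q != 0, f * tau q = tau p & v * phi q = phi p].

Lemma spec_base p : spec (tau p) (phi p).
Proof. by exists p, 1; rewrite !rmorph1 !mulr1 oner_eq0. Qed.

Lemma specD f g v w : spec f v -> spec g w -> spec (f + g) (v + w).
Proof.
move=> [p [q [q0 e1 e2]]] [p' [q' [q0' e1' e2']]]; exists (p * q' + p' * q), (q * q').
by rewrite !rmorphD !rmorphM mulf_neq0 // -e1 -e2 -e1' -e2'; split=> //; ring.
Qed.

Lemma specM f g v w : spec f v -> spec g w -> spec (f * g) (v * w).
Proof.
move=> [p [q [q0 e1 e2]]] [p' [q' [q0' e1' e2']]]; exists (p * p'), (q * q').
by rewrite !rmorphM mulf_neq0 // -e1 -e2 -e1' -e2'; split=> //; ring.
Qed.

Lemma specN f v : spec f v -> spec (- f) (- v).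
Proof.
move=> [p [q [q0 e1 e2]]]; exists (- p), q.
by rewrite !rmorphN -e1 -e2; split=> //; ring.
Qed.

Lemma specB f g v w : spec f v -> spec g w -> spec (f - g) (v - w).
Proof. by move=> sf sg; apply: specD => //; apply: specN. Qed.

Lemma spec1 : spec 1 1.
Proof. by have := spec_base 1; rewrite !rmorph1. Qed.

Lemma spec_nat n : spec n%:R n%:R.
Proof. by have := spec_base n%:R; rewrite !rmorph_nat. Qed.

Lemma specX f v n : spec f v -> spec (f ^+ n) (v ^+ n).
Proof.
move=> sf; elim: n => [|n IH]; first by rewrite !expr0; apply: spec1.
by rewrite !exprS; apply: specM.
Qed.

Lemma spec_eq0 v : spec 0 v -> v = 0.
Proof.
move=> [p [q [q0]]]; rewrite mul0r => /esym/tau_inj-> /eqP.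
by rewrite rmorph0 mulf_eq0 (negPf q0) orbF => /eqP.
Qed.

(** The usual test for nonvanishing below: with [E' = K] and the variables sent to a point, a single
    nonzero value is enough. *)
Lemma spec_neq0 f v : spec f v -> v != 0 -> f != 0.
Proof. by move=> s; apply: contra => /eqP e; move: s; rewrite e => /spec_eq0->. Qed.

Lemma spec_inj f v w : spec f v -> spec f w -> v = w.
Proof.
by move=> sv sw; apply/eqP; rewrite -subr_eq0; apply/eqP/spec_eq0; rewrite -(subrr f); apply: specB.
Qed.

Lemma specV f v : v != 0 -> spec f v -> spec f^-1 v^-1.
Proof.
move=> v0 s; have f0 := spec_neq0 s v0; move: s => [p [q [q0 e1 e2]]]; exists q, p.
by rewrite -e1 -e2 mulf_neq0 // !mulKf.
Qed.

Lemma spec_div f g v w : w != 0 -> spec f v -> spec g w -> spec (f / g) (v / w).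
Proof. by move=> w0 sf sg; apply: specM => //; apply: specV. Qed.

Lemma spec_mmap (K : fieldType) (i : K -> E) (i' : K -> E') n y Y (p : {mpoly K[n]}) :
  (forall k, spec (i k) (i' k)) -> (forall j, spec (y j) (Y j)) ->
  spec (mmap i y p) (mmap i' Y p).
Proof.
move=> si sy; rewrite /mmap; elim/big_rec2: _ => [|m f v _ sv]; first exact: (spec_nat 0).
apply: specD => //; apply: specM => //; rewrite /mmap1.
elim/big_rec2: _ => [|j g w _ sw]; first exact: spec1.
by apply: specM => //; apply: specX.
Qed.

End Specialization.

Section SpecIndep.
Variables (K E E' : fieldType) (iota : {rmorphism K -> E}) (iota' : {rmorphism K -> E'}).
Variables (n : nat) (z : 'I_n -> E) (z' : 'I_n -> E').
Hypothesis iz : indep iota z.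

Definition specz : E -> E' -> Prop := spec (mmap iota z) (mmap iota' z').

Lemma specz_var i : specz (z i) (z' i).
Proof. by have := spec_base (mmap iota z) (mmap iota' z') 'X_i; rewrite /= !mmapX !mmap1U. Qed.

Lemma specz_const k : specz (iota k) (iota' k).
Proof. by have := spec_base (mmap iota z) (mmap iota' z') k%:MP; rewrite /= !mmapC. Qed.

(** A relation among the [y] specializes to the same relation among the [Y]. Hence rational
    functions y(z) are independent as soon as y(z') = Y can be solved for one independent family
    [Y], and z' may lie in any extension field. This replaces an argument by transcendence
    degree. *)
Lemma specz_indep m (y : 'I_m -> E) (Y : 'I_m -> E') :
  indep iota' Y -> (forall i, specz (y i) (Y i)) -> indep iota y.
Proof.
move=> iY sy p py; apply: iY; apply: (@spec_eq0 _ _ _ (mmap iota z) (mmap iota' z') iz).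
by rewrite -py; apply: spec_mmap => // k; apply: specz_const.
Qed.

End SpecIndep.

(** If [D] is already a square, [T] itself serves. The independence proofs use only the root, so
    they never have to decide whether [D] is a square; the decomposition of [y] is for the quadratic
    base change of K. *)
Lemma sqrt_ext (T : fieldType) (D : T) : exists (T' : fieldType)
  (j : {rmorphism T -> T'}) (r : T'), r ^+ 2 = j D /\
  ((forall s, s ^+ 2 != D) -> forall y, exists u v, y = j u + r * j v).
Proof.
have [nsq|] := Classical_Prop.classic (forall s : T, s ^+ 2 != D); last first.
  move=> h; have [s es] : exists s : T, s ^+ 2 = D.
    by apply: Classical_Prop.NNPP => h'; apply: h => s; apply/eqP => e; apply: h'; exists s.
  by exists T, idfun, s; split=> // h'; move: (h' s); rewrite es eqxx.
have sp : size ('X^2 - D%:P) = 3%N by rewrite size_polyDl size_polyXn // size_polyN (leq_ltn_trans (size_polyC_leq1 _)).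
have irr : irreducible_poly ('X^2 - D%:P).
  by apply: cubic_irreducible => [|x]; rewrite ?sp // rootE !hornerE subr_eq0 nsq.
have [L dL [r rr fr]] := irredp_FAdjoin irr.
exists L, (in_alg L), r; split=> [|_ y].
  by move: rr; rewrite rootE rmorphB /= map_polyXn map_polyC !hornerE subr_eq0 => /eqP.
have /Fadjoin_polyP [_ /polyOver1P [q ->] ->] : y \in <<1; r>>%VS by rewrite fr memvf.
rewrite (divp_eq q ('X^2 - D%:P)) rmorphD rmorphM /= hornerD hornerM (rootP rr) mulr0 add0r.
have : (size (q %% ('X^2 - D%:P))%R <= 2)%N.
  by rewrite -ltnS -sp ltn_modp -size_poly_eq0 sp.
set m := q %% _ => sm; exists m`_0, m`_1.
rewrite (@horner_coef_wide _ 2) ?size_map_poly // big_ord_recl big_ord1 !coef_map /=.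
by rewrite mulr1 expr1 mulrC.
Qed.


(** * Fields with three independent generators, and fixed fields of involutions *)

Definition tri (E : fieldType) (y1 y2 y3 : E) : 'I_3 -> E :=
  fun i => nth 0 [:: y1; y2; y3] i.

Definition adjoin3 (K E : fieldType) (iota : {rmorphism K -> E}) (y1 y2 y3 : E) :=
  adjoin iota (fun g => [\/ g = y1, g = y2 | g = y3]).

Definition basis3 (K E : fieldType) (iota : {rmorphism K -> E}) (z1 z2 z3 : E) :=
  indep iota (tri z1 z2 z3) /\ forall f, adjoin3 iota z1 z2 z3 f.

Ltac subfield_closed sL := repeat first
  [ assumption | exact: (subfield1 sL) | exact: (subfield_nat sL)
  | apply: (subfieldD sL) | apply: (subfieldN sL) | apply: (subfieldM sL)
  | apply: (subfieldV sL) | apply: (subfieldX sL) ].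

Lemma Kaut_rmorphism (K E : fieldType) (iota : {rmorphism K -> E}) (s : E -> E) :
  is_Kautomorphism iota s -> exists S : {rmorphism E -> E},
    (forall f, s f = S f) /\ forall k, S (iota k) = iota k.
Proof.
move=> [sZ sM sk _].
pose mZ := GRing.isZmodMorphism.Build _ _ s sZ.
pose mM := GRing.isMonoidMorphism.Build _ _ s sM.
by exists (HB.pack_for {rmorphism E -> E} s mZ mM).
Qed.

Lemma fixed_generated (T : Type) (G : (T -> T) -> Prop) f :
  fixed_by (generated G) f <-> forall g, G g -> g f = f.
Proof.
split=> [h g Gg|h g]; first by apply: h; apply: gen_mem.
elim=> {g} [g /h //|//|g k _ Eg _ Ek|g k _ Eg gk _]; first by rewrite /= Ek.
by rewrite -{1}Eg gk.
Qed.

Lemma purely_transcendental_ext (K F : fieldType) (iota : {rmorphism K -> F})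
    (L L' : F -> Prop) : (forall f, L f <-> L' f) ->
  purely_transcendental iota L <-> purely_transcendental iota L'.
Proof.
by move=> e; split=> -[B [iB hB]]; exists B; split=> // f; rewrite -hB; split=> /e.
Qed.

Section FixedTransfer.
Variables (K E : fieldType) (iota : {rmorphism K -> E}) (X1 X2 X3 : E).
Hypothesis iX : indep iota (tri X1 X2 X3).

Lemma rat_emb3 : exists Phi : {rmorphism ratF K -> E},
  [/\ forall k, Phi (constF k) = iota k, Phi (x1 K) = X1, Phi (x2 K) = X2
    , Phi (x3 K) = X3 & forall f, adjoin3 iota X1 X2 X3 f <-> exists g, f = Phi g].
Proof.
have [Phi [Pk PX]] := rat_emb iX; exists Phi; split; rewrite ?PX //.
move=> f; split=> [Lf|[g ->]].
  have : adjoin iota (fun g => exists2 h, (exists i, h = varF K i) & g = Phi h) f.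
    by apply: adjoin_le Lf => g [] ->; apply: adjoin_mem;
      [exists (x1 K)|exists (x2 K)|exists (x3 K)]; rewrite ?PX //; eexists.
  by case/(adjoin_image Pk) => g _ ->; exists g.
have : adjoin iota (fun f => exists2 h, (exists i, h = varF K i) & f = Phi h) (Phi g).
  by apply/(adjoin_image Pk); exists g => //; apply: ratF_gen.
apply: adjoin_le => _ [_ [i ->] ->]; rewrite PX; apply: adjoin_mem.
by move: i; apply: forall_ord3; [constructor 1|constructor 2|constructor 3].
Qed.

Variable S : {rmorphism E -> E}.
Hypothesis Sk : forall k, S (iota k) = iota k.

(** On K(X1,X2,X3) the map [S] is [s] carried over by the embedding, since both agree on generators.
    In the applications K(X1,X2,X3) is the fixed field of one involution, so that [L] becomes the
    fixed field of the whole group. *)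
Lemma fixed_transfer (s : ratF K -> ratF K) y1 y2 y3 (L : E -> Prop) :
  Kaut_with_values s y1 y2 y3 ->
  (forall Phi : {rmorphism ratF K -> E}, (forall k, Phi (constF k) = iota k) ->
    Phi (x1 K) = X1 -> Phi (x2 K) = X2 -> Phi (x3 K) = X3 ->
    [/\ S X1 = Phi y1, S X2 = Phi y2 & S X3 = Phi y3]) ->
  (forall f, L f <-> adjoin3 iota X1 X2 X3 f /\ S f = f) ->
  purely_transcendental iota L <-> rational (fun f => s f = f).
Proof.
move=> [/Kaut_rmorphism [s' [es sk]] [e1 e2 e3]] hS hL.
have [Phi [Pk P1 P2 P3 Pim]] := rat_emb3; have [S1 S2 S3] := hS Phi Pk P1 P2 P3.
have PS f : Phi (s' f) = S (Phi f).
  apply: (@rat_ext _ _ (Phi \o s') (S \o Phi)) => [k|] /=.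
    by rewrite sk !Pk Sk.
  apply: forall_ord3; rewrite -es.
  - by rewrite -/(x1 K) e1 P1 S1.
  - by rewrite -/(x2 K) e2 P2 S2.
  - by rewrite -/(x3 K) e3 P3 S3.
apply: iff_sym; apply: (purely_transcendental_image Pk) => f; rewrite hL Pim.
split=> [[[g ->]]|[g]].
  by rewrite -PS => /fmorph_inj e; exists g; rewrite // es.
by rewrite es => e ->; split; [exists g|rewrite -PS e].
Qed.

Lemma Ruvw_transfer u v w (L : E -> Prop) : u != 0 -> v != 0 -> w != 0 ->
  S X1 = - X1 -> S X2 = iota u / X2 -> S X3 = (iota w - iota v * X1 ^+ 2) / X3 ->
  (forall f, L f <-> adjoin3 iota X1 X2 X3 f /\ S f = f) ->
  purely_transcendental iota L <-> Ruvw u v w.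
Proof.
move=> u0 v0 w0 S1 S2 S3 hL.
have -> : Ruvw u v w <-> rational (fun f => sigma_uvw u v w f = f).
  apply: purely_transcendental_ext => f; rewrite fixed_generated.
  by split=> [|e g ->] //; apply.
apply: fixed_transfer hL; first exact: sigma_uvw_Kaut.
move=> Phi Pk P1 P2 P3; rewrite S1 S2 S3 !fmorph_div rmorphN rmorphD rmorphM rmorphN.
by rewrite rmorphXn /= !Pk P1 P2 P3 mulNr addrC.
Qed.

End FixedTransfer.

Section FixedQuadratic.
Variables (K E : fieldType) (iota : {rmorphism K -> E}) (z1 z2 z3 X1 X2 X3 t : E).
Variable S : {rmorphism E -> E}.
Hypotheses (two : 2%:R != 0 :> E) (Sk : forall k, S (iota k) = iota k).
Hypothesis gz : forall f, adjoin3 iota z1 z2 z3 f.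
Hypotheses (S1 : S X1 = X1) (S2 : S X2 = X2) (S3 : S X3 = X3) (St : S t = - t).
Hypotheses (t0 : t != 0) (t2 : adjoin3 iota X1 X2 X3 (t ^+ 2)).
Hypothesis zX : forall L, is_subfield L -> (forall k, L (iota k)) ->
  L X1 -> L X2 -> L X3 -> L t -> [/\ L z1, L z2 & L z3].

(** With A = K(X1,X2,X3), the elements p + q t with p, q in A form a subfield that contains the z_i,
    hence all of [E]; invariance under [S] then kills q t. The decomposition takes the place of a
    degree count. *)
Lemma fixed_quadratic f : adjoin3 iota X1 X2 X3 f <-> S f = f.
Proof.
set A := adjoin3 iota X1 X2 X3.
have sA : is_subfield A by apply: adjoin_subfield.
have Afix g : A g -> S g = g.
  move=> Ag; apply: (Ag (fun h => S h = h)) => // [|_ [] -> //].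
  exact: fixed_subfield.
split=> [/Afix//|Sf].
pose Q h := exists p q, [/\ A p, A q & h = p + q * t].
have AQ p : A p -> Q p.
  by move=> Ap; exists p, 0; rewrite mul0r addr0; split=> //; apply: subfield0.
have sQ : is_subfield Q.
  split=> [|_ _ [p [q [Ap Aq ->]]] [p' [q' [Ap' Aq' ->]]]|
      _ _ [p [q [Ap Aq ->]]] [p' [q' [Ap' Aq' ->]]]|_ [p [q [Ap Aq ->]]]].
  - by apply: AQ; apply: (subfield1 sA).
  - by exists (p - p'), (q - q'); split; [subfield_closed sA..|ring].
  - by exists (p * p' + q * q' * t ^+ 2), (p * q' + q * p'); split; [subfield_closed sA..|ring].
  (* The inverse is (p - q t) / (p^2 - q^2 t^2). If the conjugate p - q t vanishes, so does its
     image p + q t under [S], and p = q = 0. *)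
  - have [e|n0] := eqVneq (p - q * t) 0.
      have Sp := Afix p Ap; have Sq := Afix q Aq.
      have : S (p - q * t) = 0 by rewrite e rmorph0.
      rewrite rmorphB rmorphM Sp Sq St => e'.
      have p0 : p = 0.
        apply: (mulfI two); transitivity ((p - q * t) + (p - q * - t)); first by ring.
        by rewrite e e' mulr0 addr0.
      have q0 : q = 0.
        move: e; rewrite p0 sub0r => /eqP; rewrite oppr_eq0 mulf_eq0 (negPf t0) orbF.
        by move/eqP.
      by rewrite p0 q0 mul0r addr0 invr0; apply: AQ; apply: subfield0.
    have [e|n1] := eqVneq (p + q * t) 0.
      by rewrite e invr0; apply: AQ; apply: subfield0.
    exists (p / (p ^+ 2 - q ^+ 2 * t ^+ 2)), (- q / (p ^+ 2 - q ^+ 2 * t ^+ 2)).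
    split; [subfield_closed sA..|].
    have -> : p ^+ 2 - q ^+ 2 * t ^+ 2 = (p + q * t) * (p - q * t) by ring.
    by field; rewrite n0 n1.
have Qk k : Q (iota k) by apply: AQ; apply: adjoin_const.
have QX : [/\ Q X1, Q X2 & Q X3].
  by split; apply: AQ; apply: adjoin_mem; [constructor 1|constructor 2|constructor 3].
have Qt : Q t by exists 0, 1; rewrite mul1r add0r; split=> //; [apply: subfield0|apply: subfield1].
have [Q1 Q2 Q3] := QX; have [Qz1 Qz2 Qz3] := zX sQ Qk Q1 Q2 Q3 Qt.
have [p [q [Ap Aq ef]]] : Q f by apply: (gz f) => // g [] ->.
move: Sf; rewrite ef rmorphD rmorphM St (Afix p Ap) (Afix q Aq) => e.
suff -> : q * t = 0 by rewrite addr0.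
apply: (mulfI two); rewrite mulr0.
transitivity ((p + q * t) - (p + q * - t)); first by ring.
by rewrite e subrr.
Qed.

End FixedQuadratic.

Lemma indep_ext (K F : fieldType) (iota : {rmorphism K -> F}) n (y y' : 'I_n -> F) :
  y =1 y' -> indep iota y -> indep iota y'.
Proof. by move=> e iy p h; apply: iy; rewrite -h; apply: eq_mmap. Qed.

Section BasisChange.
Variables (K E : fieldType) (iota : {rmorphism K -> E}) (z1 z2 z3 : E).
Hypothesis bz : basis3 iota z1 z2 z3.

Lemma basis_le y1 y2 y3 : indep iota (tri y1 y2 y3) ->
  (forall L, is_subfield L -> (forall k, L (iota k)) ->
     L y1 -> L y2 -> L y3 -> [/\ L z1, L z2 & L z3]) -> basis3 iota y1 y2 y3.
Proof.
move=> iy h; split=> // f; apply: adjoin_le (bz.2 f) => g.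
have [] := h (adjoin3 iota y1 y2 y3).
- exact: adjoin_subfield.
- exact: adjoin_const.
- by apply: adjoin_mem; constructor 1.
- by apply: adjoin_mem; constructor 2.
- by apply: adjoin_mem; constructor 3.
by move=> A1 A2 A3 [] ->.
Qed.

Lemma basis_swap12 : basis3 iota z2 z1 z3.
Proof.
apply: basis_le => //.
apply: (@indep_ext _ _ _ _ (tri z1 z2 z3 \o tperm (@Ordinal 3 0 isT) (@Ordinal 3 1 isT))).
  by apply: forall_ord3; rewrite /= ?tpermL ?tpermR ?tpermD.
by apply: indep_reindex bz.1; apply: perm_inj.
Qed.

Lemma basis_swap23 : basis3 iota z1 z3 z2.
Proof.
apply: basis_le => //.
apply: (@indep_ext _ _ _ _ (tri z1 z2 z3 \o tperm (@Ordinal 3 1 isT) (@Ordinal 3 2 isT))).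
  by apply: forall_ord3; rewrite /= ?tpermL ?tpermR ?tpermD.
by apply: indep_reindex bz.1; apply: perm_inj.
Qed.

Lemma basis_neq0 : [/\ z1 != 0, z2 != 0 & z3 != 0].
Proof.
have h (i : 'I_3) : tri z1 z2 z3 i != 0.
  apply/eqP => e; have /bz.1 : mmap iota (tri z1 z2 z3) 'X_i = 0 by rewrite mmapX mmap1U.
  move=> /(congr1 (fun p => p@_U_(i)%MM)).
  by rewrite mcoeffX eqxx mcoeff0 => /eqP; rewrite oner_eq0.
by split; [apply: (h (@Ordinal 3 0 isT))|apply: (h (@Ordinal 3 1 isT))|apply: (h (@Ordinal 3 2 isT))].
Qed.

End BasisChange.

Section SpecTri.
Variables (K E E' : fieldType) (iota : {rmorphism K -> E}) (iota' : {rmorphism K -> E'}).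
Variables (z1 z2 z3 : E) (z1' z2' z3' : E').
Local Notation sp := (specz iota iota' (tri z1 z2 z3) (tri z1' z2' z3')).

Lemma specz1 : sp z1 z1'. Proof. exact: (specz_var _ _ _ _ (@Ordinal 3 0 isT)). Qed.
Lemma specz2 : sp z2 z2'. Proof. exact: (specz_var _ _ _ _ (@Ordinal 3 1 isT)). Qed.
Lemma specz3 : sp z3 z3'. Proof. exact: (specz_var _ _ _ _ (@Ordinal 3 2 isT)). Qed.

Lemma specz_indep3 y1 y2 y3 Y1 Y2 Y3 : indep iota (tri z1 z2 z3) ->
  indep iota' (tri Y1 Y2 Y3) -> sp y1 Y1 -> sp y2 Y2 -> sp y3 Y3 ->
  indep iota (tri y1 y2 y3).
Proof.
move=> iz iY s1 s2 s3; apply: (specz_indep iz iY).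
by apply: forall_ord3; [exact: s1|exact: s2|exact: s3].
Qed.

End SpecTri.


Lemma specz_val (K E E' : fieldType) (iota : {rmorphism K -> E})
    (iota' : {rmorphism K -> E'}) n (z : 'I_n -> E) (z' : 'I_n -> E') f v w :
  specz iota iota' z z' f v -> v = w -> specz iota iota' z z' f w.
Proof. by move=> s <-. Qed.

Ltac spec_eval := repeat first
  [ assumption | eapply specz1 | eapply specz2 | eapply specz3
  | eapply specz_const | eapply spec1 | eapply spec_nat
  | eapply specD | eapply specN | eapply specM | eapply specX ].

Lemma indep_image (K E1 E2 : fieldType) (iota1 : {rmorphism K -> E1})
    (iota2 : {rmorphism K -> E2}) (Phi : {rmorphism E1 -> E2}) n (y : 'I_n -> E1) :
  (forall k, Phi (iota1 k) = iota2 k) -> indep iota1 y -> indep iota2 (Phi \o y).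
Proof.
move=> Pk iy p; rewrite -(mmap_image Pk) => e; apply: iy.
by apply: (fmorph_inj Phi); rewrite e rmorph0.
Qed.

Lemma indep_x (K : fieldType) : indep (@constF K) (tri (x1 K) (x2 K) (x3 K)).
Proof. by apply: indep_ext (@indep_varF K); apply: forall_ord3. Qed.

Lemma basis_x (K : fieldType) : basis3 (@constF K) (x1 K) (x2 K) (x3 K).
Proof.
split; first exact: indep_x.
move=> f; apply: adjoin_le (ratF_gen f) => _ [i ->]; apply: adjoin_mem.
by move: i; apply: forall_ord3; [constructor 1|constructor 2|constructor 3].
Qed.

Lemma sqrt_model (K : fieldType) (D : ratF K) : exists (T : fieldType)
  (j : {rmorphism ratF K -> T}) (r : T), r ^+ 2 = j D /\
  indep (j \o @constF K) (tri (j (x1 K)) (j (x2 K)) (j (x3 K))).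
Proof.
have [T [j [r [er _]]]] := sqrt_ext D; exists T, j, r; split=> //.
apply: (@indep_ext _ _ _ _ (j \o tri (x1 K) (x2 K) (x3 K))); first exact: forall_ord3.
by apply: indep_image (@indep_x K).
Qed.

Section Mobius.
Variables (K E : fieldType) (iota : {rmorphism K -> E}) (z1 z2 z3 : E).
Hypothesis bz : basis3 iota z1 z2 z3.

Lemma basis_inv : basis3 iota z1^-1 z2 z3.
Proof.
have [z10 z20 z30] := basis_neq0 bz.
apply: (basis_le bz) => [|L sL Lk L1 L2 L3]; last by split=> //; rewrite -(invrK z1); apply: (subfieldV sL).
apply: (@specz_indep3 _ _ _ iota iota z1 z2 z3 z1^-1 z2 z3 _ _ _ z1 z2 z3 bz.1 bz.1).
- by rewrite -[X in specz _ _ _ _ _ X]invrK; apply: (specV bz.1); [rewrite invr_eq0|exact: specz1].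
- exact: specz2.
- exact: specz3.
Qed.

(** The map z |-> (1 - z)/(1 + z) is its own inverse, which gives generation directly and
    independence by specialization. It exchanges the actions z |-> -z and z |-> 1/z. *)
Lemma basis_cayley : 2%:R != 0 :> K -> basis3 iota ((1 - z1) / (1 + z1)) z2 z3.
Proof.
move=> two.
have two' : 2%:R != 0 :> E by rewrite -(rmorph_nat iota) fmorph_eq0.
have z0 : 1 + z1 != 0.
  have s : specz iota (idfun : {rmorphism K -> K}) (tri z1 z2 z3) (tri 0 0 0) (1 + z1) 1.
    by eapply specz_val; [spec_eval|rewrite addr0].
  by apply: (spec_neq0 bz.1 s); apply: oner_neq0.
have e : z1 = (1 - (1 - z1) / (1 + z1)) / (1 + (1 - z1) / (1 + z1)).
  have -> : 1 + (1 - z1) / (1 + z1) = 2%:R / (1 + z1) by field.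
  by field; rewrite z0 two'.
apply: (basis_le bz) => [|L sL Lk L1 L2 L3]; last first.
  by split=> //; rewrite e; subfield_closed sL.
apply: (@specz_indep3 _ _ _ iota iota z1 z2 z3 ((1 - z1) / (1 + z1)) z2 z3 _ _ _ z1 z2 z3 bz.1 bz.1).
- rewrite [X in specz _ _ _ _ _ X]e; apply: (spec_div bz.1); [|by spec_eval..].
  have -> : 1 + (1 - z1) / (1 + z1) = 2%:R / (1 + z1) by field.
  by rewrite mulf_neq0 ?invr_eq0.
- exact: specz2.
- exact: specz3.
Qed.

End Mobius.

(** * Coordinates on the fixed field of one involution *)

(* With y2, y3 and w2, w3 the sums and differences of z2, B/z2 and z3, D/z3, the
   coordinates are X1 = w3 / w2 and X3 = (y3 + y2 X1) / 2; since y2^2 - w2^2 = 4B and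
   y3^2 - w3^2 = 4D, the conjugate (y3 - y2 X1) / 2 of X3 is (D - B X1^2) / X3. *)
Section ConicCoordinates.
Variables (K E : fieldType) (iota : {rmorphism K -> E}) (z1 z2 z3 : E).
Variables (B g d : K) (S : {rmorphism E -> E}).
Hypotheses (two : 2%:R != 0 :> K) (B0 : B != 0) (g0 : g != 0).
Hypotheses (bz : basis3 iota z1 z2 z3) (Sk : forall k, S (iota k) = iota k).

Let D := iota g - iota d * z1 ^+ 2.
Let X1 := (z3 - D / z3) / (z2 - iota B / z2).
Let X3 := ((z3 + D / z3) + (z2 + iota B / z2) * X1) / 2%:R.

Hypotheses (S1 : S z1 = z1) (S2 : S z2 = iota B / z2) (S3 : S z3 = D / z3).

Let two' : 2%:R != 0 :> E.
Proof. by rewrite -(rmorph_nat iota) fmorph_eq0. Qed.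

Let nz t f v : specz iota (idfun : {rmorphism K -> K}) (tri z1 z2 z3) (tri 0 0 t) f v ->
  v != 0 -> f != 0.
Proof. exact: (spec_neq0 bz.1). Qed.

Lemma conic_D0 : D != 0.
Proof. by apply: (@nz 0 _ g) => //; eapply specz_val; [spec_eval|rewrite /=; ring]. Qed.

Lemma conic_w2q : z2 * z2 - iota B != 0.
Proof.
apply: (@nz 0 _ (- B)); last by rewrite oppr_eq0.
by eapply specz_val; [spec_eval|rewrite /=; ring].
Qed.

Lemma conic_w2 : z2 - iota B / z2 != 0.
Proof.
have [_ z20 _] := basis_neq0 bz; have := conic_w2q.
by apply: contra => /eqP e; apply/eqP; transitivity (z2 * (z2 - iota B / z2)); [field|rewrite e mulr0].
Qed.

Lemma conic_w3 : z3 - D / z3 != 0.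
Proof.
have [_ _ z30] := basis_neq0 bz.
have : z3 ^+ 2 - D != 0.
  apply: (@nz 0 _ (- g)); last by rewrite oppr_eq0.
  by eapply specz_val; [spec_eval|rewrite /=; ring].
by apply: contra => /eqP e; apply/eqP; transitivity (z3 * (z3 - D / z3)); [field|rewrite e mulr0].
Qed.

Lemma conic_norm : X3 * (((z3 + D / z3) - (z2 + iota B / z2) * X1) / 2%:R) =
  D - iota B * X1 ^+ 2.
Proof.
have [_ z20 z30] := basis_neq0 bz; have w20 := conic_w2.
apply: (mulIf (expf_neq0 2 w20)); rewrite /X3 /X1; field; by rewrite two' z20 z30 conic_w2q.
Qed.

Lemma conic_X1_neq0 : X1 != 0.
Proof. by rewrite mulf_neq0 ?invr_eq0 ?conic_w2 ?conic_w3. Qed.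

Lemma conic_norm_neq0 : D - iota B * X1 ^+ 2 != 0.
Proof.
have [_ z20 z30] := basis_neq0 bz; have w20 := conic_w2.
have h : D * (z2 ^+ 2 + iota B) ^+ 2 * z3 ^+ 2 - iota B * (z3 ^+ 2 + D) ^+ 2 * z2 ^+ 2 != 0.
  (* The point is (0,0,1) because both terms vanish at the origin. *)
  apply: (@nz 1 _ (g * B ^+ 2)); last by rewrite mulf_neq0 ?expf_neq0.
  by eapply specz_val; [spec_eval|rewrite /=; ring].
apply: contra h => /eqP e; apply/eqP.
transitivity ((D - iota B * X1 ^+ 2) * ((z2 - iota B / z2) * z2 * z3) ^+ 2); last by rewrite e mul0r.
rewrite /X1; field; by rewrite z20 z30 conic_w2q.
Qed.

Lemma conic_X3_neq0 : X3 != 0.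
Proof.
by apply: contra conic_norm_neq0 => /eqP e; rewrite -conic_norm e mul0r.
Qed.

Lemma conic_conj : ((z3 + D / z3) - (z2 + iota B / z2) * X1) / 2%:R =
  (D - iota B * X1 ^+ 2) / X3.
Proof. by rewrite -conic_norm [RHS]mulrAC mulfV ?mul1r // conic_X3_neq0. Qed.

Lemma conic_fixed f : adjoin3 iota X1 z1 X3 f <-> S f = f.
Proof.
have [z10 z20 z30] := basis_neq0 bz; have w20 := conic_w2; have D0 := conic_D0.
have X10 := conic_X1_neq0; have X30 := conic_X3_neq0.
have SD : S D = D by rewrite rmorphB rmorphM rmorphXn !Sk S1.
(* The conjugate of X3 is (D - B X1^2)/X3, so y2 = z2 + B/z2 lies in K(X1,z1,X3). The quadratic
   generator is t, with t^2 = y2^2 - 4B and z3 - D/z3 = X1 t. *)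
pose t := z2 - iota B / z2; pose y2 := (X3 - (D - iota B * X1 ^+ 2) / X3) / X1.
have ey2 : y2 = z2 + iota B / z2.
  rewrite /y2 -conic_conj.
  have -> : X3 - (z3 + D / z3 - (z2 + iota B / z2) * X1) / 2%:R = (z2 + iota B / z2) * X1.
    rewrite /X3; field; by rewrite z20 z30 two'.
  by rewrite mulfK.
have Bk0 : iota B != 0 by rewrite fmorph_eq0.
have St : S t = - t by rewrite /t rmorphB fmorph_div Sk S2; field; rewrite z20.
have Sw3 : S (z3 - D / z3) = - (z3 - D / z3).
  by rewrite rmorphB fmorph_div SD S3; field; rewrite z30 D0.
have SX1 : S X1 = X1 by rewrite /X1 fmorph_div Sw3 St invrN mulrNN.
have SX3 : S X3 = X3.
  rewrite /X3 fmorph_div rmorph_nat rmorphD rmorphM SX1 !rmorphD !fmorph_div SD Sk S2 S3.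
  by congr ((_ + _ * _) / _); field; rewrite ?z20 ?z30 ?D0 ?Bk0.
have LD L : is_subfield L -> (forall k, L (iota k)) -> L z1 -> L D.
  by move=> sL Lk L1; rewrite /D; subfield_closed sL.
have Ly2 L : is_subfield L -> (forall k, L (iota k)) -> L z1 -> L X1 -> L X3 -> L y2.
  by move=> sL Lk L1 LX1 LX3; have := LD L sL Lk L1 => LD'; rewrite /y2; subfield_closed sL.
apply: (@fixed_quadratic _ _ iota z1 z2 z3 X1 z1 X3 t S) => // [||L sL Lk LX1 L1 LX3 Lt]; first exact: bz.2.
- have sA := adjoin_subfield iota (fun g => [\/ g = X1, g = z1 | g = X3]).
  have -> : t ^+ 2 = y2 ^+ 2 - 4%:R * iota B by rewrite ey2 /t; field; rewrite z20.
  have : adjoin3 iota X1 z1 X3 y2.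
    apply: (Ly2 (adjoin3 iota X1 z1 X3)) => //; first exact: adjoin_const.
    + by apply: adjoin_mem; constructor 2.
    + by apply: adjoin_mem; constructor 1.
    + by apply: adjoin_mem; constructor 3.
  move=> Ay2; have Ak := @adjoin_const _ _ iota (fun g => [\/ g = X1, g = z1 | g = X3]).
  rewrite /adjoin3; subfield_closed sA; exact: Ak.
- have Ly := Ly2 L sL Lk L1 LX1 LX3; have LDD := LD L sL Lk L1; split=> //.
  + have -> : z2 = (y2 + t) / 2%:R by rewrite ey2 /t; field; rewrite z20 two'.
    by subfield_closed sL.
  + have -> : z3 = (X3 + (D - iota B * X1 ^+ 2) / X3 + X1 * t) / 2%:R.
      have eXt : X1 * t = z3 - D / z3 by rewrite divfK.
      by rewrite -conic_conj eXt /X3; field; rewrite z20 z30 two'.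
    by subfield_closed sL.
Qed.

Lemma conic_indep : indep iota (tri X1 z1 X3).
Proof.
pose U1 := x1 K; pose U2 := x2 K; pose U3 := x3 K.
pose DD : ratF K := constF g - constF d * U2 ^+ 2.
pose V3 := (DD - constF B * U1 ^+ 2) / U3; pose Y2 := (U3 - V3) / U1.
(* If X1, z1, X3 are to take the values [U1], [U2], [U3], then z2 + B/z2 must become [Y2], and a
   root [r] of Y2^2 - 4B plays the part of z2 - B/z2. The values of z2 and z3 then follow
   linearly. *)
have [T [j [r [er iT]]]] := sqrt_model (Y2 ^+ 2 - 4%:R * constF B).
set io := (j \o @constF K) in iT *.
pose u1 := j U1; pose u2 := j U2; pose u3 := j U3.
have two2 : 2%:R != 0 :> T by rewrite -(rmorph_nat io) fmorph_eq0.
have nzT t f v : specz io (idfun : {rmorphism K -> K}) (tri u1 u2 u3) (tri 0 0 t) f v ->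
  v != 0 -> f != 0 by exact: (spec_neq0 iT).
have n1 : u1 != 0 by rewrite fmorph_eq0 varF_neq0.
have n3 : u3 != 0 by rewrite fmorph_eq0 varF_neq0.
pose D' := io g - io d * u2 ^+ 2; pose v3 := (D' - io B * u1 ^+ 2) / u3.
pose y2 := (u3 - v3) / u1.
have ejy : j Y2 = y2.
  by rewrite /Y2 /V3 !(rmorphB, rmorphXn, rmorphM, fmorphV).
have er2 : r ^+ 2 = y2 ^+ 2 - 4%:R * io B.
  by rewrite er rmorphB rmorphXn ejy rmorphM rmorph_nat.
have D'0 : D' != 0.
  by apply: (@nzT 0 _ g) => //; eapply specz_val; [spec_eval|rewrite /=; ring].
have r0 : r != 0.
  have : (u3 ^+ 2 - (D' - io B * u1 ^+ 2)) ^+ 2 - 4%:R * io B * u1 ^+ 2 * u3 ^+ 2 != 0.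
    apply: (@nzT 0 _ (g ^+ 2)); last by rewrite expf_neq0.
    by eapply specz_val; [spec_eval|rewrite /=; ring].
  apply: contra => /eqP e; apply/eqP; transitivity (r ^+ 2 * (u1 * u3) ^+ 2); last by rewrite e expr0n mul0r.
  by rewrite er2 /y2 /v3; field; rewrite n1 n3.
pose z2' := (y2 + r) / 2%:R; pose z3' := (u3 + v3 + u1 * r) / 2%:R.
have e2 : z2' * ((y2 - r) / 2%:R) = io B.
  transitivity ((y2 ^+ 2 - r ^+ 2) / 4%:R); last first.
    rewrite er2; field; by rewrite (natrM _ 2 2) mulf_neq0.
  by rewrite /z2'; field; rewrite (natrM _ 2 2) mulf_neq0.
have e3 : z3' * ((u3 + v3 - u1 * r) / 2%:R) = D'.
  transitivity (((u3 + v3) ^+ 2 - u1 ^+ 2 * r ^+ 2) / 4%:R); first by rewrite /z3'; field; rewrite (natrM _ 2 2) mulf_neq0.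
  rewrite er2 /y2 /v3; field; by rewrite n1 n3 (natrM _ 2 2) mulf_neq0.
have B'0 : io B != 0 by rewrite fmorph_eq0.
have z2'0 : z2' != 0 by apply: contra B'0 => /eqP e; rewrite -e2 e mul0r.
have z3'0 : z3' != 0 by apply: contra D'0 => /eqP e; rewrite -e3 e mul0r.
have f2 : io B / z2' = (y2 - r) / 2%:R by rewrite -e2 mulrC mulKf.
have f3 : D' / z3' = (u3 + v3 - u1 * r) / 2%:R by rewrite -e3 mulrC mulKf.
have w2' : z2' - io B / z2' = r by rewrite f2 /z2'; field.
have w3' : z3' - D' / z3' = u1 * r by rewrite f3 /z3'; field.
have sD : specz iota io (tri z1 z2 z3) (tri u2 z2' z3') D D' by spec_eval.
have s2 : specz iota io (tri z1 z2 z3) (tri u2 z2' z3') (iota B / z2) (io B / z2').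
  by apply: (spec_div bz.1 z2'0); spec_eval.
have s3 : specz iota io (tri z1 z2 z3) (tri u2 z2' z3') (D / z3) (D' / z3').
  by apply: (spec_div bz.1 z3'0); spec_eval.
have s1 : specz iota io (tri z1 z2 z3) (tri u2 z2' z3') X1 u1.
  have -> : u1 = (z3' - D' / z3') / (z2' - io B / z2') by rewrite w2' w3' mulfK.
  by apply: (spec_div bz.1); [rewrite w2'|spec_eval|spec_eval].
apply: (specz_indep3 bz.1 iT s1 (specz1 _ _ _ _ _ _ _ _)).
rewrite -[j (x3 K)]/u3.
have -> : u3 = ((z3' + D' / z3') + (z2' + io B / z2') * u1) / 2%:R.
  have -> : z3' + D' / z3' = u3 + v3 by rewrite f3 /z3'; field.
  have -> : z2' + io B / z2' = y2 by rewrite f2 /z2'; field.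
  by rewrite divfK //; field.
by apply: (spec_div bz.1) => //; spec_eval.
Qed.

End ConicCoordinates.


Lemma rational_adjoin3 (K E : fieldType) (iota : {rmorphism K -> E}) X1 X2 X3
    (L : E -> Prop) : indep iota (tri X1 X2 X3) ->
  (forall f, L f <-> adjoin3 iota X1 X2 X3 f) -> purely_transcendental iota L.
Proof.
move=> iX hL; have [Phi [Pk _ _ _ Pim]] := rat_emb3 iX.
apply/(@purely_transcendental_image _ _ _ _ _ Phi Pk (fun _ => True)); last exact: rational_full.
by move=> f; rewrite hL Pim; split=> [[g ->]|[g _ ->]]; exists g.
Qed.

(** * The second involution in conic coordinates *)

Section ConicApplications.
Variables (K E : fieldType) (iota : {rmorphism K -> E}) (z1 z2 z3 : E).
Variables (al B g e f : K) (S T : {rmorphism E -> E}) (L : E -> Prop).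
Hypotheses (two : 2%:R != 0 :> K) (al0 : al != 0) (B0 : B != 0) (g0 : g != 0).
Hypotheses (e2 : e ^+ 2 = 1) (f2 : f ^+ 2 = 1).
Hypotheses (bz : basis3 iota z1 z2 z3).
Hypotheses (Sk : forall k, S (iota k) = iota k) (Tk : forall k, T (iota k) = iota k).
Hypotheses (S1 : S z1 = z1) (S2 : S z2 = iota B / z2) (S3 : S z3 = iota g / z3).
Hypotheses (T1 : T z1 = iota al / z1) (T2 : T z2 = iota e * z2)
  (T3 : T z3 = iota (f * g) / z3).
Hypothesis hL : forall h, L h <-> S h = h /\ T h = h.

Let D := iota g - iota 0 * z1 ^+ 2.
Let X1 := (z3 - D / z3) / (z2 - iota B / z2).
Let X3 := ((z3 + D / z3) + (z2 + iota B / z2) * X1) / 2%:R.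

Let DE : D = iota g. Proof. by rewrite /D rmorph0 mul0r subr0. Qed.
Let S3' : S z3 = D / z3. Proof. by rewrite DE. Qed.

Let unit_neq0 (h : K) : h ^+ 2 = 1 -> h != 0.
Proof. by move=> h2; apply/eqP => h0; move/eqP: h2; rewrite h0 expr0n eq_sym oner_eq0. Qed.
Let inv_unit (h : K) : h ^+ 2 = 1 -> (iota h)^-1 = iota h.
Proof.
move=> h2; have h0 : iota h != 0 by rewrite fmorph_eq0 unit_neq0.
by apply: (mulfI h0); rewrite mulfV // -rmorphM -expr2 h2 rmorph1.
Qed.

Lemma conic_T_X1 : T X1 = - iota (e * f) * X1.
Proof.
have [z10 z20 z30] := basis_neq0 bz.
have gk0 : iota g != 0 by rewrite fmorph_eq0.
have fk0 : iota f != 0 by rewrite fmorph_eq0 unit_neq0.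
have ek0 : iota e != 0 by rewrite fmorph_eq0 unit_neq0.
have Tw3 : T (z3 - D / z3) = - iota f * (z3 - D / z3).
  rewrite rmorphB fmorph_div DE Tk T3 rmorphM.
  transitivity (iota f * (iota g / z3) - (iota f)^-1 * z3); first by field; rewrite z30 gk0 fk0.
  by rewrite inv_unit //; ring.
have Tw2 : T (z2 - iota B / z2) = iota e * (z2 - iota B / z2).
  rewrite rmorphB fmorph_div Tk T2.
  transitivity (iota e * z2 - (iota e)^-1 * (iota B / z2)); first by field; rewrite z20 ek0.
  by rewrite inv_unit //; ring.
rewrite /X1 fmorph_div Tw3 Tw2 invfM inv_unit // rmorphM; ring.
Qed.

(** [T] multiplies y2 by e, y3 by f and X1 by -ef, so X3 = (y3 + y2 X1)/2 goes to f times its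
    conjugate (y3 - y2 X1)/2. *)
Lemma conic_T_X3 : T X3 = (iota (f * g) - iota (f * B) * X1 ^+ 2) / X3.
Proof.
have [z10 z20 z30] := basis_neq0 bz.
have gk0 : iota g != 0 by rewrite fmorph_eq0.
have fk0 : iota f != 0 by rewrite fmorph_eq0 unit_neq0.
have ek0 : iota e != 0 by rewrite fmorph_eq0 unit_neq0.
have Ty3 : T (z3 + D / z3) = iota f * (z3 + D / z3).
  rewrite rmorphD fmorph_div DE Tk T3 rmorphM.
  transitivity (iota f * (iota g / z3) + (iota f)^-1 * z3); first by field; rewrite z30 gk0 fk0.
  by rewrite inv_unit //; ring.
have Ty2 : T (z2 + iota B / z2) = iota e * (z2 + iota B / z2).
  rewrite rmorphD fmorph_div Tk T2.
  transitivity (iota e * z2 + (iota e)^-1 * (iota B / z2)); first by field; rewrite z20 ek0.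
  by rewrite inv_unit //; ring.
transitivity (iota f * (((z3 + D / z3) - (z2 + iota B / z2) * X1) / 2%:R)).
  rewrite /X3 fmorph_div rmorph_nat rmorphD rmorphM Ty3 Ty2 conic_T_X1 rmorphM.
  have ee : iota e * iota e = 1 by rewrite -rmorphM -expr2 e2 rmorph1.
  transitivity ((iota f * (z3 + D / z3) - (iota e * iota e) * iota f * ((z2 + iota B / z2) * X1)) / 2%:R).
    by congr (_ / _); ring.
  by rewrite ee mul1r -mulrBr mulrA.
rewrite (conic_conj 0 two B0 g0 bz) -/D -/X1 -/X3 {1}DE !rmorphM; ring.
Qed.

Let adjoin_hL h : L h <-> adjoin3 iota X1 z1 X3 h /\ T h = h.
Proof. by rewrite hL (conic_fixed two B0 g0 bz Sk S1 S2 S3'). Qed.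

Let iX : indep iota (tri X1 z1 X3).
Proof. exact: conic_indep. Qed.

Lemma conic_Ruvw : e = f -> purely_transcendental iota L <-> Ruvw al (f * B) (f * g).
Proof.
move=> ef; apply: (Ruvw_transfer iX Tk _ _ _ _ T1 conic_T_X3 adjoin_hL) => //.
- by rewrite mulf_neq0 // unit_neq0.
- by rewrite mulf_neq0 // unit_neq0.
- by rewrite conic_T_X1 ef -expr2 f2 rmorph1 mulN1r.
Qed.

End ConicApplications.

Section TwistedInvolution.
Variables (K : fieldType) (p q r : K).
Hypotheses (two : 2%:R != 0 :> K) (p0 : p != 0) (q0 : q != 0).

Definition sigma_pqr : ratF K -> ratF K :=
  subst3 (x1 K) (constF p / x2 K) ((constF q - constF r * x1 K ^+ 2) / x3 K).

Lemma sigma_pqr_Kaut : Kaut_with_values sigma_pqr (x1 K) (constF p / x2 K)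
  ((constF q - constF r * x1 K ^+ 2) / x3 K).
Proof.
apply: subst3_Kaut; apply: forall_ord3.
- by apply: (ext_inv_var_scale (e := 1)); rewrite ?expr1n // rmorph1 mul1r.
- exact: (ext_inv_var_div (k := p)).
- pose i0 := @Ordinal 3 0 isT.
  pose m : {mpoly K[3]} := q%:MP - r%:MP * 'X_i0 ^+ 2.
  have taum : m%:F = constF q - constF r * x1 K ^+ 2.
    by rewrite /m tofracB tofracM tofracXn.
  apply: (@ext_inv_div _ _ _ _ m).
  + by rewrite /= taum /m rmorphB rmorphM rmorphXn /= !mmapC mmapX mmap1U.
  + rewrite /= taum; exact: (conic_D0 r q0 (@basis_x K)).
  + exact: varF_neq0.
  + by rewrite /= taum mmapX mmap1U.
Qed.

(** This is the use for which D may depend on z1 in the conic coordinates: here [d = r], whereas the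
    monomial actions have [d = 0]. *)
Lemma sigma_pqr_rational : rational (fun f => sigma_pqr f = f).
Proof.
have [/Kaut_rmorphism [s [es sk]] [e1 e2 e3]] := sigma_pqr_Kaut.
rewrite es in e1; rewrite es in e2; rewrite es in e3.
apply: (rational_adjoin3 (conic_indep (d := r) two p0 q0 (@basis_x K))) => f.
by rewrite (conic_fixed two p0 q0 (@basis_x K) sk e1 e2 e3) es.
Qed.

End TwistedInvolution.

(** For e = -f the factor -ef equals 1, so [T] fixes X1 and acts on K(X1,z1,X3) as a [sigma_pqr],
    whose fixed field is rational. *)
Lemma conic_rational (K E : fieldType) (iota : {rmorphism K -> E}) (z1 z2 z3 : E)
    (al B g e f : K) (S T : {rmorphism E -> E}) (L : E -> Prop) :
  2%:R != 0 :> K -> al != 0 -> B != 0 -> g != 0 -> f ^+ 2 = 1 ->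
  basis3 iota z1 z2 z3 ->
  (forall k, S (iota k) = iota k) -> (forall k, T (iota k) = iota k) ->
  S z1 = z1 -> S z2 = iota B / z2 -> S z3 = iota g / z3 ->
  T z1 = iota al / z1 -> T z2 = iota e * z2 -> T z3 = iota (f * g) / z3 ->
  (forall h, L h <-> S h = h /\ T h = h) ->
  e = - f -> purely_transcendental iota L.
Proof.
move=> two al0 B0 g0 f2 bz Sk Tk S1 S2 S3 T1 T2 T3 hL ef.
have e2 : e ^+ 2 = 1 by rewrite ef sqrrN.
have f0 : f != 0 by apply/eqP => h0; move/eqP: f2; rewrite h0 expr0n eq_sym oner_eq0.
have S3' : S z3 = (iota g - iota 0 * z1 ^+ 2) / z3 by rewrite rmorph0 mul0r subr0.
have fg0 : f * g != 0 by rewrite mulf_neq0.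
have TX1 := conic_T_X1 B g0 e2 f2 bz Tk T2 T3.
have TX3 := conic_T_X3 two B0 g0 e2 f2 bz Tk T2 T3.
apply/(fixed_transfer (conic_indep (d := 0) two B0 g0 bz) Tk (sigma_pqr_Kaut (f * B) al0 fg0)).
- move=> Phi Pk P1 P2 P3.
  rewrite TX1 TX3 T1 !(fmorph_div Phi) (rmorphB Phi) (rmorphM Phi) (rmorphXn Phi) /= !Pk P1 P2 P3; split=> //.
  have -> : e * f = -1 by rewrite ef mulNr -expr2 f2.
  by rewrite rmorphN1 opprK mul1r.
- by move=> h; rewrite hL (conic_fixed two B0 g0 bz Sk S1 S2 S3').
exact: sigma_pqr_rational.
Qed.



(** * Symmetries of R(u,v,w) *)

Definition acts_uvw (K E : fieldType) (iota : {rmorphism K -> E}) (u v w : K)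
    (S : {rmorphism E -> E}) (z1 z2 z3 : E) : Prop :=
  [/\ S z1 = - z1, S z2 = iota u / z2 & S z3 = (iota w - iota v * z1 ^+ 2) / z3].

Lemma Ruvw_acts (K E : fieldType) (iota : {rmorphism K -> E}) (u v w : K)
    (S : {rmorphism E -> E}) (z1 z2 z3 : E) : u != 0 -> v != 0 -> w != 0 ->
  (forall k, S (iota k) = iota k) -> basis3 iota z1 z2 z3 ->
  acts_uvw iota u v w S z1 z2 z3 ->
  purely_transcendental iota (fun f => S f = f) <-> Ruvw u v w.
Proof.
move=> u0 v0 w0 Sk [iz gz] [S1 S2 S3].
by apply: (Ruvw_transfer iz Sk u0 v0 w0 S1 S2 S3) => f; split=> [//|[]].
Qed.

Lemma Ruvw_basis (K : fieldType) (u v w u' v' w' : K) :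
  u != 0 -> v != 0 -> w != 0 -> u' != 0 -> v' != 0 -> w' != 0 ->
  (forall (E : fieldType) (iota : {rmorphism K -> E}) (S : {rmorphism E -> E}) z1 z2 z3,
    (forall k, S (iota k) = iota k) -> basis3 iota z1 z2 z3 ->
    acts_uvw iota u v w S z1 z2 z3 ->
    exists y1 y2 y3, basis3 iota y1 y2 y3 /\ acts_uvw iota u' v' w' S y1 y2 y3) ->
  Ruvw u v w <-> Ruvw u' v' w'.
Proof.
move=> u0 v0 w0 u0' v0' w0' h.
have [/Kaut_rmorphism [S [es Sk]] [e1 e2 e3]] := sigma_uvw_Kaut u0 v0 w0.
have ac : acts_uvw (@constF K) u v w S (x1 K) (x2 K) (x3 K).
  by split; rewrite -es // e3 mulNr addrC.
have [y1 [y2 [y3 [by' ac']]]] := h _ _ S _ _ _ Sk (@basis_x K) ac.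
by rewrite -(Ruvw_acts u0 v0 w0 Sk (@basis_x K) ac) -(Ruvw_acts u0' v0' w0' Sk by' ac').
Qed.

Section RuvwSymmetry.
Variable K : fieldType.
Implicit Types u v w s : K.

(** Dividing z3 by z1 divides z3 S(z3) by z1 S(z1) = -z1^2, and (w - v z1^2)/(-z1^2) = v - w
    (1/z1)^2. *)
Lemma Ruvw_swap23 u v w : u != 0 -> v != 0 -> w != 0 ->
  Ruvw u v w <-> Ruvw u w v.
Proof.
move=> u0 v0 w0; apply: Ruvw_basis => // E iota S z1 z2 z3 Sk bz [S1 S2 S3].
have [n1 n2 n3] := basis_neq0 bz.
exists z1^-1, z2, (z3 / z1); split; last first.
  by rewrite /acts_uvw fmorphV fmorph_div S1 S2 S3; split=> //; field; rewrite ?oppr_eq0 ?n1 ?n3.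
apply: (basis_le bz) => [|L sL Lk L1 L2 L3].
  apply: (@specz_indep3 _ _ _ iota iota z1 z2 z3 z1^-1 z2 (z3 / z1) _ _ _ z1 z2 z3 bz.1 bz.1).
  - by rewrite -[X in specz _ _ _ _ _ X]invrK; apply: (specV bz.1); [rewrite invr_eq0|exact: specz1].
  - exact: specz2.
  - rewrite [X in specz _ _ _ _ _ X](_ : _ = z3 / z1 / z1^-1); last by rewrite invrK divfK.
    by apply: (spec_div bz.1); [rewrite invr_eq0|exact: specz3|exact: specz1].
split=> //; first by rewrite -(invrK z1); apply: (subfieldV sL).
by rewrite (_ : z3 = z3 / z1 / z1^-1); [subfield_closed sL|rewrite invrK divfK].
Qed.

(** Since z2 S(z2) = u, replacing z3 by z2 z3 multiplies z3 S(z3) by u. *)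
Lemma Ruvw_mul u v w : u != 0 -> v != 0 -> w != 0 ->
  Ruvw u v w <-> Ruvw u (u * v) (u * w).
Proof.
move=> u0 v0 w0; apply: Ruvw_basis; rewrite ?mulf_neq0 // => E iota S z1 z2 z3 Sk bz [S1 S2 S3].
have [n1 n2 n3] := basis_neq0 bz.
exists z1, z2, (z2 * z3); split; last first.
  by rewrite /acts_uvw (rmorphM S) S1 S2 S3 !rmorphM; split=> //; field; rewrite n2 n3.
apply: (basis_le bz) => [|L sL Lk L1 L2 L3].
  apply: (@specz_indep3 _ _ _ iota iota z1 z2 z3 z1 z2 (z3 / z2) _ _ _ z1 z2 z3 bz.1 bz.1); [exact: specz1|exact: specz2|].
  rewrite [X in specz _ _ _ _ _ X](_ : _ = z2 * (z3 / z2)); last by field.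
  by apply: specM; [exact: specz2|exact: specz3].
by split=> //; rewrite (_ : z3 = z2 * z3 / z2); [subfield_closed sL|field].
Qed.

Lemma Ruvw_scale s u v w : s != 0 -> u != 0 -> v != 0 -> w != 0 ->
  Ruvw u (s ^+ 2 * v) w <-> Ruvw u v w.
Proof.
move=> s0 u0 v0 w0; apply: Ruvw_basis; rewrite ?mulf_neq0 ?expf_neq0 // => E iota S z1 z2 z3 Sk bz [S1 S2 S3].
have [n1 n2 n3] := basis_neq0 bz; have sk : iota s != 0 by rewrite fmorph_eq0.
exists (iota s * z1), z2, z3; split; last first.
  by rewrite /acts_uvw (rmorphM S) Sk S1 S2 S3 rmorphM rmorphXn; split=> //; [ring|field].
apply: (basis_le bz) => [|L sL Lk L1 L2 L3].
  apply: (@specz_indep3 _ _ _ iota iota z1 z2 z3 (z1 / iota s) z2 z3 _ _ _ z1 z2 z3 bz.1 bz.1); [|exact: specz2|exact: specz3].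
  rewrite [X in specz _ _ _ _ _ X](_ : _ = iota s * (z1 / iota s)); last by field.
  by apply: specM; [exact: specz_const|exact: specz1].
split=> //; rewrite (_ : z1 = iota s * z1 / iota s); last by field.
by apply: (subfield_div sL).
Qed.

(** Both sides express the rationality of one fixed field, that of two involutions of which [S]
    fixes x1 and [T] fixes x2. Conic coordinates for [S] lead to R(u,v,w), those for [T] to
    R(v,u,w). *)
Lemma Ruvw_swap12 u v w : 2%:R != 0 :> K -> u != 0 -> v != 0 -> w != 0 ->
  Ruvw u v w <-> Ruvw v u w.
Proof.
move=> two u0 v0 w0.
have o2 : 1 ^+ 2 = 1 :> K by rewrite expr1n.
have [/Kaut_rmorphism [S [es Sk]] [S1 S2 S3]] := sigma1_Kaut v0 w0 o2.
have [/Kaut_rmorphism [T [et Tk]] [T1 T2 T3]] := sigma2_Kaut u0 w0 o2 (oner_neq0 K).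
rewrite !es rmorph1 mul1r in S1 S2 S3; rewrite !et rmorph1 mul1r in T1 T2 T3.
pose L f := S f = f /\ T f = f.
rewrite -(mul1r v) -(mul1r w).
transitivity (purely_transcendental (@constF K) L).
  apply: iff_sym; apply: (conic_Ruvw (e := 1) two u0 v0 w0 o2 o2 (@basis_x K) Sk Tk S1 S2 S3 T1) => //.
  by rewrite rmorph1 mul1r.
rewrite -{1}(mul1r u) mul1r.
apply: (conic_Ruvw (e := 1) two v0 u0 w0 o2 o2 (basis_swap12 (@basis_x K)) Tk Sk) => //.
- by rewrite mul1r in T3.
- by rewrite rmorph1 mul1r.
- by rewrite mul1r.
- by move=> h; split=> -[].
Qed.
End RuvwSymmetry.


(** * Coordinates when no involution of the group fixes a variable *)

Section CayleyCoordinates.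
Variables (K E : fieldType) (iota : {rmorphism K -> E}) (z1 z2 z3 : E).
Variables (B g : K) (S T : {rmorphism E -> E}) (L : E -> Prop).
Hypotheses (two : 2%:R != 0 :> K) (B0 : B != 0) (g0 : g != 0).
Hypotheses (bz : basis3 iota z1 z2 z3).
Hypotheses (Sk : forall k, S (iota k) = iota k) (Tk : forall k, T (iota k) = iota k).
Hypotheses (S1 : S z1 = - z1) (S2 : S z2 = - z2) (S3 : S z3 = - iota g / z3).
Hypotheses (T1 : T z1 = z1^-1) (T2 : T z2 = iota B / z2) (T3 : T z3 = iota g / z3).
Hypothesis hL : forall h, L h <-> S h = h /\ T h = h.

Let X1 := (z3 - iota g / z3) / 2%:R.
Let X2 := z1 * z2.
Let X3 := z1 * ((z3 + iota g / z3) / 2%:R).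

Let two' : 2%:R != 0 :> E.
Proof. by rewrite -(rmorph_nat iota) fmorph_eq0. Qed.

Let gk0 : iota g != 0. Proof. by rewrite fmorph_eq0. Qed.

Let w_neq0 : (z3 + iota g / z3) / 2%:R != 0.
Proof.
have [_ _ z30] := basis_neq0 bz; rewrite mulf_neq0 ?invr_eq0 //.
have : z3 ^+ 2 + iota g != 0.
  have s : specz iota (idfun : {rmorphism K -> K}) (tri z1 z2 z3) (tri 0 0 0) (z3 ^+ 2 + iota g) g.
    by eapply specz_val; [spec_eval|rewrite /=; ring].
  exact: (spec_neq0 bz.1 s).
by apply: contra => /eqP e; apply/eqP; transitivity (z3 * (z3 + iota g / z3)); [field|rewrite e mulr0].
Qed.

Let w_sqr : ((z3 + iota g / z3) / 2%:R) ^+ 2 = X1 ^+ 2 + iota g.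
Proof.
have [_ _ z30] := basis_neq0 bz.
by rewrite /X1; field; rewrite z30 two'.
Qed.

Lemma cayley_indep : indep iota (tri X1 X2 X3).
Proof.
(* The root [r] stands for w = (z3 + g/z3)/2, whose square is X1^2 + g. Then z3 = u1 + r, z1 = u3/r
   and z2 = u2 r/u3. *)
have [T' [j [r [er iT]]]] := sqrt_model (x1 K ^+ 2 + constF g).
set io := (j \o @constF K) in iT *.
pose u1 := j (x1 K); pose u2 := j (x2 K); pose u3 := j (x3 K).
have two2 : 2%:R != 0 :> T' by rewrite -(rmorph_nat io) fmorph_eq0.
have n3 : u3 != 0 by rewrite fmorph_eq0 varF_neq0.
have er2 : r ^+ 2 = u1 ^+ 2 + io g by rewrite er rmorphD rmorphXn.
have r0 : r != 0.
  have s : specz io (idfun : {rmorphism K -> K}) (tri u1 u2 u3) (tri 0 0 0) (u1 ^+ 2 + io g) g.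
    by eapply specz_val; [spec_eval|rewrite /=; ring].
  by have := spec_neq0 iT s g0; rewrite -er2 expf_eq0.
have e3 : (u1 + r) * (r - u1) = io g.
  by transitivity (r ^+ 2 - u1 ^+ 2); [ring|rewrite er2; ring].
have z3'0 : u1 + r != 0.
  by apply/eqP => e; move/eqP: e3; rewrite e mul0r eq_sym fmorph_eq0 (negPf g0).
have f3 : io g / (u1 + r) = r - u1 by rewrite -e3 mulrC mulKf.
pose sp := specz iota io (tri z1 z2 z3) (tri (u3 / r) (u2 * r / u3) (u1 + r)).
have s3 : sp (iota g / z3) (io g / (u1 + r)).
  by apply: (spec_div bz.1 z3'0); [exact: specz_const|exact: specz3].
have sw : sp ((z3 + iota g / z3) / 2%:R) r.
  have -> : r = (u1 + r + io g / (u1 + r)) / 2%:R by rewrite f3; field.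
  by apply: (spec_div bz.1) => //; [apply: specD => //; exact: specz3|exact: spec_nat].
apply: (specz_indep3 bz.1 iT (z1' := u3 / r) (z2' := u2 * r / u3) (z3' := u1 + r)).
- rewrite [X in specz _ _ _ _ _ X](_ : _ = (u1 + r - io g / (u1 + r)) / 2%:R).
    by apply: (spec_div bz.1) => //; [apply: specB => //; exact: specz3|exact: spec_nat].
  by rewrite f3; field.
- rewrite [X in specz _ _ _ _ _ X](_ : _ = u3 / r * (u2 * r / u3)).
    by apply: specM; [exact: specz1|exact: specz2].
  by field; rewrite r0 n3.
- rewrite [X in specz _ _ _ _ _ X](_ : _ = u3 / r * r); last by rewrite divfK.
  by apply: specM => //; exact: specz1.
Qed.

Lemma cayley_fixed f : adjoin3 iota X1 X2 X3 f <-> S f = f.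
Proof.
have [z10 z20 z30] := basis_neq0 bz.
have Sw : S ((z3 + iota g / z3) / 2%:R) = - ((z3 + iota g / z3) / 2%:R).
  by rewrite fmorph_div rmorph_nat rmorphD fmorph_div Sk S3; field; rewrite ?oppr_eq0 ?gk0 ?z30 ?two'.
have ez1 : z1 ^+ 2 = X3 ^+ 2 / (X1 ^+ 2 + iota g).
  by rewrite -w_sqr /X3 exprMn mulfK // expf_neq0.
apply: (fixed_quadratic two' Sk bz.2 _ _ _ S1) => //.
- by rewrite /X1 fmorph_div rmorph_nat rmorphB fmorph_div Sk S3; field; rewrite ?oppr_eq0 ?gk0 ?z30 ?two'.
- by rewrite /X2 rmorphM S1 S2 mulrNN.
- by rewrite /X3 rmorphM S1 Sw mulrNN.
- have sA := adjoin_subfield iota (fun g => [\/ g = X1, g = X2 | g = X3]).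
  rewrite ez1; have A1 : adjoin3 iota X1 X2 X3 X1 by apply: adjoin_mem; constructor 1.
  have A3 : adjoin3 iota X1 X2 X3 X3 by apply: adjoin_mem; constructor 3.
  have Ak : adjoin3 iota X1 X2 X3 (iota g) by apply: adjoin_const.
  by rewrite /adjoin3; subfield_closed sA.
- move=> M sM Mk M1 M2 M3 Mt; split=> //.
    by rewrite (_ : z2 = X2 / z1); [subfield_closed sM|rewrite /X2 mulrC mulKf].
  rewrite (_ : z3 = X1 + X3 / z1); first by subfield_closed sM.
  by rewrite /X1 /X3; field; rewrite z10 z30 two'.
Qed.

(** [T] inverts z1 and fixes w = (z3 + g/z3)/2, so X3 = z1 w satisfies X3 T(X3) = w^2 = g + X1^2;
    this is where the parameter -1 comes from. *)
Lemma cayley_Ruvw : purely_transcendental iota L <-> Ruvw B (-1) g.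
Proof.
have [z10 z20 z30] := basis_neq0 bz.
apply: (Ruvw_transfer cayley_indep Tk B0 _ g0) => //.
- by rewrite oppr_eq0 oner_eq0.
- by rewrite /X1 fmorph_div rmorph_nat rmorphB fmorph_div Tk T3; field; rewrite ?gk0 ?z30 ?two'.
- by rewrite /X2 rmorphM T1 T2; field; rewrite z10 z20.
- have Tw : T ((z3 + iota g / z3) / 2%:R) = (z3 + iota g / z3) / 2%:R.
    by rewrite fmorph_div rmorph_nat rmorphD fmorph_div Tk T3; field; rewrite ?gk0 ?z30 ?two'.
  rewrite rmorphN1 mulN1r opprK addrC -w_sqr /X3 rmorphM T1 Tw.
  by move: w_neq0; set w := _ / 2%:R => w0; field; rewrite z10 w0.
- by move=> f; rewrite hL cayley_fixed.
Qed.

End CayleyCoordinates.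

Section DiagonalCoordinates.
Variables (K E : fieldType) (iota : {rmorphism K -> E}) (z1 z2 z3 : E).
Variables (al c : K) (S T : {rmorphism E -> E}) (L : E -> Prop).
Hypotheses (two : 2%:R != 0 :> K) (al0 : al != 0) (c0 : c != 0).
Hypotheses (bz : basis3 iota z1 z2 z3).
Hypotheses (Sk : forall k, S (iota k) = iota k) (Tk : forall k, T (iota k) = iota k).
Hypotheses (S1 : S z1 = - iota al / z1) (S2 : S z2 = - iota al / z2) (S3 : S z3 = - z3).
Hypotheses (T1 : T z1 = - z1) (T2 : T z2 = iota al / z2) (T3 : T z3 = iota c / z3).
Hypothesis hL : forall h, L h <-> S h = h /\ T h = h.

Let X1 := (iota al / z2 - z2) / 2%:R.
(** The subtraction formula for the tangent: if z_i = sqrt(al) tan(theta_i), then X2 = sqrt(al)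
    tan(theta_1 - theta_2). [S] turns both angles by a right angle, so it fixes X2; z1 is recovered
    from z2 and X2 by the addition formula. *)
Let X2 := iota al * (z1 - z2) / (z1 * z2 + iota al).
Let t := (z2 + iota al / z2) / 2%:R.
Let X3 := z3 * t.

Let two' : 2%:R != 0 :> E.
Proof. by rewrite -(rmorph_nat iota) fmorph_eq0. Qed.
Let ak0 : iota al != 0. Proof. by rewrite fmorph_eq0. Qed.

Let nz u1 u2 f v : specz iota (idfun : {rmorphism K -> K}) (tri z1 z2 z3) (tri u1 u2 0) f v ->
  v != 0 -> f != 0.
Proof. exact: (spec_neq0 bz.1). Qed.

Let m_neq0 : z1 * z2 + iota al != 0.
Proof. by apply: (@nz 0 0 _ al) => //; eapply specz_val; [spec_eval|rewrite /=; ring]. Qed.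

Let t_neq0 : t != 0.
Proof.
have [_ z20 _] := basis_neq0 bz; rewrite mulf_neq0 ?invr_eq0 //.
have : z2 ^+ 2 + iota al != 0.
  by apply: (@nz 0 0 _ al) => //; eapply specz_val; [spec_eval|rewrite /=; ring].
by apply: contra => /eqP e; apply/eqP; transitivity (z2 * (z2 + iota al / z2)); [field|rewrite e mulr0].
Qed.

Let d_neq0 : z1 - z2 != 0.
Proof.
apply: (@nz 1 0 _ 1); last exact: oner_neq0.
by eapply specz_val; [spec_eval|rewrite /=; ring].
Qed.

Let t_sqr : t ^+ 2 = X1 ^+ 2 + iota al.
Proof.
have [_ z20 _] := basis_neq0 bz.
by rewrite /X1 /t; field; rewrite z20 two'.
Qed.

Lemma diagonal_indep : indep iota (tri X1 X2 X3).
Proof.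
have [T' [j [r [er iT]]]] := sqrt_model (x1 K ^+ 2 + constF al).
set io := (j \o @constF K) in iT *.
pose u1 := j (x1 K); pose u2 := j (x2 K); pose u3 := j (x3 K).
have two2 : 2%:R != 0 :> T' by rewrite -(rmorph_nat io) fmorph_eq0.
have er2 : r ^+ 2 = u1 ^+ 2 + io al by rewrite er rmorphD rmorphXn.
have a'0 : io al != 0 by rewrite fmorph_eq0.
have r0 : r != 0.
  have s : specz io (idfun : {rmorphism K -> K}) (tri u1 u2 u3) (tri 0 0 0) (u1 ^+ 2 + io al) al.
    by eapply specz_val; [spec_eval|rewrite /=; ring].
  by have := spec_neq0 iT s al0; rewrite -er2 expf_eq0.
pose z2' := r - u1.
have e2 : z2' * (r + u1) = io al.
  by transitivity (r ^+ 2 - u1 ^+ 2); [rewrite /z2'; ring|rewrite er2; ring].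
have z2'0 : z2' != 0 by apply: contra a'0 => /eqP e; rewrite -e2 e mul0r.
have f2 : io al / z2' = r + u1 by rewrite -e2 mulrC mulKf.
(* The product with the conjugate under r |-> -r is free of [r] and takes the value al^2 at the
   origin. *)
have q0 : io al - u2 * z2' != 0.
  have s : specz io (idfun : {rmorphism K -> K}) (tri u1 u2 u3) (tri 0 0 0)
     (io al * (io al + 2%:R * u1 * u2 - u2 ^+ 2)) (al ^+ 2).
    by eapply specz_val; [spec_eval|rewrite /=; ring].
  have := spec_neq0 iT s (expf_neq0 2 al0); apply: contra => /eqP e; apply/eqP.
  transitivity ((io al - u2 * z2') * (io al + u2 * u1 + u2 * r) + u2 ^+ 2 * (r ^+ 2 - (u1 ^+ 2 + io al))).
    by rewrite /z2'; ring.
  by rewrite e er2 subrr mul0r mulr0 addr0.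
pose z1' := io al * (z2' + u2) / (io al - u2 * z2').
have em : z1' * z2' + io al = io al * (z2' * (r + r)) / (io al - u2 * z2').
  have -> : z2' * (r + r) = z2' ^+ 2 + io al by rewrite -e2 /z2'; ring.
  by rewrite /z1'; field.
have m'0 : z1' * z2' + io al != 0.
  rewrite em !mulf_neq0 ?invr_eq0 //.
  by rewrite -mulr2n -mulr_natr mulf_neq0.
pose sp := specz iota io (tri z1 z2 z3) (tri z1' z2' (u3 / r)).
have sa : sp (iota al / z2) (io al / z2').
  by apply: (spec_div bz.1 z2'0); [exact: specz_const|exact: specz2].
have st : sp t r.
  have -> : r = (z2' + io al / z2') / 2%:R by rewrite f2 /z2'; field.
  by apply: (spec_div bz.1) => //; [apply: specD => //; exact: specz2|exact: spec_nat].
apply: (specz_indep3 bz.1 iT (z1' := z1') (z2' := z2') (z3' := u3 / r)).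
- rewrite [X in specz _ _ _ _ _ X](_ : _ = (io al / z2' - z2') / 2%:R).
    by apply: (spec_div bz.1) => //; [apply: specB => //; exact: specz2|exact: spec_nat].
  by rewrite f2 /z2'; field.
- rewrite [X in specz _ _ _ _ _ X](_ : _ = io al * (z1' - z2') / (z1' * z2' + io al)).
    apply: (spec_div bz.1) => //; spec_eval.
  rewrite em.
  have -> : z1' - z2' = u2 * (z2' ^+ 2 + io al) / (io al - u2 * z2').
    by rewrite /z1'; field.
  have -> : z2' ^+ 2 + io al = z2' * (r + r) by rewrite -e2 /z2'; ring.
  field; by rewrite q0 a'0 z2'0 -mulr2n -mulr_natr mulf_neq0.
- rewrite [X in specz _ _ _ _ _ X](_ : _ = u3 / r * r); last by rewrite divfK.
  by apply: specM => //; exact: specz3.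
Qed.

Lemma diagonal_fixed f : adjoin3 iota X1 X2 X3 f <-> S f = f.
Proof.
have [z10 z20 z30] := basis_neq0 bz.
have St : S t = - t.
  by rewrite /t fmorph_div rmorph_nat rmorphD fmorph_div Sk S2; field; rewrite ?oppr_eq0 ?ak0 ?z20 ?two'.
apply: (fixed_quadratic two' Sk bz.2 _ _ _ St) => //.
- by rewrite /X1 fmorph_div rmorph_nat rmorphB fmorph_div Sk S2; field; rewrite ?oppr_eq0 ?ak0 ?z20 ?two'.
- rewrite /X2 fmorph_div rmorphM rmorphB rmorphD rmorphM Sk S1 S2.
  have -> : - iota al / z1 * (- iota al / z2) + iota al = iota al * (z1 * z2 + iota al) / (z1 * z2).
    by field; rewrite z10 z20.
  by field; rewrite z10 z20 m_neq0 ak0.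
- by rewrite /X3 rmorphM S3 St mulrNN.
- have sA := adjoin_subfield iota (fun g => [\/ g = X1, g = X2 | g = X3]).
  rewrite t_sqr; have A1 : adjoin3 iota X1 X2 X3 X1 by apply: adjoin_mem; constructor 1.
  have Ak : adjoin3 iota X1 X2 X3 (iota al) by apply: adjoin_const.
  by rewrite /adjoin3; subfield_closed sA.
- move=> M sM Mk M1 M2 M3 Mt.
  have M2' : M z2 by rewrite (_ : z2 = t - X1); [subfield_closed sM|rewrite /t /X1; field; rewrite z20 two'].
  split=> //; last by rewrite (_ : z3 = X3 / t); [subfield_closed sM|rewrite /X3 mulfK].
  rewrite (_ : z1 = iota al * (z2 + X2) / (iota al - X2 * z2)); first by subfield_closed sM.
  have e : iota al - X2 * z2 = iota al * (z2 * (t + t)) / (z1 * z2 + iota al).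
    by rewrite /X2 /t; field; rewrite m_neq0 z20 two'.
  have e' : z2 + X2 = z1 * (z2 * (t + t)) / (z1 * z2 + iota al).
    by rewrite /X2 /t; field; rewrite m_neq0 z20 two'.
  rewrite e e'; field.
  by rewrite m_neq0 ak0 z20 -mulr2n -mulr_natr mulf_neq0.
Qed.

(** In terms of angles, [T] sends theta_1 - theta_2 to its negative minus a right angle, so the
    tangent becomes the cotangent and X2 goes to al/X2. As [T] fixes t, X3 T(X3) = c t^2 = c (X1^2 +
    al). *)
Lemma diagonal_Ruvw : purely_transcendental iota L <-> Ruvw al (- c) (al * c).
Proof.
have [z10 z20 z30] := basis_neq0 bz.
have Tt : T t = t by rewrite /t fmorph_div rmorph_nat rmorphD fmorph_div Tk T2; field; rewrite ?ak0 ?z20 ?two'.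
apply: (Ruvw_transfer diagonal_indep Tk al0) => //.
- by rewrite oppr_eq0.
- by rewrite mulf_neq0.
- by rewrite /X1 fmorph_div rmorph_nat rmorphB fmorph_div Tk T2; field; rewrite ?ak0 ?z20 ?two'.
- rewrite /X2 fmorph_div rmorphM rmorphB rmorphD rmorphM Tk T1 T2.
  have -> : - z1 * (iota al / z2) + iota al = - iota al * (z1 - z2) / z2 by field.
  field; by rewrite ak0 z20 m_neq0 ?oppr_eq0 d_neq0.
- rewrite /X3 rmorphM Tt T3 rmorphN rmorphM mulNr opprK.
  have -> : iota al * iota c + iota c * X1 ^+ 2 = iota c * t ^+ 2 by rewrite t_sqr; ring.
  by field; rewrite z30 t_neq0.
- by move=> f; rewrite hL diagonal_fixed.
Qed.

End DiagonalCoordinates.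


Section RuvwPermutations.
Variable K : fieldType.
Hypothesis two : 2%:R != 0 :> K.
Implicit Types u v w : K.

Lemma Ruvw_rot u v w : u != 0 -> v != 0 -> w != 0 -> Ruvw u v w <-> Ruvw v w u.
Proof. by move=> u0 v0 w0; rewrite (Ruvw_swap12 two u0 v0 w0) Ruvw_swap23. Qed.

Lemma Ruvw_swap13 u v w : u != 0 -> v != 0 -> w != 0 -> Ruvw u v w <-> Ruvw w v u.
Proof. by move=> u0 v0 w0; rewrite (Ruvw_rot u0 v0 w0) Ruvw_swap12. Qed.

(** Multiplication by u turns the pair (v, -uv) into (uv, -u^2 v); after a swap the square factor
    u^2 is dropped. *)
Lemma Ruvw_oppr u v : u != 0 -> v != 0 -> Ruvw u (- v) (u * v) <-> Ruvw u v (- (u * v)).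
Proof.
move=> u0 v0; have uv0 : u * v != 0 by rewrite mulf_neq0.
rewrite (Ruvw_mul u0 v0) ?oppr_eq0 // (Ruvw_swap23 u0 uv0) ?mulf_neq0 ?oppr_eq0 //.
have -> : u * - (u * v) = u ^+ 2 * - v by ring.
by apply: iff_sym; apply: Ruvw_scale; rewrite ?oppr_eq0.
Qed.

Lemma Ruvw_oppN1 u w : u != 0 -> w != 0 -> Ruvw (- u) (-1) (- w) <-> Ruvw u (-1) w.
Proof.
move=> u0 w0; have n1 : -1 != 0 :> K by rewrite oppr_eq0 oner_eq0.
rewrite (Ruvw_swap12 two u0 n1 w0) (Ruvw_mul n1 u0 w0) !mulN1r.
by apply: Ruvw_swap12 => //; rewrite oppr_eq0.
Qed.

End RuvwPermutations.

Lemma basis_1D_neq0 (K E : fieldType) (iota : {rmorphism K -> E}) (z1 z2 z3 : E) :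
  basis3 iota z1 z2 z3 -> 1 + z1 != 0 /\ 1 - z1 != 0.
Proof.
move=> bz.
have h f : specz iota (idfun : {rmorphism K -> K}) (tri z1 z2 z3) (tri 0 0 0) f 1 -> f != 0.
  by move=> s; apply: (spec_neq0 bz.1 s); apply: oner_neq0.
by split; apply: h; eapply specz_val; [spec_eval|rewrite /=; ring|spec_eval|rewrite /=; ring].
Qed.

Section CayleyTransform.
Variables (E : fieldType) (S : {rmorphism E -> E}) (x : E).
Hypotheses (x0 : x != 0) (p0 : 1 + x != 0) (m0 : 1 - x != 0).

Lemma cayley_opp : S x = - x -> S ((1 - x) / (1 + x)) = ((1 - x) / (1 + x))^-1.
Proof.
move=> Sx; rewrite fmorph_div rmorphB rmorphD rmorph1 Sx opprK.
by field; rewrite p0 m0.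
Qed.

Lemma cayley_inv : S x = x^-1 -> S ((1 - x) / (1 + x)) = - ((1 - x) / (1 + x)).
Proof.
move=> Sx; rewrite fmorph_div rmorphB rmorphD rmorph1 Sx.
have -> : 1 + x^-1 = (1 + x) / x by field.
by field; rewrite p0 x0.
Qed.

End CayleyTransform.

(** * Monomial actions *)

Section MonomialAction.
Variables (K E : fieldType) (iota : {rmorphism K -> E}) (x1 x2 x3 : E).
Variables (a b c : K) (S T : {rmorphism E -> E}) (L : E -> Prop).
Hypotheses (two : 2%:R != 0 :> K) (a0 : a != 0) (b0 : b != 0) (c0 : c != 0).
Hypothesis bx : basis3 iota x1 x2 x3.
Hypotheses (Sk : forall k, S (iota k) = iota k) (Tk : forall k, T (iota k) = iota k).
Hypotheses (S2 : S x2 = iota b / x2) (S3 : S x3 = iota c / x3) (T1 : T x1 = iota a / x1).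
Hypothesis hL : forall h, L h <-> S h = h /\ T h = h.

(** The group has three involutions, and [L] is the fixed field of any two of them. Each case below
    picks the ordered pair that fits its coordinates. *)
Let ST : {rmorphism E -> E} := S \o T.
Let STk k : ST (iota k) = iota k. Proof. by rewrite /= Tk Sk. Qed.
Let hTS h : L h <-> T h = h /\ S h = h.
Proof. by rewrite hL; split=> -[]. Qed.
Let hST_S h : L h <-> ST h = h /\ S h = h.
Proof.
rewrite hL /=; split=> [[Sh Th]|[STh Sh]]; first by rewrite Th Sh.
by split=> //; apply: (fmorph_inj S); rewrite STh Sh.
Qed.
Let hST_T h : L h <-> ST h = h /\ T h = h.
Proof.
rewrite hL /=; split=> [[Sh Th]|[STh Th]]; first by rewrite Th.
by rewrite Th in STh.
Qed.
Let hS_ST h : L h <-> S h = h /\ ST h = h.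
Proof. by rewrite hST_S; split=> -[]. Qed.
Let hT_ST h : L h <-> T h = h /\ ST h = h.
Proof. by rewrite hST_T; split=> -[]. Qed.

Let a0' : - a != 0. Proof. by rewrite oppr_eq0. Qed.
Let b0' : - b != 0. Proof. by rewrite oppr_eq0. Qed.
Let c0' : - c != 0. Proof. by rewrite oppr_eq0. Qed.
Let o2 : 1 ^+ 2 = 1 :> K. Proof. by rewrite expr1n. Qed.
Let m2 : (-1) ^+ 2 = 1 :> K. Proof. by rewrite sqrrN expr1n. Qed.

Local Notation rat := (purely_transcendental iota L).

Section PlusOne.
Hypothesis S1 : S x1 = x1.

Lemma monomial_plus e : e ^+ 2 = 1 -> T x2 = iota e * x2 -> T x3 = iota (e * c) / x3 ->
  rat <-> Ruvw a (e * b) (e * c).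
Proof.
move=> e2 T2 T3.
exact: (conic_Ruvw two a0 b0 c0 e2 e2 bx Sk Tk S1 S2 S3 T1 T2 T3 hL).
Qed.

Lemma monomial_plus_rational f : f ^+ 2 = 1 ->
  T x2 = iota (- f) * x2 -> T x3 = iota (f * c) / x3 -> rat.
Proof.
move=> f2 T2 T3.
exact: (conic_rational two a0 b0 c0 f2 bx Sk Tk S1 S2 S3 T1 T2 T3 hL).
Qed.

End PlusOne.

Section MinusOne.
Hypothesis S1 : S x1 = - x1.

Let S1' : S x1 = iota (-1) * x1. Proof. by rewrite rmorphN1 mulN1r. Qed.

Lemma monomial_minus_plus_rational : T x2 = x2 -> T x3 = iota c / x3 -> rat.
Proof.
move=> T2 T3; apply: (conic_rational (f := 1) two b0 a0 c0 o2 (basis_swap12 bx) Tk Sk T2 T1 T3 S2 S1' _ hTS) => //.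
by rewrite mul1r.
Qed.

Lemma monomial_minus_plus : T x2 = x2 -> T x3 = iota (- c) / x3 -> rat <-> Ruvw (- a) b c.
Proof.
move=> T2 T3; rewrite (Ruvw_swap12 two a0' b0 c0).
have := conic_Ruvw two b0 a0 c0' m2 m2 (basis_swap12 bx) Tk Sk T2 T1 T3 S2 S1' _ hTS erefl.
by rewrite !mulN1r opprK; apply.
Qed.

(** Here it is the product [ST] that fixes a variable, namely x3. It sends x1 and x2 to -a/x1 and
    -b/x2, and these signs cancel against f = -1. *)
Lemma monomial_minus_minus : T x2 = - x2 -> T x3 = iota c / x3 -> rat <-> Ruvw a b c.
Proof.
move=> T2 T3; have [n1 n2 n3] := basis_neq0 bx.
have ck0 : iota c != 0 by rewrite fmorph_eq0.
have U3 : ST x3 = x3 by rewrite /= T3 fmorph_div Sk S3; field; rewrite n3 ck0.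
have U1 : ST x1 = iota (- a) / x1.
  by rewrite /= T1 fmorph_div Sk S1 rmorphN; field; rewrite ?oppr_eq0 n1.
have U2 : ST x2 = iota (- b) / x2 by rewrite /= T2 rmorphN S2 rmorphN mulNr.
rewrite -(Ruvw_rot two c0 a0 b0).
have := conic_Ruvw two c0 a0' b0' m2 m2 (basis_swap12 (basis_swap23 bx)) STk Sk U3 U1 U2 S3 S1' _ hST_S erefl.
by rewrite !mulN1r !opprK; apply.
Qed.

Section AllMinus.
Hypotheses (T2 : T x2 = - x2) (T3 : T x3 = iota (- c) / x3).

Let U1 : ST x1 = iota (- a) / x1.
Proof.
have [n1 n2 n3] := basis_neq0 bx.
by rewrite /= T1 fmorph_div Sk S1 rmorphN; field; rewrite ?oppr_eq0 n1.
Qed.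
Let U2 : ST x2 = iota (- b) / x2.
Proof. by rewrite /= T2 rmorphN S2 rmorphN mulNr. Qed.
Let U3 : ST x3 = - x3.
Proof.
have [n1 n2 n3] := basis_neq0 bx; have ck0 : iota c != 0 by rewrite fmorph_eq0.
by rewrite /= T3 fmorph_div Sk S3 rmorphN; field; rewrite n3 ck0.
Qed.

Let bx2 := basis_swap12 bx.
Let bx3 := basis_swap12 (basis_swap23 bx).

(** [S] negates x1, while [T] inverts it if a = 1 and [ST] does if a = -1. The Cayley transform of
    x1 exchanges negation and inversion, which is the shape that [cayley_Ruvw] expects. *)
Lemma minus_a1 : a = 1 \/ a = -1 -> rat <-> Ruvw b (-1) c.
Proof.
have [n1 n2 n3] := basis_neq0 bx; have [p0 m0] := basis_1D_neq0 bx.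
case=> ea.
- have Tx : T x1 = x1^-1 by rewrite T1 ea rmorph1 mul1r.
  apply: (cayley_Ruvw two b0 c0 (basis_cayley bx two) Tk Sk (cayley_inv n1 p0 Tx) T2 _
    (cayley_opp p0 m0 S1) S2 S3 hTS).
  by rewrite T3 rmorphN.
- have Ux : ST x1 = x1^-1 by rewrite U1 ea opprK rmorph1 mul1r.
  rewrite (Ruvw_swap13 two) // ?oppr_eq0 ?oner_eq0 //.
  apply: (cayley_Ruvw two c0 b0 (basis_cayley (basis_swap23 bx) two) STk Sk (cayley_inv n1 p0 Ux) U3 _
    (cayley_opp p0 m0 S1) S3 S2 hST_S).
  by rewrite U2 rmorphN.
Qed.

Lemma minus_b1 : b = 1 \/ b = -1 -> rat <-> Ruvw a (-1) (- c).
Proof.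
have [n1 n2 n3] := basis_neq0 bx; have [p0 m0] := basis_1D_neq0 bx2.
case=> eb.
- have Sx : S x2 = x2^-1 by rewrite S2 eb rmorph1 mul1r.
  apply: (cayley_Ruvw two a0 c0' (basis_cayley bx2 two) Sk Tk (cayley_inv n2 p0 Sx) S1 _
    (cayley_opp p0 m0 T2) T1 T3 hL).
  by rewrite S3 rmorphN opprK.
- have Ux : ST x2 = x2^-1 by rewrite U2 eb opprK rmorph1 mul1r.
  rewrite (Ruvw_swap13 two) // ?oppr_eq0 ?oner_eq0 //.
  apply: (cayley_Ruvw two c0' a0 (basis_cayley (basis_swap23 bx2) two) STk Tk (cayley_inv n2 p0 Ux) U3 _
    (cayley_opp p0 m0 T2) T3 T1 hST_T).
  by rewrite U1 rmorphN.
Qed.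

Lemma minus_c1 : c = 1 \/ c = -1 -> rat <-> Ruvw a (-1) b.
Proof.
have [n1 n2 n3] := basis_neq0 bx; have [p0 m0] := basis_1D_neq0 bx3.
rewrite -(Ruvw_oppN1 two a0 b0).
case=> ec.
- have Sx : S x3 = x3^-1 by rewrite S3 ec rmorph1 mul1r.
  apply: (cayley_Ruvw two a0' b0' (basis_cayley bx3 two) Sk STk (cayley_inv n3 p0 Sx) S1 _
    (cayley_opp p0 m0 U3) U1 U2 hS_ST).
  by rewrite S2 rmorphN opprK.
- have Tx : T x3 = x3^-1 by rewrite T3 ec opprK rmorph1 mul1r.
  rewrite (Ruvw_swap13 two) // ?oppr_eq0 ?oner_eq0 //.
  apply: (cayley_Ruvw two b0' a0' (basis_cayley (basis_swap23 bx3) two) Tk STk (cayley_inv n3 p0 Tx) T2 _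
    (cayley_opp p0 m0 U3) U2 U1 hT_ST).
  by rewrite T1 rmorphN opprK.
Qed.

(** Because b = 1/a, the involution [ST] sends each of x1 and 1/x2 to -a times its inverse, as the
    diagonal coordinates require. The cases ac = -1 and bc = 1 differ in the roles of the variables
    and of the involutions. *)
Lemma minus_ab : a * b = 1 -> rat <-> Ruvw a c (- (a * c)).
Proof.
move=> ab; have [n1 n2 n3] := basis_neq0 bx.
have eb : iota b = (iota a)^-1 by rewrite -fmorphV; congr (iota _); apply: (mulfI a0); rewrite ab mulfV.
have ak0 : iota a != 0 by rewrite fmorph_eq0.
rewrite -(Ruvw_oppr a0 c0).
apply: (diagonal_Ruvw two a0 c0 (basis_swap12 (basis_inv bx2)) STk Sk _ _ U3 S1 _ S3 hST_S).
- by rewrite U1 rmorphN.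
- by rewrite fmorphV U2 rmorphN eb; field; rewrite ?oppr_eq0 ?oner_eq0 ?ak0 ?n2.
- by rewrite fmorphV S2 eb; field; rewrite ?oner_eq0 ?ak0 ?n2.
Qed.

Lemma minus_ac : a * c = -1 -> rat <-> Ruvw (- a) b (a * b).
Proof.
move=> ac; have [n1 n2 n3] := basis_neq0 bx.
have ec : iota c = - (iota a)^-1.
  by rewrite -fmorphV -rmorphN; congr (iota _); apply: (mulfI a0); rewrite ac mulrN mulfV.
have ak0 : iota a != 0 by rewrite fmorph_eq0.
have -> : a * b = - (- a * b) by ring.
rewrite -(Ruvw_oppr a0' b0).
apply: (diagonal_Ruvw two a0' b0 (basis_swap12 (basis_inv (basis_swap12 (basis_swap23 bx)))) Tk Sk _ _ T2 S1 _ S2 hTS).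
- by rewrite T1 rmorphN opprK.
- by rewrite fmorphV T3 !rmorphN ec; field; rewrite ?oppr_eq0 ?oner_eq0 ?ak0 ?n3.
- by rewrite fmorphV S3 rmorphN ec; field; rewrite ?oppr_eq0 ?oner_eq0 ?ak0 ?n3.
Qed.

Lemma minus_bc : b * c = 1 -> rat <-> Ruvw (- b) a (a * b).
Proof.
move=> bc; have [n1 n2 n3] := basis_neq0 bx.
have ec : iota c = (iota b)^-1 by rewrite -fmorphV; congr (iota _); apply: (mulfI b0); rewrite bc mulfV.
have bk0 : iota b != 0 by rewrite fmorph_eq0.
have -> : a * b = - (- b * a) by ring.
rewrite -(Ruvw_oppr b0' a0).
apply: (diagonal_Ruvw two b0' a0 (basis_swap12 (basis_inv (basis_swap12 (basis_swap23 bx2)))) Sk Tk _ _ S1 T2 _ T1 hL).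
- by rewrite S2 rmorphN opprK.
- by rewrite fmorphV S3 rmorphN ec; field; rewrite ?oppr_eq0 ?oner_eq0 ?bk0 ?n3.
- by rewrite fmorphV T3 !rmorphN ec; field; rewrite ?oppr_eq0 ?oner_eq0 ?bk0 ?n3.
Qed.

End AllMinus.
End MinusOne.
End MonomialAction.

Lemma groupG_fixed (K : fieldType) (a b c e1 e2 e3 : K) :
  a != 0 -> b != 0 -> c != 0 -> e1 ^+ 2 = 1 -> e2 ^+ 2 = 1 -> e3 != 0 ->
  exists S T : {rmorphism ratF K -> ratF K},
  [/\ forall k, S (constF k) = constF k, forall k, T (constF k) = constF k,
    [/\ S (x1 K) = constF e1 * x1 K, S (x2 K) = constF b / x2 K & S (x3 K) = constF c / x3 K],
    [/\ T (x1 K) = constF a / x1 K, T (x2 K) = constF e2 * x2 K &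
        T (x3 K) = constF (e3 * c) / x3 K] &
    forall f, fixed_by (groupG a b c e1 e2 e3) f <-> S f = f /\ T f = f].
Proof.
move=> a0 b0 c0 h1 h2 h3.
have [/Kaut_rmorphism [S [es Sk]] [S1 S2 S3]] := sigma1_Kaut b0 c0 h1.
have [/Kaut_rmorphism [T [et Tk]] [T1 T2 T3]] := sigma2_Kaut a0 c0 h2 h3.
exists S, T; split=> //; try by split; rewrite -?es -?et.
move=> f; rewrite fixed_generated -es -et.
by split=> [h|[hS hT] g [] ->] //; split; apply: h; [left|right].
Qed.


(** * Unramified classes over rational function fields *)

Section PolyArith.
Variable k : fieldType.
Implicit Types p q f g x y z u v : {poly k}.

Lemma irr_dvdM p x y : irreducible_poly p -> (p %| x * y) = (p %| x) || (p %| y).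
Proof.
move=> irr; have [px|npx] := boolP (p %| x); first by rewrite dvdp_mulr.
rewrite /= Gauss_dvdpr // coprimep_sym; apply/coprimepP => d dx dp.
have [/eqP s1|s1] := boolP (size d == 1%N); first by rewrite -size_poly_eq1 s1.
by move: npx; rewrite -(eqp_dvdl x (irr.2 d s1 dp)) dx.
Qed.

Lemma irr_dvdX2 p x : irreducible_poly p -> (p %| x ^+ 2) = (p %| x).
Proof. by move=> irr; rewrite expr2 irr_dvdM // orbb. Qed.

Lemma irr_dvdC p (c : k) : irreducible_poly p -> c != 0 -> (p %| c%:P) = false.
Proof.
move=> irr c0; apply/negP => /dvdp_leq; rewrite polyC_eq0 => /(_ c0).
by rewrite size_polyC c0 leqNgt irr.1.
Qed.

Lemma irr_exists f : (1 < size f)%N -> exists2 p, irreducible_poly p & p %| f.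
Proof.
have [n] := ubnP (size f); elim: n f => // n IH f lfn f1.
have [irr|nirr] := classic (irreducible_poly f); first by exists f.
have [q [q1 qf nqf]] : exists q, [/\ size q != 1%N, q %| f & ~~ (q %= f)].
  apply: NNPP => h; apply: nirr; split=> // q q1 qf; apply/negPn/negP => nqf.
  by apply: h; exists q.
have f0 : f != 0 by rewrite -size_poly_gt0 (ltn_trans _ f1).
have q0 : q != 0 by apply: contraNneq f0 => q0; move: qf; rewrite q0 dvd0p.
have lqf : (size q < size f)%N.
  rewrite ltn_neqAle dvdp_leq // andbT.
  by apply: contra nqf => e; rewrite -dvdp_size_eqp.
have lq : (1 < size q)%N.
  by rewrite ltn_neqAle eq_sym q1 /= size_poly_gt0.
have [p irr pq] := IH q (leq_trans lqf lfn) lq.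
by exists p => //; apply: dvdp_trans pq qf.
Qed.

Lemma dvdp_congr p x y w : p %| x -> x - y = p * w -> p %| y.
Proof.
move=> px e; have -> : y = x - p * w by rewrite -e; ring.
by rewrite dvdp_sub // dvdp_mulr.
Qed.

Section Local.
Variable p : {poly k}.
Hypothesis irr : irreducible_poly p.

(** Being a square in the residue field k[X]/(p), with u/v as the root. The denominator makes it
    unnecessary to construct that field and to invert in it. *)
Definition sqmod x := exists u v, ~~ (p %| v) /\ p %| u ^+ 2 - x * v ^+ 2.
Definition prim x y z := ~ [/\ p %| x, p %| y & p %| z].

Lemma sqmodM x y : sqmod x -> sqmod y -> sqmod (x * y).
Proof.
move=> [u [v [nv /dvdpP [w e]]]] [u' [v' [nv' /dvdpP [w' e']]]].
exists (u * u'), (v * v'); split; first by rewrite irr_dvdM // negb_or nv.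
apply/dvdpP; exists (w * u' ^+ 2 + x * v ^+ 2 * w').
transitivity ((u ^+ 2 - x * v ^+ 2) * u' ^+ 2 + x * v ^+ 2 * (u' ^+ 2 - y * v' ^+ 2)); first by ring.
by rewrite e e'; ring.
Qed.

Lemma sqmod_cancel x y : ~~ (p %| y) -> sqmod (y ^+ 2 * x) -> sqmod x.
Proof.
move=> ny [u [v [nv d]]]; exists u, (y * v); split; first by rewrite irr_dvdM // negb_or ny.
by rewrite (_ : _ - _ = u ^+ 2 - y ^+ 2 * x * v ^+ 2) //; ring.
Qed.

Lemma sqmod_quot x y : ~~ (p %| x) -> sqmod x -> sqmod (x * y) -> sqmod y.
Proof.
move=> nx sx sxy; apply: (sqmod_cancel nx).
by rewrite (_ : _ * y = x * (x * y)); [apply: sqmodM|ring].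
Qed.

Lemma sqmodC x (c : k) : c != 0 -> sqmod (x * c%:P ^+ 2) -> sqmod x.
Proof.
move=> c0 s; apply: (@sqmod_cancel x c%:P); first by rewrite irr_dvdC.
by rewrite mulrC.
Qed.

Variables (f g f' g' X Y Z : {poly k}) (c : k).
Hypotheses (c0 : c != 0) (ef : f = p * f') (nf' : ~~ (p %| f')).
Hypothesis pr : prim X Y Z.

(** The [local_] lemmas compute tame residues at [p], where f has valuation 1 and g has valuation 0
    or 1. Here (cf, g) splits and g is a unit, so the residue is g. *)
Lemma local_even1 : ~~ (p %| g) -> f * X ^+ 2 - f * g * Y ^+ 2 = c%:P * Z ^+ 2 -> sqmod g.
Proof.
move=> ng e.
have pZ : p %| Z.
  have : p %| c%:P * Z ^+ 2 by rewrite -e ef; apply/dvdpP; exists (f' * X ^+ 2 - f' * g * Y ^+ 2); ring.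
  by rewrite irr_dvdM // irr_dvdC // irr_dvdX2.
have p0 := irredp_neq0 irr; have [Z' eZ] := dvdpP _ _ pZ.
have d : p %| X ^+ 2 - g * Y ^+ 2.
  have : p %| f' * (X ^+ 2 - g * Y ^+ 2).
    apply/dvdpP; exists (c%:P * Z' ^+ 2); apply: (mulfI p0).
    transitivity (f * X ^+ 2 - f * g * Y ^+ 2); first by rewrite ef; ring.
    by rewrite e eZ; ring.
  by rewrite irr_dvdM // (negPf nf').
exists X, Y; split=> //; apply/negP => pY; apply: pr; split=> //.
rewrite -(irr_dvdX2 _ irr); have [Y' eY] := dvdpP _ _ pY.
by apply: (dvdp_congr (w := - (g * Y * Y')) d); rewrite eY; ring.
Qed.

(** The algebra is (cg, f), with cg a unit and f of valuation 1: the residue is cg. *)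
Lemma local_even2 : ~~ (p %| g) -> g * X ^+ 2 - f * g * Y ^+ 2 = c%:P * Z ^+ 2 ->
  sqmod (g * c%:P).
Proof.
move=> ng e; have p0 := irredp_neq0 irr.
exists (g * X), Z; split.
  apply/negP => pZ; have [Z' eZ] := dvdpP _ _ pZ.
  have pX : p %| X.
    have : p %| g * X ^+ 2.
      apply/dvdpP; exists (f' * g * Y ^+ 2 + c%:P * Z * Z').
      transitivity (c%:P * Z ^+ 2 + f * g * Y ^+ 2); first by rewrite -e; ring.
      by rewrite ef eZ; ring.
    by rewrite irr_dvdM // (negPf ng) irr_dvdX2.
  apply: pr; split=> //; have [X' eX] := dvdpP _ _ pX.
  have : p %| f' * g * Y ^+ 2.
    apply/dvdpP; exists (g * X' ^+ 2 - c%:P * Z' ^+ 2); apply: (mulfI p0).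
    transitivity (g * X ^+ 2 - (g * X ^+ 2 - f * g * Y ^+ 2)); first by rewrite ef; ring.
    by rewrite e eX eZ; ring.
  by rewrite irr_dvdM // irr_dvdX2 // irr_dvdM // (negPf ng) (negPf nf').
apply/dvdpP; exists (g ^+ 2 * f' * Y ^+ 2).
transitivity (g * (g * X ^+ 2 - c%:P * Z ^+ 2)); first by ring.
by rewrite -e ef; ring.
Qed.

Hypotheses (eg : g = p * g') (ng' : ~~ (p %| g')).

(** In (cf, g) both slots have valuation 1. The tame residue is -c f'/g', the sign being (-1)^(v(f)
    v(g)). *)
Lemma local_odd1 : f * X ^+ 2 - f * g * Y ^+ 2 = c%:P * Z ^+ 2 -> sqmod ((- c)%:P * (f' * g')).
Proof.
move=> e; have p0 := irredp_neq0 irr.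
have pZ : p %| Z.
  have : p %| c%:P * Z ^+ 2 by rewrite -e ef; apply/dvdpP; exists (f' * X ^+ 2 - f' * g * Y ^+ 2); ring.
  by rewrite irr_dvdM // irr_dvdC // irr_dvdX2.
have [Z' eZ] := dvdpP _ _ pZ.
have e1 : f' * X ^+ 2 - p * f' * g' * Y ^+ 2 = c%:P * p * Z' ^+ 2.
  apply: (mulfI p0); transitivity (f * X ^+ 2 - f * g * Y ^+ 2); first by rewrite ef eg; ring.
  by rewrite e eZ; ring.
have pX : p %| X.
  have : p %| f' * X ^+ 2.
    apply/dvdpP; exists (f' * g' * Y ^+ 2 + c%:P * Z' ^+ 2).
    transitivity (c%:P * p * Z' ^+ 2 + p * f' * g' * Y ^+ 2); first by rewrite -e1; ring.
    by ring.
  by rewrite irr_dvdM // (negPf nf') irr_dvdX2.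
have [X' eX] := dvdpP _ _ pX.
have e2 : p * f' * X' ^+ 2 - f' * g' * Y ^+ 2 = c%:P * Z' ^+ 2.
  apply: (mulfI p0); transitivity (f' * X ^+ 2 - p * f' * g' * Y ^+ 2); first by rewrite eX; ring.
  by rewrite e1; ring.
exists (c%:P * Z'), Y; split.
  by apply/negP => pY; apply: pr.
apply/dvdpP; exists (c%:P * f' * X' ^+ 2).
rewrite polyCN; transitivity (c%:P * (c%:P * Z' ^+ 2 + f' * g' * Y ^+ 2)); first by ring.
by rewrite -e2; ring.
Qed.

(** The algebra is (cg, fg); fg has valuation 2 and unit part f'g', which is the residue up to
    squares. *)
Lemma local_odd3 : g * X ^+ 2 - f * Y ^+ 2 = c%:P * Z ^+ 2 -> sqmod (f' * g').
Proof.
move=> e; have p0 := irredp_neq0 irr.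
have pZ : p %| Z.
  have : p %| c%:P * Z ^+ 2 by rewrite -e ef eg; apply/dvdpP; exists (g' * X ^+ 2 - f' * Y ^+ 2); ring.
  by rewrite irr_dvdM // irr_dvdC // irr_dvdX2.
have [Z' eZ] := dvdpP _ _ pZ.
have e1 : g' * X ^+ 2 - f' * Y ^+ 2 = c%:P * p * Z' ^+ 2.
  apply: (mulfI p0); transitivity (g * X ^+ 2 - f * Y ^+ 2); first by rewrite ef eg; ring.
  by rewrite e eZ; ring.
exists (g' * X), Y; split.
  apply/negP => pY; apply: pr; split=> //; have [Y' eY] := dvdpP _ _ pY.
  have : p %| g' * X ^+ 2.
    apply/dvdpP; exists (c%:P * Z' ^+ 2 + f' * Y * Y').
    transitivity (c%:P * p * Z' ^+ 2 + f' * Y ^+ 2); first by rewrite -e1; ring.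
    by rewrite eY; ring.
  by rewrite irr_dvdM // (negPf ng') irr_dvdX2.
apply/dvdpP; exists (g' * c%:P * Z' ^+ 2).
transitivity (g' * (g' * X ^+ 2 - f' * Y ^+ 2)); first by ring.
by rewrite e1; ring.
Qed.

End Local.

(** Bezout inverts the denominator modulo p, and reduction bounds the degree of the root; this bound
    is what lets the induction on norms terminate. *)
Lemma sqmod_const p (b : k) : irreducible_poly p -> sqmod p b%:P ->
  exists2 s : {poly k}, (size s < size p)%N & p %| s ^+ 2 - b%:P.
Proof.
move=> irr [u [v [nv d]]]; have p0 := irredp_neq0 irr.
have cp : coprimep p v.
  apply/coprimepP => q qp qv.
  have [/eqP s1|s1] := boolP (size q == 1%N); first by rewrite -size_poly_eq1 s1.
  by move: nv; rewrite -(eqp_dvdl v (irr.2 q s1 qp)) qv.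
have [[w1 w2] /= e] := Bezout_eq1_coprimepP _ _ cp.
have [m em] := dvdpP _ _ d.
exists ((u * w2) %% p); first by rewrite ltn_modp.
have : p %| (u * w2) ^+ 2 - b%:P.
  apply/dvdpP; exists (m * w2 ^+ 2 - b%:P * w1 * (w1 * p + w2 * v + w2 * v)).
  transitivity ((u ^+ 2 - b%:P * v ^+ 2) * w2 ^+ 2 + b%:P * (w2 * v) ^+ 2 - b%:P * (w1 * p + w2 * v) ^+ 2).
    by rewrite e; ring.
  by rewrite em; ring.
set s := u * w2 => /dvdpP [n en]; apply/dvdpP; exists (n - (s %/ p) * (s %% p + s)).
transitivity ((s ^+ 2 - b%:P) - (s - s %% p) * (s %% p + s)); first by ring.
have -> : s - s %% p = s %/ p * p by rewrite {1}(divp_eq s p) addrK.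
by rewrite en; ring.
Qed.

End PolyArith.


(** For x nonzero this says that the quaternion class (b, x) equals a class (b, ka) with ka in K. *)
Definition norm_multiple (K T : fieldType) (j : {rmorphism K -> T}) (b : K) (x : T) :=
  exists ka A B, x = j ka * (A ^+ 2 - j b * B ^+ 2).

Section NormMultiple.
Variables (K T : fieldType) (j : {rmorphism K -> T}) (b : K).
Local Notation nm := (norm_multiple j b).

Lemma norm_multipleM x y : nm x -> nm y -> nm (x * y).
Proof.
move=> [ka [A [B ->]]] [ka' [A' [B' ->]]].
by exists (ka * ka'), (A * A' + j b * B * B'), (A * B' + B * A'); rewrite rmorphM; ring.
Qed.

Lemma norm_multipleV x : x != 0 -> nm x -> nm x^-1.
Proof.
move=> x0 [ka [A [B e]]]; move: x0; rewrite e mulf_eq0 negb_or fmorph_eq0 => /andP [ka0 n0].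
set n := _ - _ in n0 *; exists ka^-1, (A / n), (B / n); rewrite fmorphV invfM; congr (_ * _).
transitivity (n / n ^+ 2); first by field.
by rewrite /n; field.
Qed.

Lemma norm_multiple_const ka : nm (j ka).
Proof. by exists ka, 1, 0; rewrite expr1n expr0n mulr0 subr0 mulr1. Qed.

Lemma norm_multiple_norm A B : nm (A ^+ 2 - j b * B ^+ 2).
Proof. by exists 1, A, B; rewrite rmorph1 mul1r. Qed.

Lemma norm_multiple_sqr A : nm (A ^+ 2).
Proof. by exists 1, A, 0; rewrite rmorph1 expr0n mulr0 subr0 mul1r. Qed.

(** If b is a square, A^2 - b B^2 is a hyperbolic plane and takes every value. *)
Lemma norm_multiple_split s x : 2%:R != 0 :> T -> b != 0 -> s ^+ 2 = j b -> nm x.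
Proof.
move=> two b0 es; have s0 : s != 0.
  by apply: contraNneq b0 => s0; rewrite -(fmorph_eq0 j) -es s0 expr0n.
exists 1, ((x + 1) / 2%:R), ((x - 1) / (2%:R * s)); rewrite rmorph1 -es.
by field; rewrite two s0.
Qed.

End NormMultiple.

Section RationalFunctions.
Variable k : fieldType.
Variables (T : fieldType) (tau : {rmorphism {poly k} -> T}).
Hypothesis tau_inj : forall p, tau p = 0 -> p = 0.
Hypothesis tau_frac : forall x, exists n d : {poly k}, d != 0 /\ x = tau n / tau d.
Implicit Types (p f g : {poly k}).

Let ratC : {rmorphism k -> T} := tau \o (@polyC k).

Lemma tau_neq0 p : p != 0 -> tau p != 0.
Proof. by apply: contraNneq => /tau_inj->. Qed.

(** Only the parity of the valuations of P matters. With f squarefree, an odd valuation at [p] just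
    means that [p] divides f. *)
Lemma sqfree_rep (P : T) : P != 0 -> exists f h, [/\ h != 0, P = tau f * h ^+ 2 &
  forall p, irreducible_poly p -> ~~ (p ^+ 2 %| f)].
Proof.
move=> P0.
have [f [h [h0 e]]] : exists f (h : T), h != 0 /\ P = tau f * h ^+ 2.
  have [n [d [/tau_neq0 d0 ->]]] := tau_frac P.
  by exists (n * d), (tau d)^-1; rewrite invr_eq0 d0 rmorphM; split=> //; field.
have [n] := ubnP (size f); elim: n f h h0 e => // n IH f h h0 e lfn.
have [h1|h1] := classic (exists2 p, irreducible_poly p & p ^+ 2 %| f); last first.
  by exists f, h; split=> // p irr; apply/negP => d; apply: h1; exists p.
have [p irr /dvdpP [q eq]] := h1; have p0 := irredp_neq0 irr.
have f0 : f != 0 by apply: contraNneq P0 => f0; rewrite e f0 rmorph0 mul0r.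
have q0 : q != 0 by apply: contraNneq f0 => q0; rewrite eq q0 mul0r.
apply: (IH q (h * tau p)).
- by rewrite mulf_neq0 // tau_neq0.
- by rewrite e eq rmorphM rmorphXn; ring.
- rewrite ltnS in lfn; apply: leq_trans lfn; rewrite eq size_mul ?expf_neq0 // expr2 size_mul //.
  rewrite -size_poly_gt0 in q0; move: irr.1 q0.
  by move: (size p) (size q) => x y; lia.
Qed.

(** Denominators are cleared, then common factors [p] are divided out; [Z] stays nonzero and its
    degree drops. Primitivity at the one prime [p] is all that the residue computations use. *)
Lemma prim_sol p (al be ga : {poly k}) (U V W : T) : (1 < size p)%N -> W != 0 ->
  tau al * U ^+ 2 + tau be * V ^+ 2 + tau ga * W ^+ 2 = 0 ->
  exists X Y Z, al * X ^+ 2 + be * Y ^+ 2 + ga * Z ^+ 2 = 0 /\ prim p X Y Z.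
Proof.
move=> p1 W0 e.
have [X [Y [Z [Z0 e']]]] : exists X Y Z, Z != 0 /\ al * X ^+ 2 + be * Y ^+ 2 + ga * Z ^+ 2 = 0.
  have [u [u' [/tau_neq0 u0 eU]]] := tau_frac U.
  have [v [v' [/tau_neq0 v0 eV]]] := tau_frac V.
  have [w [w' [/tau_neq0 w0 eW]]] := tau_frac W.
  exists (u * v' * w'), (v * u' * w'), (w * u' * v'); split.
    have : tau (w * u' * v') != 0.
      rewrite !rmorphM !mulf_neq0 //.
      by apply: contraNneq W0 => wz; rewrite eW wz mul0r.
    by apply: contraNneq => ->; rewrite rmorph0.
  apply: tau_inj.
  transitivity ((tau al * U ^+ 2 + tau be * V ^+ 2 + tau ga * W ^+ 2) * (tau u' * tau v' * tau w') ^+ 2); last by rewrite e mul0r.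
  rewrite eU eV eW !(rmorphD, rmorphXn, rmorphM); field.
  by rewrite u0 v0 w0.
have [n] := ubnP (size Z); elim: n X Y Z Z0 e' => // n IH X Y Z Z0 e' lZ.
have [h|h] := classic (prim p X Y Z); first by exists X, Y, Z.
have {}h := NNPP _ h; case: h => /dvdpP [X' eX] /dvdpP [Y' eY] /dvdpP [Z' eZ].
have p0 : p != 0 by rewrite -size_poly_gt0 (ltn_trans _ p1).
have Z0' : Z' != 0 by apply: contraNneq Z0 => z; rewrite eZ z mul0r.
apply: (IH X' Y' Z') => //.
  apply: (mulfI (expf_neq0 2 p0)); rewrite mulr0 -e' eX eY eZ; ring.
rewrite ltnS in lZ; apply: leq_trans lZ; rewrite eZ size_mul //.
by case: (size p) p1 => [|[|m]] // _; rewrite !addnS /= ltnS leq_addr.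
Qed.

(* If p is irreducible and b = s^2 modulo p with deg s < deg p, then s^2 - b = p m with
   deg m < deg p, and b is a square modulo every prime factor of m. *)
Lemma norm_of_split (b : k) f : 2%:R != 0 :> k -> b != 0 -> f != 0 ->
  (forall p, irreducible_poly p -> p %| f -> sqmod p b%:P) -> norm_multiple ratC b (tau f).
Proof.
move=> two b0; have [n] := ubnP (size f); elim: n f => // n IH f lfn f0 hf.
have [s1|s1] := leqP (size f) 1.
  by rewrite (size1_polyC s1); apply: norm_multiple_const.
have [p irr pf] := irr_exists s1; have p0 := irredp_neq0 irr.
have [s ls /dvdpP [m em]] := sqmod_const irr (hf p irr pf).
have two' : 2%:R != 0 :> T by rewrite -(rmorph_nat ratC) fmorph_eq0.
have [q eq] := dvdpP _ _ pf.
(* If m = 0 then b = s^2, and every element is a norm. *)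
have [m0|m0] := eqVneq m 0.
  apply: (@norm_multiple_split _ _ ratC b (tau s)) => //.
  by rewrite -rmorphXn -[s ^+ 2](subrK b%:P) em m0 mul0r add0r.
have q0 : q != 0 by apply: contraNneq f0 => q0; rewrite eq q0 mul0r.
have sp := irr.1.
have lq : (size q < size f)%N.
  by rewrite eq size_mul //; case: (size p) sp => [|[|z]] // _; rewrite !addnS /= ltnS leq_addr.
have lpf : (size p <= size f)%N by apply: dvdp_leq.
have lm : (size m < size p)%N.
  have : (size (m * p)%R <= (size s + size s).-1)%N || (size (m * p)%R <= 1)%N.
    rewrite -em; apply/orP.
    have := size_polyD (s ^+ 2) (- b%:P); rewrite size_polyN.
    rewrite leq_max => /orP [h|h]; [left|right].
      by apply: leq_trans h _; rewrite expr2 size_polyMleq.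
    by apply: leq_trans h _; apply: size_polyC_leq1.
  rewrite size_mul //; move: sp ls; move: (size p) (size s) (size m) => x y z; lia.
have nq : norm_multiple ratC b (tau q).
  apply: IH => //; first by rewrite ltnS in lfn; apply: leq_trans lq lfn.
  by move=> r ir rq; apply: hf => //; rewrite eq dvdp_mulr.
have nm : norm_multiple ratC b (tau m).
  apply: IH => // [|r ir rm].
    by rewrite ltnS in lfn; apply: leq_trans lfn; apply: leq_trans lm lpf.
  exists s, 1; split; first by rewrite -polyC1 irr_dvdC // oner_neq0.
  by rewrite expr1n mulr1 em dvdp_mulr.
have -> : tau f = tau q * ((tau s ^+ 2 - ratC b * 1 ^+ 2) / tau m).
  have -> : tau s ^+ 2 - ratC b * 1 ^+ 2 = tau (m * p) by rewrite -em rmorphB rmorphXn expr1n mulr1.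
  by rewrite eq !rmorphM; field; rewrite tau_neq0.
apply: norm_multipleM => //; apply: norm_multipleM; first exact: norm_multiple_norm.
by apply: norm_multipleV => //; rewrite tau_neq0.
Qed.

End RationalFunctions.


(* The relations say that the quaternion algebras (aP, Q), (bQ, P) and (cQ, PQ)
   split, and the conclusion that (b, P) is the pull-back of a class from K. *)
Definition unramified_norm (K k : fieldType) (j : {rmorphism K -> k}) (a b c : K) : Prop :=
  forall P Q e1 e2 e3 e4 : k,
  P - P * Q * e1 ^+ 2 = 4%:R * j a -> Q - P * Q * e2 ^+ 2 = 4%:R * j b ->
  Q * e3 ^+ 2 - P * e4 ^+ 2 = 4%:R * j c -> norm_multiple j b P.

Definition infinite_field (k : fieldType) : Prop :=
  forall d : {poly k}, d != 0 -> exists t0, d.[t0] != 0.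

(** * Residues over one more variable, and specialization of that variable *)

Section Step.
Variables (k T : fieldType) (tau : {rmorphism {poly k} -> T}).
Hypothesis tau_inj : forall p, tau p = 0 -> p = 0.
Hypothesis tau_frac : forall x, exists n d : {poly k}, d != 0 /\ x = tau n / tau d.
Hypothesis two : 2%:R != 0 :> k.

Let ratC : {rmorphism k -> T} := tau \o (@polyC k).
Let two' : 2%:R != 0 :> T. Proof. by rewrite -(rmorph_nat ratC) fmorph_eq0. Qed.

Lemma unramified_norm_over (a b c : k) : a != 0 -> b != 0 -> c != 0 ->
  (forall p, irreducible_poly p ->
     sqmod p (- a)%:P -> sqmod p (- b)%:P -> sqmod p b%:P) ->
  unramified_norm ratC a b c.
Proof.
move=> a0 b0 c0 sq P Q e1 e2 e3 e4 r1 r2 r3.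
have four0 : 4%:R != 0 :> T by rewrite (natrM _ 2 2) mulf_neq0.
have P0 : P != 0.
  apply: contraTneq isT => P0; move/eqP: r1; rewrite P0 !mul0r subr0 eq_sym.
  by rewrite mulf_eq0 (negPf four0) fmorph_eq0 (negPf a0).
have Q0 : Q != 0.
  apply: contraTneq isT => Q0; move/eqP: r2; rewrite Q0 mulr0 mul0r subr0 eq_sym.
  by rewrite mulf_eq0 (negPf four0) fmorph_eq0 (negPf b0).
have [f [h [h0 eP sf]]] := sqfree_rep tau_inj tau_frac P0.
have [g [l [l0 eQ sg]]] := sqfree_rep tau_inj tau_frac Q0.
have f0 : f != 0 by apply: contraNneq P0 => f0; rewrite eP f0 rmorph0 mul0r.
have g0 : g != 0 by apply: contraNneq Q0 => g0; rewrite eQ g0 rmorph0 mul0r.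
rewrite eP; apply: norm_multipleM; last exact: norm_multiple_sqr.
apply: (norm_of_split tau_inj two b0 f0) => p irr pf.
have [f' ef] := dvdpP _ _ pf; rewrite mulrC in ef.
have nf' : ~~ (p %| f').
  apply/negP => /dvdpP [w ew]; move/negP: (sf p irr); apply; apply/dvdpP; exists w.
  by rewrite ef ew; ring.
have [X1 [Y1 [Z1 [E1 pr1]]]] : exists X Y Z, f * X ^+ 2 - f * g * Y ^+ 2 = a%:P * Z ^+ 2 /\ prim p X Y Z.
  have [|X [Y [Z [E pr]]]] := @prim_sol _ _ _ tau_inj tau_frac p f (- (f * g)) (- a%:P) h (h * l * e1) 2%:R irr.1 two'.
    rewrite !rmorphN !rmorphM; transitivity (P - P * Q * e1 ^+ 2 - 4%:R * ratC a); last by rewrite r1 subrr.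
    by rewrite eP eQ /=; ring.
  by exists X, Y, Z; split=> //; apply/eqP; rewrite -subr_eq0 -E; apply/eqP; ring.
have [X2 [Y2 [Z2 [E2 pr2]]]] : exists X Y Z, g * X ^+ 2 - f * g * Y ^+ 2 = b%:P * Z ^+ 2 /\ prim p X Y Z.
  have [|X [Y [Z [E pr]]]] := @prim_sol _ _ _ tau_inj tau_frac p g (- (f * g)) (- b%:P) l (h * l * e2) 2%:R irr.1 two'.
    rewrite !rmorphN !rmorphM; transitivity (Q - P * Q * e2 ^+ 2 - 4%:R * ratC b); last by rewrite r2 subrr.
    by rewrite eP eQ /=; ring.
  by exists X, Y, Z; split=> //; apply/eqP; rewrite -subr_eq0 -E; apply/eqP; ring.
have [X3 [Y3 [Z3 [E3 pr3]]]] : exists X Y Z, g * X ^+ 2 - f * Y ^+ 2 = c%:P * Z ^+ 2 /\ prim p X Y Z.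
  have [|X [Y [Z [E pr]]]] := @prim_sol _ _ _ tau_inj tau_frac p g (- f) (- c%:P) (l * e3) (h * e4) 2%:R irr.1 two'.
    rewrite !rmorphN; transitivity (Q * e3 ^+ 2 - P * e4 ^+ 2 - 4%:R * ratC c); last by rewrite r3 subrr.
    by rewrite eP eQ /=; ring.
  by exists X, Y, Z; split=> //; apply/eqP; rewrite -subr_eq0 -E; apply/eqP; ring.
(* If [p] does not divide g, both g and bg are squares at [p], and so is b. *)
have [pg|npg] := boolP (p %| g); last first.
  have s1 := local_even1 irr a0 ef nf' pr1 npg E1.
  by apply: (sqmod_quot irr npg s1); apply: (local_even2 irr ef nf' pr2 npg E2).
have [g' eg] := dvdpP _ _ pg; rewrite mulrC in eg.
have ng' : ~~ (p %| g').
  apply/negP => /dvdpP [w ew]; move/negP: (sg p irr); apply; apply/dvdpP; exists w.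
  by rewrite eg ew; ring.
(* Both valuations are odd: f'g' is a square by the third relation, which reduces the residues of
   the other two to -a and -b. The second relation is the first with f and g exchanged. *)
have s3 := local_odd3 irr c0 ef pr3 eg ng' E3.
have nfg : ~~ (p %| f' * g') by rewrite irr_dvdM // negb_or nf'.
have sa := local_odd1 irr a0 ef nf' pr1 eg E1.
have sb : sqmod p ((- b)%:P * (g' * f')).
  by apply: (local_odd1 irr b0 eg ng' pr2 ef); rewrite [g * f]mulrC.
apply: sq => //; apply: (sqmod_quot irr nfg s3); first by rewrite mulrC.
by rewrite mulrC [f' * g']mulrC.
Qed.

Lemma spec_exists (fs : seq T) : infinite_field k -> exists t0, forall f, f \in fs ->
  exists v, spec tau (horner_eval t0) f v.
Proof.
move=> ik.
have [d [d0 hd]] : exists d : {poly k}, d != 0 /\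
    forall t0, d.[t0] != 0 -> forall f, f \in fs -> exists v, spec tau (horner_eval t0) f v.
  elim: fs => [|f fs [d [d0 hd]]]; first by exists 1; rewrite oner_neq0.
  have [n [e [e0 ef]]] := tau_frac f; exists (d * e); rewrite mulf_neq0 //; split=> // t0.
  rewrite hornerM mulf_eq0 negb_or => /andP [dt et] g; rewrite inE => /orP [/eqP->|]; last exact: hd.
  exists (n.[t0] / e.[t0]), n, e; split=> //=.
  - by rewrite ef divfK // (tau_neq0 tau_inj).
  - by rewrite /horner_eval divfK.
by have [t0 ht] := ik d d0; exists t0; apply: hd.
Qed.

(** The residues give P = ka times a norm with ka only in [k]. Specializing the new variable at a
    point of [k] where nothing has a pole preserves the relations, so by induction the value of P,
    and with it ka, is an element of K times a norm. The second alternative on [k] is for the bottom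
    of the tower, where k = K may be finite. *)
Lemma unramified_norm_step (K : fieldType) (j : {rmorphism K -> k}) (a b c : K) :
  a != 0 -> b != 0 -> c != 0 ->
  (exists i, i ^+ 2 = -1 :> K) \/ (exists r, r ^+ 2 = - (a * b)) ->
  unramified_norm j a b c ->
  infinite_field k \/ (forall x, exists ka, x = j ka) ->
  unramified_norm (ratC \o j) a b c.
Proof.
move=> a0 b0 c0 hsq hj hk.
have a0' : j a != 0 by rewrite fmorph_eq0.
have b0' : j b != 0 by rewrite fmorph_eq0.
have c0' : j c != 0 by rewrite fmorph_eq0.
have sq p : irreducible_poly p -> sqmod p (- j a)%:P -> sqmod p (- j b)%:P -> sqmod p (j b)%:P.
  (* With i^2 = -1, the elements b and -b differ by a square. With r^2 = -ab, both -a and (-a) b are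
     squares at [p], hence b is. *)
  move=> irr sa sb; case: hsq => [[i ei]|[r er]].
    have i0 : j i != 0.
      rewrite fmorph_eq0; apply: contraTneq isT => i0; move/eqP: ei.
      by rewrite i0 expr0n eq_sym oppr_eq0 oner_eq0.
    apply: (sqmodC irr i0); rewrite -polyC_exp -polyCM.
    by rewrite -rmorphXn ei rmorphN1 mulrN1.
  apply: (sqmod_quot irr _ sa); first by rewrite irr_dvdC // oppr_eq0.
  exists (j r)%:P, 1; split; first by rewrite -polyC1 irr_dvdC // oner_neq0.
  rewrite expr1n mulr1 -polyC_exp -polyCM.
  have -> : - j a * j b = j r ^+ 2 by rewrite -rmorphXn er rmorphN rmorphM mulNr.
  by rewrite subrr dvdp0.
move=> P Q e1 e2 e3 e4 r1 r2 r3.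
have [ka [A [B eP]]] := unramified_norm_over a0' b0' c0' sq r1 r2 r3.
case: hk => [ik|sj]; last by have [ka' eka] := sj ka; exists ka', A, B; rewrite eP eka.
have [t0 ht] := spec_exists [:: P; Q; e1; e2; e3; e4; A; B] ik.
have [P' sP] := ht P (mem_head _ _).
have [Q' sQ] : exists v, spec tau (horner_eval t0) Q v by apply: ht; rewrite !inE eqxx ?orbT.
have [e1' s1] : exists v, spec tau (horner_eval t0) e1 v by apply: ht; rewrite !inE eqxx ?orbT.
have [e2' s2] : exists v, spec tau (horner_eval t0) e2 v by apply: ht; rewrite !inE eqxx ?orbT.
have [e3' s3] : exists v, spec tau (horner_eval t0) e3 v by apply: ht; rewrite !inE eqxx ?orbT.
have [e4' s4] : exists v, spec tau (horner_eval t0) e4 v by apply: ht; rewrite !inE eqxx ?orbT.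
have [A' sA] : exists v, spec tau (horner_eval t0) A v by apply: ht; rewrite !inE eqxx ?orbT.
have [B' sB] : exists v, spec tau (horner_eval t0) B v by apply: ht; rewrite !inE eqxx ?orbT.
have sC x : spec tau (horner_eval t0) (ratC x) x.
  by have := spec_base tau (horner_eval t0) x%:P; rewrite /= /horner_eval hornerC.
have s4R x : spec tau (horner_eval t0) (4%:R * ratC x) (4%:R * x).
  by apply: specM => //; apply: spec_nat.
have r1' : P' - P' * Q' * e1' ^+ 2 = 4%:R * j a.
  apply: (spec_inj tau_inj _ (s4R _)); rewrite -r1.
  by apply: specB => //; apply: specM; [apply: specM|apply: specX].
have r2' : Q' - P' * Q' * e2' ^+ 2 = 4%:R * j b.
  apply: (spec_inj tau_inj _ (s4R _)); rewrite -r2.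
  by apply: specB => //; apply: specM; [apply: specM|apply: specX].
have r3' : Q' * e3' ^+ 2 - P' * e4' ^+ 2 = 4%:R * j c.
  apply: (spec_inj tau_inj _ (s4R _)); rewrite -r3.
  by apply: specB; apply: specM => //; apply: specX.
have eP' : P' = ka * (A' ^+ 2 - j b * B' ^+ 2).
  apply: (spec_inj tau_inj sP); rewrite eP.
  by apply: specM => //; apply: specB; [apply: specX|apply: specM => //; apply: specX].
have P'0 : P' != 0.
  have four0 : 4%:R != 0 :> k by rewrite (natrM _ 2 2) mulf_neq0.
  apply: contraTneq isT => P0; move/eqP: r1'; rewrite P0 !mul0r subr0 eq_sym.
  by rewrite mulf_eq0 (negPf four0) (negPf a0').
have [ka0 [A0 [B0 eP0]]] := hj _ _ _ _ _ _ r1' r2' r3'.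
have nmC x : norm_multiple j b x -> norm_multiple (ratC \o j) b (ratC x).
  by move=> [y [U [V ->]]]; exists y, (ratC U), (ratC V); rewrite (rmorphM ratC) (rmorphB ratC) (rmorphXn ratC) (rmorphM ratC) (rmorphXn ratC).
have nka : norm_multiple j b ka.
  move: P'0; rewrite eP'; set n := _ - _; rewrite mulf_eq0 negb_or => /andP [k0 n0].
  have -> : ka = P' * n^-1 by rewrite eP' mulfK.
  apply: norm_multipleM; first by exists ka0, A0, B0.
  by apply: norm_multipleV => //; apply: norm_multiple_norm.
rewrite eP; apply: norm_multipleM; first exact: nmC.
exact: norm_multiple_norm.
Qed.

End Step.


(** * Towers of simple transcendental extensions *)

Section TranscendentalExtension.
Variables (k E : fieldType) (phi : {rmorphism k -> E}) (t : E).

Lemma comm_ev : commr_rmorph phi t. Proof. by move=> x; apply: mulrC. Qed.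
Definition ev : {poly k} -> E := horner_morph comm_ev.
HB.instance Definition _ := GRing.RMorphism.copy ev (horner_morph comm_ev).

Lemma evE p : ev p = (map_poly phi p).[t]. Proof. by []. Qed.
Lemma evC x : ev x%:P = phi x. Proof. exact: horner_morphC. Qed.
Lemma evX : ev 'X = t. Proof. exact: horner_morphX. Qed.

Definition transcendental := forall p, ev p = 0 -> p = 0.

Lemma transcendental_emb : transcendental ->
  exists Phi : {rmorphism {fraction {poly k}} -> E}, forall p, Phi p%:F = ev p.
Proof.
move=> tr.
pose s : {fraction {poly k}} -> E := frac_ext ev.
pose sZ := GRing.isZmodMorphism.Build _ _ s (frac_ext_zmod tr).
pose sM := GRing.isMonoidMorphism.Build _ _ s (frac_ext_monoid tr).
exists (HB.pack_for {rmorphism {fraction {poly k}} -> E} s sZ sM) => p.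
exact: (frac_ext_poly tr).
Qed.

End TranscendentalExtension.

Section FracPoly.
Variable k : fieldType.

Lemma tofrac_inj (p : {poly k}) : p%:F = 0 -> p = 0.
Proof. by move/eqP; rewrite tofrac_eq0 => /eqP. Qed.

Lemma tofrac_frac (x : {fraction {poly k}}) :
  exists n d : {poly k}, d != 0 /\ x = n%:F / d%:F.
Proof.
exists (\n_(repr x)), (\d_(repr x)); split; first exact: denom_ratioP.
exact: frac_numden.
Qed.

Lemma infinite_frac : infinite_field {fraction {poly k}}.
Proof.
(* The powers of the variable supply enough distinct elements even if [k] is finite. *)
move=> d d0; pose rs := [seq ('X^i : {poly k})%:F | i <- iota 0 (size d)].
have ur : uniq rs.
  rewrite map_inj_in_uniq ?iota_uniq // => i l _ _ /eqP; rewrite tofrac_eq => /eqP.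
  by move/(congr1 (fun p : {poly k} => size p)); rewrite !size_polyXn => -[].
have [ar|] := boolP (all (root d) rs).
  by have := max_poly_roots d0 ar ur; rewrite size_map size_iota ltnn.
by rewrite -has_predC => /hasP [x _ /= nx]; exists x; rewrite -rootE.
Qed.

End FracPoly.

Section Polynomials.
Variables (K : fieldType) (n : nat).

Definition to_mpoly (R : {poly {mpoly K[n]}}) : {mpoly K[n.+1]} :=
  (map_poly (@mwiden n K) R).['X_ord_max].

Lemma to_mpoly_inj R : to_mpoly R = 0 -> R = 0.
Proof.
pose g (i : 'I_n.+1) : {poly {mpoly K[n]}} :=
  if unlift ord_max i is Some l then ('X_l)%:P else 'X.
pose V : {rmorphism {mpoly K[n.+1]} -> {poly {mpoly K[n]}}} :=
  mmap (polyC \o @mpolyC n K) g.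
have VX : V 'X_ord_max = 'X by rewrite /V /= mmapX mmap1U /g unlift_none.
have Vw p : V (mwiden p) = p%:P.
  rewrite /V /= /mwiden rmorph_mmap.
  have -> : p%:P = mmap (polyC \o @mpolyC n K) (polyC \o (fun i => 'X_i)) p.
    rewrite -(rmorph_mmap (@mpolyC n K)); congr (_%:P).
    elim/mpolyind: p => [|c m p _ _ IH]; first by rewrite rmorph0.
    by rewrite rmorphD /= -IH -mul_mpolyC rmorphM /= mmapC mmapX mmap1_id.
  apply: eq_mmap => [c|i] /=; rewrite ?mmapC // mmapX mmap1U /g.
  have -> : widen_ord (leqnSn n) i = lift ord_max i by apply: val_inj; rewrite /= /bump leqNgt ltn_ord.
  by rewrite liftK.
have VK : V (to_mpoly R) = R.
  rewrite /to_mpoly -horner_map VX -map_poly_comp.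
  have -> : map_poly (V \o @mwiden n K) R = map_poly polyC R by apply: eq_map_poly.
  by rewrite -[RHS](comp_polyXr R).
by move=> e; rewrite -VK e rmorph0.
Qed.

Variables (E : fieldType) (iota : {rmorphism K -> E}) (y : nat -> E).
Local Notation m_ev := (mmap iota (fun i : 'I_n => y i)).
Local Notation m_ev' := (mmap iota (fun i : 'I_n.+1 => y i)).

Lemma mmap_widen p : m_ev' (mwiden p) = m_ev p.
Proof.
rewrite /mwiden rmorph_mmap; apply: eq_mmap => [c|i] /=; first by rewrite mmapC.
by rewrite mmapX mmap1U.
Qed.

Lemma mmap_to_mpoly R : m_ev' (to_mpoly R) = (map_poly m_ev R).[y n].
Proof.
rewrite /to_mpoly -horner_map -map_poly_comp /= mmapX mmap1U /=; congr (_.[_]).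
by apply: eq_map_poly => p /=; apply: mmap_widen.
Qed.

End Polynomials.

(** An explicit form of membership in K(y_0,...,y_(n-1)). It serves to prove that the next y is
    transcendental over this field, and later that automorphisms fixing the y fix the whole
    field. *)
Definition fractions_of (K E : fieldType) (iota : {rmorphism K -> E}) (y : nat -> E) n f :=
  exists p q : {mpoly K[n]}, mmap iota (fun i : 'I_n => y i) q != 0 /\
    f * mmap iota (fun i : 'I_n => y i) q = mmap iota (fun i : 'I_n => y i) p.

Section TowerStep.
Variables (K E : fieldType) (iota : {rmorphism K -> E}) (y : nat -> E) (n : nat).
Variables (k : fieldType) (phi : {rmorphism k -> E}).
Hypothesis hphi : forall z, fractions_of iota y n (phi z).
Local Notation m_ev := (mmap iota (fun i : 'I_n => y i)).

Lemma poly_fractions (r : {poly k}) : exists (q : {mpoly K[n]}) (R : {poly {mpoly K[n]}}),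
  m_ev q != 0 /\ map_poly phi r * (m_ev q)%:P = map_poly m_ev R.
Proof.
elim/poly_ind: r => [|r c [q [R [q0 e]]]].
  by exists 1, 0; rewrite rmorph1 oner_neq0 !rmorph0 mul0r.
have [p' [q' [q0' e']]] := hphi c.
exists (q * q'), (R * q'%:P * 'X + (p' * q)%:P).
rewrite rmorphM mulf_neq0 //; split=> //.
rewrite !rmorphD !rmorphM /= !map_polyX !map_polyC /= -e -e' !rmorphM; ring.
Qed.

Lemma tower_transcendental : indep iota (fun i : 'I_n.+1 => y i) ->
  transcendental phi (y n).
Proof.
move=> iy r er; have [q [R [q0 e]]] := poly_fractions r.
have R0 : R = 0.
  apply: to_mpoly_inj; apply: iy; rewrite mmap_to_mpoly -e hornerM -evE er mul0r //.
have : map_poly phi r = 0.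
  by apply/eqP; move/eqP: e; rewrite R0 rmorph0 mulf_eq0 polyC_eq0 (negPf q0) orbF.
by move/eqP; rewrite map_poly_eq0 => /eqP.
Qed.

Lemma tower_fractions (Phi : {rmorphism {fraction {poly k}} -> E}) z :
  (forall p, Phi p%:F = ev phi (y n) p) -> fractions_of iota y n.+1 (Phi z).
Proof.
move=> hP; have [N [D [D0 ->]]] := tofrac_frac z.
have [q [R [q0 e]]] := poly_fractions N; have [q' [R' [q0' e']]] := poly_fractions D.
have PD0 : ev phi (y n) D != 0 by rewrite -hP fmorph_eq0 tofrac_eq0.
have eN : ev phi (y n) N * m_ev q = (map_poly m_ev R).[y n] by rewrite -e hornerM hornerC.
have eD : ev phi (y n) D * m_ev q' = (map_poly m_ev R').[y n] by rewrite -e' hornerM hornerC.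
exists (to_mpoly R * mwiden q'), (to_mpoly R' * mwiden q).
rewrite !rmorphM /= !mmap_to_mpoly !mmap_widen -eN -eD !mulf_neq0 //; split=> //.
by rewrite (fmorphV Phi) !hP; field.
Qed.

End TowerStep.

(** K(y_0,...,y_(n-1)) is rebuilt as an iterated fraction field of one-variable polynomial rings, so
    that [unramified_norm] climbs one variable at a time. At the bottom k = K, and P is its own
    constant. *)
Lemma tower (K E : fieldType) (iota : {rmorphism K -> E}) (a b c : K) (y : nat -> E) n :
  2%:R != 0 :> K -> a != 0 -> b != 0 -> c != 0 ->
  (exists i, i ^+ 2 = -1 :> K) \/ (exists r, r ^+ 2 = - (a * b)) ->
  indep iota (fun i : 'I_n => y i) ->
  exists (k : fieldType) (j : {rmorphism K -> k}) (phi : {rmorphism k -> E}),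
  [/\ forall x, phi (j x) = iota x, unramified_norm j a b c,
      infinite_field k \/ (forall x, exists ka, x = j ka),
      forall i, (i < n)%N -> exists z, phi z = y i &
      forall z, fractions_of iota y n (phi z)].
Proof.
move=> two a0 b0 c0 hsq; elim: n => [|n IH] iy.
  exists K, idfun, iota; split=> //; last by move=> z; exists z%:MP, 1; rewrite rmorph1 oner_neq0 mulr1 mmapC.
    by move=> P *; exists P, 1, 0; rewrite expr1n expr0n mulr0 subr0 mulr1.
  by right=> x; exists x.
have [|k [j [phi [pj uj ik hy hphi]]]] := IH.
  have wI : injective (widen_ord (leqnSn n)) by move=> i l /(congr1 val) /= /val_inj.
  by apply: (indep_ext _ (indep_reindex wI iy)).
have tr := tower_transcendental hphi iy.
have [Phi hP] := transcendental_emb tr.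
pose tau : {rmorphism {poly k} -> {fraction {poly k}}} := @FracField.tofrac {poly k}.
pose j' : {rmorphism K -> {fraction {poly k}}} := (tau \o @polyC k) \o j.
have two' : 2%:R != 0 :> k by rewrite -(rmorph_nat j) fmorph_eq0.
exists {fraction {poly k}}, j', Phi; split.
- by move=> x; rewrite /= hP evC pj.
- exact: (unramified_norm_step (tau := tau) (@tofrac_inj k) (@tofrac_frac k) two' a0 b0 c0 hsq uj ik).
- by left; apply: infinite_frac.
- move=> i; rewrite ltnS leq_eqVlt => /orP [/eqP->|/hy [z ez]].
    by exists ('X)%:F; rewrite hP evX.
  by exists (z%:P)%:F; rewrite hP evC.
- by move=> z; apply: (tower_fractions hphi).
Qed.


(** * Descent of invariant norms *)

Section CoprimePairs.
Variable k : fieldType.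
Implicit Types (f g q fh gh : {poly k}) (ka : k).

Lemma multiplier_const f g q N : q != 0 -> maxn (size f) (size g) = N.+1 ->
  (size (q * f)%R <= N.+1)%N -> (size (q * g)%R <= N.+1)%N ->
  exists2 c, c != 0 & q = c%:P.
Proof.
move=> q0 eN lf lg.
have h x : (size (q * x)%R <= N.+1)%N -> size x = N.+1 -> exists2 c, c != 0 & q = c%:P.
  move=> lx ex; have x0 : x != 0 by rewrite -size_poly_gt0 ex.
  have sq : (size q <= 1)%N.
    by move: lx; rewrite size_mul // ex addnS /= -add1n leq_add2r.
  by exists q`_0; [rewrite -polyC_eq0 -size1_polyC|apply: size1_polyC].
by move: eN; rewrite /maxn; case: ifP => _ e; [apply: (h g)|apply: (h f)].
Qed.

(** [fh] and [gh] stand for the images of f and g under an involution, brought back to polynomials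
    of degree at most N. Coprimality makes f divide [gh], and the degree bound makes the quotient
    constant. *)
Lemma coprime_norm f g fh gh ka N : coprimep f g -> f != 0 -> ka != 0 -> gh != 0 ->
  maxn (size f) (size g) = N.+1 -> (size fh <= N.+1)%N -> (size gh <= N.+1)%N ->
  fh * f = ka%:P * (gh * g) ->
  exists2 ga, ga != 0 & gh = ga%:P * f /\ fh = (ka * ga)%:P * g.
Proof.
move=> cp f0 ka0 gh0 eN lf lg e.
have : f %| gh.
  have : f %| gh * g.
    have : f %| ka%:P * (gh * g) by rewrite -e dvdp_mull.
    by rewrite mul_polyC dvdpZr.
  by rewrite Gauss_dvdpl.
case/dvdpP => q eq.
have efh : fh = ka%:P * q * g by apply: (mulIf f0); rewrite e eq; ring.
have q0 : q != 0 by apply: contraNneq gh0 => q0; rewrite eq q0 mul0r.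
have [ga ga0 ega] : exists2 c, c != 0 & q = c%:P.
  apply: (multiplier_const q0 eN); first by rewrite -eq.
  by move: lf; rewrite efh -mulrA mul_polyC size_scale.
by exists ga => //; split; rewrite ?efh ?polyCM -ega.
Qed.

Lemma coprime_invariant f g fh gh N : coprimep f g -> f != 0 -> fh != 0 ->
  maxn (size f) (size g) = N.+1 -> (size fh <= N.+1)%N -> (size gh <= N.+1)%N ->
  fh * g = f * gh ->
  exists2 la, la != 0 & fh = la%:P * f /\ gh = la%:P * g.
Proof.
move=> cp f0 fh0 eN lf lg e.
have : f %| fh by rewrite -(Gauss_dvdpl _ cp) e dvdp_mulr.
case/dvdpP => q eq.
have eg : gh = q * g by apply: (mulfI f0); rewrite -e eq; ring.
have q0 : q != 0 by apply: contraNneq fh0 => q0; rewrite eq q0 mul0r.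
have [la la0 ela] : exists2 c, c != 0 & q = c%:P.
  by apply: (multiplier_const q0 eN); rewrite -?eq -?eg.
by exists la => //; rewrite -ela.
Qed.

End CoprimePairs.

Section Descent.
Variables (k E : fieldType) (phi : {rmorphism k -> E}) (Z : E).
Hypothesis trZ : transcendental phi Z.
Hypothesis fracZ : forall h : E, exists f g : {poly k}, g != 0 /\ h = ev phi Z f / ev phi Z g.
Local Notation e := (ev phi Z).

Lemma ev_neq0 f : f != 0 -> e f != 0.
Proof. by apply: contraNneq => /trZ->. Qed.

Lemma ev_inj f g : e f = e g -> f = g.
Proof. by move=> h; apply/eqP; rewrite -subr_eq0; apply/eqP/trZ; rewrite rmorphB /= h subrr. Qed.

Lemma coprime_rep h : h != 0 -> exists f g, [/\ coprimep f g, f != 0, g != 0 & h = e f / e g].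
Proof.
move=> h0; have [f [g [g0 eh]]] := fracZ h.
have f0 : f != 0 by apply: contraNneq h0 => f0; rewrite eh f0 rmorph0 mul0r.
pose d := gcdp f g; have d0 : d != 0 by rewrite gcdp_eq0 negb_and f0.
have [f' ef] := dvdpP _ _ (dvdp_gcdl f g); have [g' eg] := dvdpP _ _ (dvdp_gcdr f g).
rewrite -/d in ef eg.
have f0' : f' != 0 by apply: contraNneq f0 => z; rewrite ef z mul0r.
have g0' : g' != 0 by apply: contraNneq g0 => z; rewrite eg z mul0r.
exists f', g'; split=> //.
  have := @coprimep_div_gcd _ f g; rewrite f0 -/d => /(_ isT).
  have -> : f %/ d = f' by rewrite ef mulpK.
  by have -> : g %/ d = g' by rewrite eg mulpK.
rewrite eh ef eg !rmorphM /=; field; by rewrite !ev_neq0.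
Qed.

(* W is Z when S inverts Z up to a constant and 1 when S scales Z; multiplication by
   W^N makes S act on polynomials of degree at most N. *)
Definition hat_closed (S : E -> E) (W : E) := forall N (f : {poly k}), (size f <= N.+1)%N ->
  exists2 fh : {poly k}, (size fh <= N.+1)%N & S (e f) * W ^+ N = e fh.

Section OneInvolution.
Variables (S : {rmorphism E -> E}) (s : {rmorphism k -> k}) (W : E) (w : k).
Hypotheses (Ss : forall x, S (phi x) = phi (s x)) (SS : forall x, S (S x) = x).
Hypotheses (W0 : W != 0) (WSW : W * S W = phi w) (hS : hat_closed S W).

(** Twisting a polynomial of degree at most N twice multiplies it by w^N, with w = W S(W). Since the
    twists of g and f are ga f and ka ga g, this yields an equation for w^N in the coefficient
    field, from which Z has disappeared. *)
Lemma norm_pair f g N ka : coprimep f g -> f != 0 -> g != 0 -> ka != 0 ->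
  maxn (size f) (size g) = N.+1 -> e f / e g * S (e f / e g) = phi ka ->
  exists ga, [/\ ga != 0, S (e g) * W ^+ N = phi ga * e f,
    S (e f) * W ^+ N = phi (ka * ga) * e g & w ^+ N = ka * ga * s ga].
Proof.
move=> cp f0 g0 ka0 eN en.
have lf : (size f <= N.+1)%N by rewrite -eN leq_maxl.
have lg : (size g <= N.+1)%N by rewrite -eN leq_maxr.
have [fh lfh efh] := hS lf; have [gh lgh egh] := hS lg.
have ef0 := ev_neq0 f0; have eg0 := ev_neq0 g0; have WN0 := expf_neq0 N W0.
have Sg0 : S (e g) != 0 by rewrite fmorph_eq0.
have gh0 : gh != 0.
  by apply: contraTneq isT => z; move/eqP: egh; rewrite z rmorph0 mulf_eq0 (negPf Sg0) (negPf WN0).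
have [|ga ga0 [eg1 ef1]] := coprime_norm cp f0 ka0 gh0 eN lfh lgh.
  apply: ev_inj; rewrite !rmorphM /= evC -efh -egh -en fmorph_div; field.
  by rewrite eg0 Sg0.
exists ga; rewrite egh efh eg1 ef1 !rmorphM /= !evC; split=> //.
apply: (fmorph_inj phi); rewrite rmorphXn !rmorphM -WSW exprMn /=.
have h1 : S (e g) * W ^+ N = phi ga * e f by rewrite egh eg1 rmorphM /= evC.
have h2 : S (e f) * W ^+ N = phi ka * phi ga * e g by rewrite efh ef1 rmorphM /= evC rmorphM.
have h3 : e g * S W ^+ N = phi (s ga) * S (e f).
  by have := congr1 S h1; rewrite !rmorphM SS rmorphXn Ss.
apply: (mulIf eg0).
transitivity (e g * S W ^+ N * W ^+ N); first by ring.
rewrite h3 -mulrA h2; ring.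
Qed.

Lemma invariant_pair f g N : coprimep f g -> f != 0 -> g != 0 ->
  maxn (size f) (size g) = N.+1 -> S (e f / e g) = e f / e g ->
  exists la, [/\ la != 0, S (e f) * W ^+ N = phi la * e f,
    S (e g) * W ^+ N = phi la * e g & w ^+ N = la * s la].
Proof.
move=> cp f0 g0 eN en.
have lf : (size f <= N.+1)%N by rewrite -eN leq_maxl.
have lg : (size g <= N.+1)%N by rewrite -eN leq_maxr.
have [fh lfh efh] := hS lf; have [gh lgh egh] := hS lg.
have ef0 := ev_neq0 f0; have eg0 := ev_neq0 g0; have WN0 := expf_neq0 N W0.
have Sg0 : S (e g) != 0 by rewrite fmorph_eq0.
have Sf0 : S (e f) != 0 by rewrite fmorph_eq0.
have fh0 : fh != 0.
  by apply: contraTneq isT => z; move/eqP: efh; rewrite z rmorph0 mulf_eq0 (negPf Sf0) (negPf WN0).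
have [|la la0 [ef1 eg1]] := coprime_invariant cp f0 fh0 eN lfh lgh.
  apply: ev_inj; rewrite !rmorphM /= -efh -egh.
  have -> : S (e f) = e f / e g * S (e g) by rewrite -en fmorph_div divfK.
  by field.
exists la; rewrite egh efh eg1 ef1 !rmorphM /= !evC; split=> //.
apply: (fmorph_inj phi); rewrite rmorphXn !rmorphM -WSW exprMn /=.
have h1 : S (e g) * W ^+ N = phi la * e g by rewrite egh eg1 rmorphM /= evC.
have h3 : e g * S W ^+ N = phi (s la) * S (e g).
  by have := congr1 S h1; rewrite !rmorphM SS rmorphXn Ss.
apply: (mulIf eg0).
transitivity (e g * S W ^+ N * W ^+ N); first by ring.
rewrite h3 -mulrA h1; ring.
Qed.

Lemma norm_descent h ka : ka != 0 -> h * S h = phi ka ->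
  exists N ga, ga != 0 /\ w ^+ N = ka * ga * s ga.
Proof.
move=> ka0 eh.
have h0 : h != 0.
  by apply: contraNneq ka0 => h0; rewrite -(fmorph_eq0 phi) -eh h0 mul0r.
have [f [g [cp f0 g0 e1]]] := coprime_rep h0.
have [N eN] : exists N, maxn (size f) (size g) = N.+1.
  by exists (maxn (size f) (size g)).-1; rewrite prednK // leq_max size_poly_gt0 f0.
rewrite e1 in eh; have [ga [ga0 _ _ ew]] := norm_pair cp f0 g0 ka0 eN eh.
by exists N, ga.
Qed.

End OneInvolution.

Section TwoInvolutions.
Variables (S1 S2 : {rmorphism E -> E}) (s1 s2 : {rmorphism k -> k}) (W1 W2 : E) (w1 w2 : k).
Hypotheses (Ss1 : forall x, S1 (phi x) = phi (s1 x)) (Ss2 : forall x, S2 (phi x) = phi (s2 x)).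
Hypotheses (SS1 : forall x, S1 (S1 x) = x) (SS2 : forall x, S2 (S2 x) = x).
Hypothesis S12 : forall x, S1 (S2 x) = S2 (S1 x).
Hypotheses (W10 : W1 != 0) (WSW1 : W1 * S1 W1 = phi w1) (hS1 : hat_closed S1 W1).
Hypotheses (W20 : W2 != 0) (WSW2 : W2 * S2 W2 = phi w2) (hS2 : hat_closed S2 W2).
Hypothesis W12 : W1 * S1 W2 = - (W2 * S2 W1).

(** The last equation compares the two orders in which g is twisted by [S1] and [S2]. By [W12] the
    twists anticommute for N = 1, hence the factor (-1)^N. *)
Lemma invariant_norm_descent h b : b != 0 -> h * S1 h = phi b -> S2 h = h ->
  exists N ga la, [/\ ga != 0, la != 0, w1 ^+ N = b * ga * s1 ga,
    w2 ^+ N = la * s2 la & s2 ga * la = (-1) ^+ N * (s1 la * ga)].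
Proof.
move=> b0 eh ih.
have h0 : h != 0.
  by apply: contraNneq b0 => h0; rewrite -(fmorph_eq0 phi) -eh h0 mul0r.
have [f [g [cp f0 g0 e1]]] := coprime_rep h0.
have [N eN] : exists N, maxn (size f) (size g) = N.+1.
  by exists (maxn (size f) (size g)).-1; rewrite prednK // leq_max size_poly_gt0 f0.
rewrite e1 in eh ih.
have [ga [ga0 h1 _ ew1]] := norm_pair Ss1 SS1 W10 WSW1 hS1 cp f0 g0 b0 eN eh.
have [la [la0 h2 h3 ew2]] := invariant_pair Ss2 SS2 W20 WSW2 hS2 cp f0 g0 eN ih.
exists N, ga, la; split=> //; apply: (fmorph_inj phi).
have a1 : S2 (S1 (e g)) * S2 W1 ^+ N = phi (s2 ga) * S2 (e f).
  by have := congr1 S2 h1; rewrite !rmorphM rmorphXn Ss2.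
have a2 : S2 (S1 (e g)) * S1 W2 ^+ N = phi (s1 la) * S1 (e g).
  by have := congr1 S1 h3; rewrite !rmorphM rmorphXn Ss1 S12.
have ef0 := ev_neq0 f0; have eg0 := ev_neq0 g0.
have n0 : (W2 * S2 W1) ^+ N * e f != 0 by rewrite mulf_neq0 ?expf_neq0 // mulf_neq0 ?fmorph_eq0.
apply: (mulIf n0); rewrite !rmorphM rmorphXn rmorphN1.
transitivity ((W1 * S1 W2) ^+ N * (W2 ^+ N * (phi (s2 ga) * S2 (e f))) * (-1) ^+ N).
  transitivity ((-1) ^+ N * (-1) ^+ N * (phi (s2 ga) * (phi la * e f) * (W2 * S2 W1) ^+ N)).
    by rewrite -exprMn mulrNN mulr1 expr1n; ring.
  by rewrite W12 (exprNn (W2 * S2 W1)) -h2; ring.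
rewrite -a1 !exprMn.
transitivity ((-1) ^+ N * (W2 ^+ N * S2 W1 ^+ N) * (S2 (S1 (e g)) * S1 W2 ^+ N * W1 ^+ N)); first by ring.
rewrite a2 -[phi (s1 la) * _ * _]mulrA h1; ring.
Qed.

End TwoInvolutions.
End Descent.

(** * Hilbert 90 for two commuting involutions *)

Section HilbertNinety.
Variables (k : fieldType) (s1 s2 : {rmorphism k -> k}) (b w1 w2 ga la u : k) (N : nat).
Hypotheses (s12 : forall x, s1 (s2 x) = s2 (s1 x)) (ss1 : forall x, s1 (s1 x) = x)
  (ss2 : forall x, s2 (s2 x) = x).
Hypotheses (w10 : w1 != 0) (w20 : w2 != 0) (ga0 : ga != 0) (la0 : la != 0).
Hypotheses (sw1 : s1 w1 = w1) (sw1' : s2 w1 = w1) (sw2 : s1 w2 = w2) (sw2' : s2 w2 = w2).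
Hypotheses (u0 : u != 0) (su : s2 u = - u).
Hypotheses (e1 : w1 ^+ N = b * ga * s1 ga) (e2 : w2 ^+ N = la * s2 la)
  (e3 : s2 ga * la = (-1) ^+ N * (s1 la * ga)) (evN : ~~ odd N).

(** For even N, dividing by half powers of w1 and w2 gives h of norm b under s1 and l of norm 1
    under s2. Hilbert 90 writes l = s2(m)/m; then h s1(m)/m has the same norm as h, and s2(h) s1(l)
    = h l makes it fixed by s2. *)
Lemma cocycle_invariant : exists2 h, h * s1 h = b & s2 h = h.
Proof.
pose M := N./2; have eN : N = (M + M)%N by rewrite addnn even_halfK.
have e3' : s2 ga * la = s1 la * ga by rewrite e3 -signr_odd (negPf evN) mul1r.
pose h := w1 ^+ M / ga; pose l := la / w2 ^+ M.
have w1M := expf_neq0 M w10; have w2M := expf_neq0 M w20.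
have sga : s1 ga != 0 by rewrite fmorph_eq0.
have s2ga : s2 ga != 0 by rewrite fmorph_eq0.
have s2la : s2 la != 0 by rewrite fmorph_eq0.
have hh : h * s1 h = b.
  rewrite /h fmorph_div rmorphXn sw1.
  transitivity (w1 ^+ N / (ga * s1 ga)); first by rewrite eN exprD; field; rewrite sga ga0.
  by rewrite e1; field; rewrite sga ga0.
have l0 : l != 0 by rewrite mulf_neq0 ?invr_eq0.
have ll : l * s2 l = 1.
  rewrite /l fmorph_div rmorphXn sw2'.
  transitivity (la * s2 la / w2 ^+ N); first by rewrite eN exprD; field.
  by rewrite -e2 mulfV ?expf_neq0.
have hl : s2 h * s1 l = h * l.
  rewrite /h /l !fmorph_div !rmorphXn sw1' sw2.
  transitivity (w1 ^+ M / w2 ^+ M * (s1 la * ga) / (ga * s2 ga)); first by field; rewrite ga0 s2ga.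
  by rewrite -e3'; field; rewrite ga0 s2ga w2M.
clearbody h l; have [m m0 sm] : exists2 m, m != 0 & s2 m = l * m.
  (* The usual choice m = 1 + 1/l vanishes for l = -1; there [u], which s2 negates, takes its
     place. *)
  have [lN|lN] := eqVneq l (-1); first by exists u; rewrite // su lN mulN1r.
  have eV : l^-1 = s2 l by rewrite -(mulr1 l^-1) -ll mulKf.
  exists (1 + l^-1); last by rewrite eV rmorphD rmorph1 ss2 mulrDr mulr1 ll addrC.
  apply: contra lN => /eqP e; apply/eqP; apply: invr_inj.
  by rewrite invrN1; apply/eqP; rewrite -subr_eq0 opprK addrC e.
have sm0 : s1 m != 0 by rewrite fmorph_eq0.
have sl0 : s1 l != 0 by rewrite fmorph_eq0.
exists (h * s1 m / m).
  by rewrite -hh fmorph_div rmorphM ss1; field; rewrite m0 sm0.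
rewrite fmorph_div rmorphM -s12 sm rmorphM.
transitivity (s2 h * s1 l * s1 m / (l * m)); first by field; rewrite l0 m0.
by rewrite hl; field; rewrite l0 m0.
Qed.

End HilbertNinety.


Lemma rmorph_ev (k E E' : fieldType) (phi : {rmorphism k -> E}) (g : {rmorphism E -> E'})
    (psi : {rmorphism k -> E'}) t f : (forall x, g (phi x) = psi x) ->
  g (ev phi t f) = ev psi (g t) f.
Proof.
move=> h; rewrite !evE -horner_map -map_poly_comp; congr (_.[_]).
by apply: eq_map_poly.
Qed.

Lemma image_subfield (k E : fieldType) (phi : {rmorphism k -> E}) :
  is_subfield (fun f => exists z, phi z = f).
Proof.
split=> [|_ _ [x <-] [z <-]|_ _ [x <-] [z <-]|_ [x <-]].
- by exists 1; rewrite rmorph1.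
- by exists (x - z); rewrite rmorphB.
- by exists (x * z); rewrite rmorphM.
- by exists x^-1; rewrite fmorphV.
Qed.

Lemma subfield_ev (k E : fieldType) (phi : {rmorphism k -> E}) t (L : E -> Prop) f :
  is_subfield L -> (forall x, L (phi x)) -> L t -> L (ev phi t f).
Proof.
move=> sL Lk Lt; elim/poly_ind: f => [|f c IH]; first by rewrite rmorph0; apply: subfield0.
by rewrite rmorphD rmorphM /= evX evC; subfield_closed sL; apply: Lk.
Qed.

Lemma simple_ext (k E : fieldType) (phi : {rmorphism k -> E}) t : transcendental phi t ->
  exists (k' : fieldType) (rho : {rmorphism k -> k'}) (X : k') (phi' : {rmorphism k' -> E}),
  [/\ forall x, phi' (rho x) = phi x, phi' X = t, transcendental rho X,
      forall h, exists f g : {poly k}, g != 0 /\ h = ev rho X f / ev rho X g &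
      forall (K : fieldType) (iota : {rmorphism K -> E}) y n,
        (forall z, fractions_of iota y n (phi z)) -> y n = t ->
        forall z, fractions_of iota y n.+1 (phi' z)].
Proof.
move=> tr; have [Phi hP] := transcendental_emb tr.
pose rho : {rmorphism k -> {fraction {poly k}}} := (@FracField.tofrac {poly k}) \o @polyC k.
have er p : ev rho ('X)%:F p = p%:F.
  elim/poly_ind: p => [|p c IH]; first by rewrite !rmorph0.
  by rewrite !rmorphD !rmorphM /= evX evC IH.
exists {fraction {poly k}}, rho, ('X)%:F, Phi; split.
- by move=> x; rewrite /= hP evC.
- by rewrite hP evX.
- by move=> p; rewrite er; apply: tofrac_inj.
- by move=> h; have [n [d [d0 ->]]] := tofrac_frac h; exists n, d; rewrite !er.
- by move=> K iota y n hz ey z; apply: (tower_fractions hz) => p; rewrite hP ey.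
Qed.

Lemma restrict_rmorphism (k E : fieldType) (phi : {rmorphism k -> E}) (S : {rmorphism E -> E}) :
  (forall x, exists z, phi z = S (phi x)) ->
  exists s : {rmorphism k -> k}, forall x, phi (s x) = S (phi x).
Proof.
move=> h; have h' x : exists z, phi z == S (phi x) by have [z e] := h x; exists z; apply/eqP.
pose s x := xchoose (h' x); have sE x : phi (s x) = S (phi x) by apply/eqP; exact: (xchooseP (h' x)).
have sZ : zmod_morphism s by move=> x z; apply: (fmorph_inj phi); rewrite sE !rmorphB !sE.
have sM : monoid_morphism s.
  split; first by apply: (fmorph_inj phi); rewrite sE !rmorph1.
  by move=> x z; apply: (fmorph_inj phi); rewrite sE !rmorphM !sE.
pose mZ := GRing.isZmodMorphism.Build _ _ s sZ.
pose mM := GRing.isMonoidMorphism.Build _ _ s sM.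
by exists (HB.pack_for {rmorphism k -> k} s mZ mM).
Qed.

Section Hat.
Variables (k E : fieldType) (phi : {rmorphism k -> E}) (Z : E).
Variables (S : {rmorphism E -> E}) (s : {rmorphism k -> k}) (x : k).
Hypothesis Ss : forall x, S (phi x) = phi (s x).

Lemma hat_closed_inv : Z != 0 -> S Z = phi x / Z -> hat_closed phi Z S Z.
Proof.
move=> Z0 SZ N f lf; exists (\poly_(i < N.+1) (s f`_(N - i) * x ^+ (N - i))); first exact: size_poly.
rewrite !evE (horner_coef_wide (n := N.+1)) ?size_map_poly // rmorph_sum mulr_suml.
rewrite (horner_coef_wide (n := N.+1)); last by rewrite size_map_poly size_poly.
rewrite (reindex_inj rev_ord_inj); apply: eq_bigr => i _ /=.
have li : (i <= N)%N by rewrite -ltnS.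
rewrite !coef_map coef_poly ltn_ord /= rmorphM Ss rmorphXn SZ subSS.
have -> : Z ^+ N = Z ^+ (N - i) * Z ^+ i by rewrite -exprD subnK.
rewrite expr_div_n rmorphM rmorphXn.
by field; rewrite expf_neq0.
Qed.

Lemma hat_closed_scale : S Z = phi x * Z -> hat_closed phi Z S 1.
Proof.
move=> SZ N f lf; exists (\poly_(i < N.+1) (s f`_i * x ^+ i)); first exact: size_poly.
rewrite !evE (horner_coef_wide (n := N.+1)) ?size_map_poly // rmorph_sum expr1n mulr1.
rewrite (horner_coef_wide (n := N.+1)); last by rewrite size_map_poly size_poly.
apply: eq_bigr => i _ /=.
rewrite !coef_map coef_poly ltn_ord /= rmorphM Ss rmorphXn SZ exprMn !rmorphM rmorphXn; ring.
Qed.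

End Hat.

Lemma indep_widen (K E : fieldType) (iota : {rmorphism K -> E}) (y : nat -> E) m n :
  (n <= m)%N -> indep iota (fun i : 'I_m => y i) -> indep iota (fun i : 'I_n => y i).
Proof.
move=> le iy; have wI : injective (widen_ord le) by move=> i l /(congr1 val) /= /val_inj.
by apply: (indep_ext _ (indep_reindex wI iy)).
Qed.


(** * No element fixed by sigma_2 has sigma_1-norm b *)

Section NoInvariantNorm.
Variables (K E : fieldType) (iota : {rmorphism K -> E}) (x1 x2 x3 : E) (a b c : K).
Variables S1 S2 : {rmorphism E -> E}.
Hypotheses (two : 2%:R != 0 :> K) (a0 : a != 0) (b0 : b != 0) (c0 : c != 0).
Hypotheses (na : forall s, s ^+ 2 != a) (nb : forall s, s ^+ 2 != b)
  (nc : forall s, s ^+ 2 != - c) (nac : forall s, s ^+ 2 != - (a * c)).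
Hypothesis bx : basis3 iota x1 x2 x3.
Hypotheses (Sk1 : forall x, S1 (iota x) = iota x) (Sk2 : forall x, S2 (iota x) = iota x).
Hypotheses (S11 : S1 x1 = - x1) (S12 : S1 x2 = iota b / x2) (S13 : S1 x3 = iota c / x3).
Hypotheses (S21 : S2 x1 = iota a / x1) (S22 : S2 x2 = - x2) (S23 : S2 x3 = iota (- c) / x3).

Let div_div (F : fieldType) (x z : F) : x != 0 -> z != 0 -> x / (x / z) = z.
Proof. by move=> x0 z0; field; rewrite x0 z0. Qed.

Lemma basis_rmorph_ext (f g : {rmorphism E -> E}) :
  (forall x, f (iota x) = g (iota x)) -> f x1 = g x1 -> f x2 = g x2 -> f x3 = g x3 -> f =1 g.
Proof.
move=> fk f1 f2 f3 z; apply: (bx.2 z (fun z => f z = g z)) => // [|_ [] -> //].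
split=> [|u v eu ev|u v eu ev|u eu]; first by rewrite !rmorph1.
- by rewrite !rmorphB eu ev.
- by rewrite !rmorphM eu ev.
- by rewrite !fmorphV eu.
Qed.

Let SS1 z : S1 (S1 z) = z.
Proof.
have [n1 n2 n3] := basis_neq0 bx.
apply: (@basis_rmorph_ext (S1 \o S1) idfun) => [x|||] /=; rewrite ?Sk1 //.
- by rewrite S11 rmorphN S11 opprK.
- by rewrite S12 fmorph_div Sk1 S12 div_div // fmorph_eq0.
- by rewrite S13 fmorph_div Sk1 S13 div_div // fmorph_eq0.
Qed.

Let SS2 z : S2 (S2 z) = z.
Proof.
have [n1 n2 n3] := basis_neq0 bx.
apply: (@basis_rmorph_ext (S2 \o S2) idfun) => [x|||] /=; rewrite ?Sk2 //.
- by rewrite S21 fmorph_div Sk2 S21 div_div // fmorph_eq0.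
- by rewrite S22 rmorphN S22 opprK.
- by rewrite S23 fmorph_div Sk2 S23 div_div // fmorph_eq0 oppr_eq0.
Qed.

Let SC z : S1 (S2 z) = S2 (S1 z).
Proof.
have [n1 n2 n3] := basis_neq0 bx.
have ck : iota c != 0 by rewrite fmorph_eq0.
apply: (@basis_rmorph_ext (S1 \o S2) (S2 \o S1)) => [x|||] /=; rewrite ?Sk1 ?Sk2 ?Sk1 //.
- by rewrite S21 S11 fmorph_div rmorphN Sk1 S11 S21 invrN mulrN.
- by rewrite S22 S12 fmorph_div rmorphN Sk2 S22 S12 invrN mulrN.
- by rewrite S23 S13 !fmorph_div Sk1 Sk2 S13 S23 rmorphN; field; rewrite ?oppr_eq0 n3 ck.
Qed.

Let odd_half N : odd N -> N = (N./2 + N./2).+1.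
Proof. by move=> oN; rewrite -[LHS]odd_double_half oN addnn add1n. Qed.

Lemma no_invariant_norm h : h * S1 h = iota b -> S2 h <> h.
Proof.
move=> eh ih; have [n1 n2 n3] := basis_neq0 bx.
(* The layers are K, K(x2), K(x1,x2) and F, each stable under both involutions; x3 is eliminated
   first and x2 last. *)
pose y i := nth 0 [:: x2; x1; x3] i.
have iy : indep iota (fun i : 'I_3 => y i) by exact: (basis_swap12 bx).1.
have f0 z : fractions_of iota y 0 (iota z).
  by exists z%:MP, 1; rewrite rmorph1 oner_neq0 mulr1 mmapC.
have tr1 := tower_transcendental f0 (indep_widen (isT : (1 <= 3)%N) iy).
have [k1 [rho1 [X2 [phi1 [p1r p1X t1 fr1 ff1]]]]] := simple_ext tr1.
have {}ff1 := ff1 _ _ _ _ f0 erefl.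
have tr2 := tower_transcendental ff1 (indep_widen (isT : (2 <= 3)%N) iy).
have [k2 [rho2 [X1 [phi2 [p2r p2X t2 fr2 ff2]]]]] := simple_ext tr2.
have {}ff2 := ff2 _ _ _ _ ff1 erefl.
have tr3 := tower_transcendental ff2 iy.
have [k3 [rho3 [X3 [phi3 [p3r p3X _ fr3 _]]]]] := simple_ext tr3.
rewrite /y /= in tr1 tr2 tr3 p1X p2X p3X.
have frE z : exists f g : {poly k2}, g != 0 /\ z = ev phi2 x3 f / ev phi2 x3 g.
  have [z3 <-] : exists z3, phi3 z3 = z.
    apply: (bx.2 z (fun z => exists z3, phi3 z3 = z)) => [|x|_ [] ->].
    - exact: image_subfield.
    - by exists (rho3 (rho2 (rho1 x))); rewrite p3r p2r p1r.
    - by exists (rho3 X1); rewrite p3r.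
    - by exists (rho3 (rho2 X2)); rewrite p3r p2r.
    - by exists X3.
  have [f [g [g0 ->]]] := fr3 z3; exists f, g; split=> //.
  by rewrite fmorph_div !(rmorph_ev (psi := phi2) _ _ p3r) p3X.
have X10 : X1 != 0 by rewrite -(fmorph_eq0 phi2) p2X.
have X20 : X2 != 0 by rewrite -(fmorph_eq0 phi1) p1X.
have im1 : is_subfield (fun f => exists z, phi1 z = f) by exact: image_subfield.
have im2 : is_subfield (fun f => exists z, phi2 z = f) by exact: image_subfield.
have restr1 (S : {rmorphism E -> E}) : (forall x, S (iota x) = iota x) ->
    (exists z, phi1 z = S x2) -> exists s : {rmorphism k1 -> k1}, forall x, phi1 (s x) = S (phi1 x).
  move=> Sk Sx; apply: restrict_rmorphism => x.
  have ec f : exists z, phi1 z = ev iota (S x2) f.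
    by apply: (subfield_ev f im1) => // u; exists (rho1 u).
  have [f [g [_ ->]]] := fr1 x; rewrite !fmorph_div !(rmorph_ev (psi := iota) _ _ p1r) p1X.
  rewrite !(rmorph_ev (psi := iota) _ _ Sk); have [u <-] := ec f; have [v <-] := ec g.
  by exists (u / v); rewrite fmorph_div.
have [t_1 ht1] : exists s : {rmorphism k1 -> k1}, forall x, phi1 (s x) = S1 (phi1 x).
  by apply: restr1 => //; exists (rho1 b / X2); rewrite fmorph_div p1r p1X S12.
have [t_2 ht2] : exists s : {rmorphism k1 -> k1}, forall x, phi1 (s x) = S2 (phi1 x).
  by apply: restr1 => //; exists (- X2); rewrite rmorphN p1X S22.
have restr2 (S : {rmorphism E -> E}) (t : {rmorphism k1 -> k1}) : (forall x, phi1 (t x) = S (phi1 x)) ->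
    (exists z, phi2 z = S x1) -> exists s : {rmorphism k2 -> k2}, forall x, phi2 (s x) = S (phi2 x).
  move=> St Sx; apply: restrict_rmorphism => x.
  have St' x0 : S (phi1 x0) = (phi1 \o t) x0 by rewrite /= St.
  have ec f : exists z, phi2 z = ev (phi1 \o t) (S x1) f.
    by apply: (subfield_ev f im2) => // u; exists (rho2 (t u)); rewrite p2r.
  have [f [g [_ ->]]] := fr2 x; rewrite !fmorph_div !(rmorph_ev (psi := phi1) _ _ p2r) p2X.
  rewrite !(rmorph_ev (psi := phi1 \o t) _ _ St'); have [u <-] := ec f; have [v <-] := ec g.
  by exists (u / v); rewrite fmorph_div.
have [s_1 hs1] : exists s : {rmorphism k2 -> k2}, forall x, phi2 (s x) = S1 (phi2 x).
  by apply: (restr2 _ t_1) => //; exists (- X1); rewrite rmorphN p2X S11.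
have [s_2 hs2] : exists s : {rmorphism k2 -> k2}, forall x, phi2 (s x) = S2 (phi2 x).
  by apply: (restr2 _ t_2) => //; exists (rho2 (rho1 a) / X1); rewrite fmorph_div p2r p1r p2X S21.
have I1 := fmorph_inj phi1; have I2 := fmorph_inj phi2.
have tt1 z : t_1 (t_1 z) = z by apply: I1; rewrite !ht1 SS1.
have tt2 z : t_2 (t_2 z) = z by apply: I1; rewrite !ht2 SS2.
have t12 z : t_1 (t_2 z) = t_2 (t_1 z) by apply: I1; rewrite !(ht1, ht2) SC.
have ss1 z : s_1 (s_1 z) = z by apply: I2; rewrite !hs1 SS1.
have ss2 z : s_2 (s_2 z) = z by apply: I2; rewrite !hs2 SS2.
have s12 z : s_1 (s_2 z) = s_2 (s_1 z) by apply: I2; rewrite !(hs1, hs2) SC.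
have tk1 x : t_1 (rho1 x) = rho1 x by apply: I1; rewrite ht1 p1r.
have tk2 x : t_2 (rho1 x) = rho1 x by apply: I1; rewrite ht2 p1r.
have st1 x : s_1 (rho2 x) = rho2 (t_1 x) by apply: I2; rewrite hs1 !p2r ht1.
have st2 x : s_2 (rho2 x) = rho2 (t_2 x) by apply: I2; rewrite hs2 !p2r ht2.
have t1X : t_1 X2 = rho1 b / X2 by apply: I1; rewrite ht1 fmorph_div p1r p1X S12.
have t2X : t_2 X2 = - X2 by apply: I1; rewrite ht2 rmorphN p1X S22.
have s1X : s_1 X1 = - X1 by apply: I2; rewrite hs1 rmorphN p2X S11.
have s2X : s_2 X1 = rho2 (rho1 a) / X1 by apply: I2; rewrite hs2 fmorph_div p2r p1r p2X S21.
(* For x2 |-> -x2 one may take W = 1 and w = 1, so the descent of a norm ka gives 1 = ka ga^2. *)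
have sq1 (g : k1) (ka : K) : ka != 0 -> g * t_2 g = rho1 ka -> exists s, s ^+ 2 = ka.
  move=> ka0 eg.
  have t2X' : t_2 X2 = rho1 (-1) * X2 by rewrite rmorphN1 mulN1r.
  have h1 : 1 * t_2 1 = rho1 1 by rewrite !rmorph1 mulr1.
  have tk2' x : t_2 (rho1 x) = rho1 (idfun x) by [].
  have [N [ga [ga0 e]]] := norm_descent t1 fr1 tk2' tt2 (oner_neq0 _) h1 (hat_closed_scale tk2' t2X') ka0 eg.
  exists ga^-1; move: e; rewrite expr1n /= => e.
  by apply: (mulIf ga0); apply: (mulIf ga0); rewrite -e; field.
have lvl3 : exists2 h2, h2 * s_1 h2 = rho2 (rho1 b) & s_2 h2 = h2.
  have S13' : S1 x3 = phi2 (rho2 (rho1 c)) / x3 by rewrite p2r p1r.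
  have S23' : S2 x3 = phi2 (rho2 (rho1 (- c))) / x3 by rewrite p2r p1r.
  have w1 : x3 * S1 x3 = phi2 (rho2 (rho1 c)) by rewrite S13'; field.
  have w2 : x3 * S2 x3 = phi2 (rho2 (rho1 (- c))) by rewrite S23'; field.
  have w12 : x3 * S1 x3 = - (x3 * S2 x3) by rewrite w1 w2 !rmorphN opprK.
  have b20 : rho2 (rho1 b) != 0 by rewrite !fmorph_eq0.
  have eh' : h * S1 h = phi2 (rho2 (rho1 b)) by rewrite p2r p1r.
  have Ss1' x : S1 (phi2 x) = phi2 (s_1 x) by rewrite hs1.
  have Ss2' x : S2 (phi2 x) = phi2 (s_2 x) by rewrite hs2.
  have [N [ga [la [ga0 la0 e1 e2 e3]]]] := invariant_norm_descent tr3 frE Ss1' Ss2' SS1 SS2 SC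
    n3 w1 (hat_closed_inv Ss1' n3 S13') n3 w2 (hat_closed_inv Ss2' n3 S23') w12 b20 eh' ih.
  have [oN|evN] := boolP (odd N); last first.
    apply: (cocycle_invariant s12 ss1 ss2 _ _ ga0 la0 _ _ _ _ _ _ e1 e2 e3 evN (u := rho2 X2)).
    - by rewrite !fmorph_eq0.
    - by rewrite !fmorph_eq0 oppr_eq0.
    - by rewrite st1 tk1.
    - by rewrite st2 tk2.
    - by rewrite st1 tk1.
    - by rewrite st2 tk2.
    - by rewrite fmorph_eq0.
    - by rewrite st2 t2X rmorphN.
  (* For odd N, dividing (-c)^N = la s2(la) by an even power makes -c a norm from K(x1,x2).
     Eliminating x1 leaves a^N'/(-c) as a square of K, so -ac or -c is a square, according to the
     parity of N'. *)
  exfalso; set cc := rho2 (rho1 (- c)) in e2.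
  have cc0 : cc != 0 by rewrite !fmorph_eq0 oppr_eq0.
  have scc : s_2 cc = cc by rewrite st2 tk2.
  pose mu := la / cc ^+ N./2.
  have emu : mu * s_2 mu = rho2 (rho1 (- c)).
    rewrite -/cc /mu fmorph_div rmorphXn scc.
    transitivity (la * s_2 la / (cc ^+ N./2 * cc ^+ N./2)); first by field; rewrite expf_neq0.
    by rewrite -e2 -exprD {1}(odd_half oN) exprS mulfK // expf_neq0.
  have nc0 : rho1 (- c) != 0 by rewrite fmorph_eq0 oppr_eq0.
  have wX : X1 * s_2 X1 = rho2 (rho1 a) by rewrite s2X; field.
  have [N' [ga' [ga0' e']]] := norm_descent t2 fr2 st2 ss2 X10 wX (hat_closed_inv st2 X10 s2X) nc0 emu.
  have eg : ga' * t_2 ga' = rho1 (a ^+ N' / - c).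
    by rewrite fmorph_div rmorphXn e' -mulrA [RHS]mulrC mulKf.
  have [|s es] := sq1 ga' _ _ eg; first by rewrite mulf_neq0 ?invr_eq0 ?expf_neq0 ?oppr_eq0.
  have [oN'|evN'] := boolP (odd N').
    have /eqP := nac (s * c / a ^+ N'./2); apply.
    rewrite expr_div_n exprMn es {1}(odd_half oN') exprS exprD.
    by field; rewrite ?oppr_eq0 ?c0 ?expf_neq0 ?oner_eq0.
  have /eqP := nc (a ^+ N'./2 / s); apply.
  have eN' : N' = (N'./2 + N'./2)%N by rewrite addnn even_halfK.
  rewrite expr_div_n es {2}eN' exprD.
  by field; rewrite ?oppr_eq0 ?c0 ?expf_neq0 ?oner_eq0.
have lvl2 : exists2 h1, h1 * t_1 h1 = rho1 b & t_2 h1 = h1.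
  have [h2 eh2 ih2] := lvl3.
  have s1X' : s_1 X1 = rho2 (-1) * X1 by rewrite rmorphN1 mulN1r.
  have w1 : 1 * s_1 1 = rho2 1 by rewrite !rmorph1 mulr1.
  have w2 : X1 * s_2 X1 = rho2 (rho1 a) by rewrite s2X; field.
  have w12 : 1 * s_1 X1 = - (X1 * s_2 1) by rewrite rmorph1 mul1r mulr1.
  have b10 : rho1 b != 0 by rewrite fmorph_eq0.
  have [N [ga [la [ga0 la0 e1 e2 e3]]]] := invariant_norm_descent t2 fr2 st1 st2 ss1 ss2 s12
    (oner_neq0 _) w1 (hat_closed_scale st1 s1X') X10 w2 (hat_closed_inv st2 X10 s2X) w12 b10 eh2 ih2.
  have [oN|evN] := boolP (odd N); last first.
    apply: (cocycle_invariant t12 tt1 tt2 _ _ ga0 la0 _ _ _ _ _ _ e1 e2 e3 evN (u := X2)) => //.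
    - by rewrite oner_neq0.
    - by rewrite !fmorph_eq0.
    - by rewrite rmorph1.
    - by rewrite rmorph1.
  (* For odd N the same division makes a a norm from K(x2), that is, a square. *)
  exfalso; set aa := rho1 a in e2.
  have aa0 : aa != 0 by rewrite !fmorph_eq0.
  pose mu := la / aa ^+ N./2.
  have [|s es] := sq1 mu a a0; last by have /eqP := na s.
  rewrite -/aa /mu fmorph_div rmorphXn tk2.
  transitivity (la * t_2 la / (aa ^+ N./2 * aa ^+ N./2)); first by field; rewrite expf_neq0.
  by rewrite -e2 -exprD {1}(odd_half oN) exprS mulfK // expf_neq0.
have [h1 eh1 ih1] := lvl2.
have t2X' : t_2 X2 = rho1 (-1) * X2 by rewrite rmorphN1 mulN1r.
have w2 : 1 * t_2 1 = rho1 1 by rewrite !rmorph1 mulr1.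
have w1 : X2 * t_1 X2 = rho1 b by rewrite t1X; field.
have w12 : X2 * t_1 1 = - (1 * t_2 X2) by rewrite t2X rmorph1 mul1r mulr1 opprK.
have tk1' x : t_1 (rho1 x) = rho1 (idfun x) by [].
have tk2' x : t_2 (rho1 x) = rho1 (idfun x) by [].
have [N [ga [la [ga0 la0 e1 _ e3]]]] := invariant_norm_descent t1 fr1 tk1' tk2' tt1 tt2 t12
  X20 w1 (hat_closed_inv tk1' X20 t1X) (oner_neq0 _) w2 (hat_closed_scale tk2' t2X') w12 b0 eh1 ih1.
(* On K both involutions are trivial, so [e3] reads ga la = (-1)^N la ga. Then N is even, and b^N =
   b ga^2 makes b a square. *)
have evN : ~~ odd N.
  apply/negP => oN; move: e3; rewrite /= -signr_odd oN expr1 mulN1r => e3.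
  have : 2%:R * (ga * la) = 0 by rewrite mulr_natl mulr2n {1}e3 [la * ga]mulrC addNr.
  by move/eqP; rewrite !mulf_eq0 (negPf two) (negPf ga0) (negPf la0).
have eN : N = (N./2 + N./2)%N by rewrite addnn even_halfK.
have /eqP := nb (b ^+ N./2 / ga); apply.
rewrite expr_div_n expr2 -exprD -eN e1 /=.
by field.
Qed.

End NoInvariantNorm.


(** * Irrationality *)

Section LeadingNorm.
Variables (K : fieldType) (n : nat).
Implicit Types p q : {mpoly K[n]}.

(** With m the largest of the three leading monomials, the coefficients at 2m give the identity
    between constants, and [hb] keeps q from dropping out. Specializing at a point would require
    enough elements in K. *)
Lemma leading_norm p1 p2 q (b ka : K) : q != 0 ->
  (forall m, p1@_m ^+ 2 = b * p2@_m ^+ 2 -> p1@_m = 0 /\ p2@_m = 0) ->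
  p1 ^+ 2 - b%:MP * p2 ^+ 2 = ka%:MP * q ^+ 2 ->
  exists al be, ka = al ^+ 2 - b * be ^+ 2 /\ (p2 = 0 -> be = 0).
Proof.
move=> q0 hb e; pose m := Order.max (mlead p1) (Order.max (mlead p2) (mlead q)).
have l1 : (mlead p1 <= m)%O by rewrite le_max lexx.
have l2 : (mlead p2 <= m)%O by rewrite !le_max lexx orbT.
have lq : (mlead q <= m)%O by rewrite !le_max lexx !orbT.
have em : p1@_m ^+ 2 - b * p2@_m ^+ 2 = ka * q@_m ^+ 2.
  have := congr1 (mcoeff (m + m)%MM) e.
  by rewrite mcoeffB !mcoeffCM !expr2 !mleadcMW.
have qm : q@_m != 0.
  apply/eqP => qm; move: em; rewrite qm expr0n mulr0 => /eqP; rewrite subr_eq0 => /eqP /hb [u1 u2].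
  (* All three coefficients at m would vanish, so the polynomial with leading monomial m is zero and
     m = 0 by convention. Then q also has leading monomial 0 = m, against q != 0. *)
  have m0 : m = 0%MM.
    have h r : m = mlead r -> r@_m = 0 -> m = 0%MM.
      by move=> -> /eqP; rewrite mleadc_eq0 => /eqP->; rewrite mlead0.
    have : [\/ m = mlead p1, m = mlead p2 | m = mlead q].
      rewrite /m /Order.max; case: ifP => _; [case: ifP => _|]; by constructor.
    by case=> /h; apply.
  have : mlead q = m by apply/eqP; rewrite eq_le lq m0 le0x.
  by move=> eq; move: qm; rewrite -eq => /eqP; rewrite mleadc_eq0 (negPf q0).
exists (p1@_m / q@_m), (p2@_m / q@_m); split; last by move=> ->; rewrite mcoeff0 mul0r.
by apply: (mulIf (expf_neq0 2 qm)); rewrite -em; field.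
Qed.

Variables (E : fieldType) (tau : {rmorphism {mpoly K[n]} -> E}).
Hypothesis tau_inj : forall p, tau p = 0 -> p = 0.
Hypothesis tau_frac : forall f, exists p q : {mpoly K[n]}, q != 0 /\ f = tau p / tau q.

Let tn p : p != 0 -> tau p != 0.
Proof. by apply: contraNneq => /tau_inj->. Qed.

Lemma norm_const A B (b ka : K) : (forall s, s ^+ 2 != b) ->
  A ^+ 2 - tau b%:MP * B ^+ 2 = tau ka%:MP -> exists al be, ka = al ^+ 2 - b * be ^+ 2.
Proof.
move=> nb e; have [p1 [q1 [/[dup] z1 /tn t1 e1]]] := tau_frac A.
have [p2 [q2 [/[dup] z2 /tn t2 e2]]] := tau_frac B.
have [|m h||al [be [-> _]]] := @leading_norm (p1 * q2) (p2 * q1) (q1 * q2) b ka; last by exists al, be.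
- by rewrite mulf_neq0.
- have v0 : (p2 * q1)@_m = 0.
    apply/eqP; apply/negPn/negP => v0; have /eqP := nb ((p1 * q2)@_m / (p2 * q1)@_m); apply.
    by rewrite expr_div_n h mulfK // expf_neq0.
  by move: h; rewrite v0 expr0n mulr0 => /eqP; rewrite expf_eq0 => /eqP.
- apply/eqP; rewrite -subr_eq0; apply/eqP/tau_inj.
  transitivity ((A ^+ 2 - tau b%:MP * B ^+ 2 - tau ka%:MP) * (tau q1 * tau q2) ^+ 2); last by rewrite e subrr mul0r.
  rewrite e1 e2 !rmorphB !(rmorphXn, rmorphM); field.
  by rewrite t1 t2.
Qed.

Lemma nonsquare_const (s : K) f : (forall r, r ^+ 2 != s) -> f ^+ 2 != tau s%:MP.
Proof.
move=> ns; apply/eqP => e; have [p [q [/[dup] z /tn t1 e1]]] := tau_frac f.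
have [m h||al [be [es hbe]]] := @leading_norm p 0 q 0 s z.
- by move: h; rewrite mul0r mcoeff0 => /eqP; rewrite expf_eq0 => /eqP.
- apply/eqP; rewrite -subr_eq0; apply/eqP/tau_inj.
  transitivity ((f ^+ 2 - tau s%:MP) * tau q ^+ 2); last by rewrite e subrr mul0r.
  by rewrite e1 expr0n mulr0 subr0 !rmorphB !(rmorphXn, rmorphM); field.
by have /eqP := ns al; apply; rewrite es mul0r subr0.
Qed.

End LeadingNorm.

Section AllMinus.
Variables (K E : fieldType) (iota : {rmorphism K -> E}) (x1 x2 x3 : E) (a b c : K).
Variables S1 S2 : {rmorphism E -> E}.
Hypotheses (two : 2%:R != 0 :> K) (a0 : a != 0) (b0 : b != 0) (c0 : c != 0).
Hypothesis bx : basis3 iota x1 x2 x3.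
Hypotheses (Sk1 : forall x, S1 (iota x) = iota x) (Sk2 : forall x, S2 (iota x) = iota x).
Hypotheses (S11 : S1 x1 = - x1) (S12 : S1 x2 = iota b / x2) (S13 : S1 x3 = iota c / x3).
Hypotheses (S21 : S2 x1 = iota a / x1) (S22 : S2 x2 = - x2) (S23 : S2 x3 = iota (- c) / x3).

Let ak : iota a != 0. Proof. by rewrite fmorph_eq0. Qed.
Let bk : iota b != 0. Proof. by rewrite fmorph_eq0. Qed.
Let ck : iota c != 0. Proof. by rewrite fmorph_eq0. Qed.

Let s1 := x1 + iota a / x1.
Let s2 := x2 + iota b / x2.
Let s3 := x3 + iota c / x3.
Let d1 := x1 - iota a / x1.
Let d2 := x2 - iota b / x2.
Let d3 := x3 - iota c / x3.

Let sum_neq0 x u v (k : K) : basis3 iota x u v -> k != 0 -> x + iota k / x != 0.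
Proof.
move=> bz k0; have [n1 _ _] := basis_neq0 bz.
have s : specz iota (idfun : {rmorphism K -> K}) (tri x u v) (tri 0 0 0) (x ^+ 2 + iota k) k.
  by eapply specz_val; [spec_eval|rewrite /=; ring].
have := spec_neq0 bz.1 s k0.
by apply: contra => /eqP e; apply/eqP; transitivity (x * (x + iota k / x)); [field|rewrite e mulr0].
Qed.

Let s10 : s1 != 0. Proof. exact: sum_neq0 bx a0. Qed.
Let s20 : s2 != 0. Proof. exact: sum_neq0 (basis_swap12 bx) b0. Qed.

Let S1_values : [/\ S1 s1 = - s1, S1 s2 = s2 & S1 s3 = s3] /\ [/\ S1 d1 = - d1, S1 d2 = - d2 & S1 d3 = - d3].
Proof.
have [n1 n2 n3] := basis_neq0 bx.
rewrite /s1 /s2 /s3 /d1 /d2 /d3 !rmorphD !rmorphN !fmorph_div !Sk1 S11 S12 S13.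
by do !split; field; rewrite ?oppr_eq0 ?n1 ?n2 ?n3 ?bk ?ck.
Qed.

Let S2_values : [/\ S2 s1 = s1, S2 s2 = - s2 & S2 s3 = - s3] /\ [/\ S2 d1 = - d1, S2 d2 = - d2 & S2 d3 = d3].
Proof.
have [n1 n2 n3] := basis_neq0 bx.
rewrite /s1 /s2 /s3 /d1 /d2 /d3 !rmorphD !rmorphN !fmorph_div !Sk2 S21 S22 S23 rmorphN.
by do !split; field; rewrite ?oppr_eq0 ?n1 ?n2 ?n3 ?ak ?ck.
Qed.

(** The group multiplies every s_i and d_i by signs. Those of d1 and d2 are the signs of s1 s2,
    those of s3 are the signs of s2, and those of d3 are the signs of s1; hence the four quotients
    are invariant. *)
Lemma invariant_relations : exists P Q e1 e2 e3 e4 : E,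
  [/\ P = s1 ^+ 2,
    P - P * Q * e1 ^+ 2 = 4%:R * iota a, Q - P * Q * e2 ^+ 2 = 4%:R * iota b,
    Q * e3 ^+ 2 - P * e4 ^+ 2 = 4%:R * iota c &
    forall f, f \in [:: P; Q; e1; e2; e3; e4] -> S1 f = f /\ S2 f = f].
Proof.
have [n1 n2 n3] := basis_neq0 bx.
have [[u1 u2 u3] [v1 v2 v3]] := S1_values; have [[u1' u2' u3'] [v1' v2' v3']] := S2_values.
exists (s1 ^+ 2), (s2 ^+ 2), (d1 / (s1 * s2)), (d2 / (s1 * s2)), (s3 / s2), (d3 / s1).
split=> //.
- transitivity (s1 ^+ 2 - d1 ^+ 2); first by field; rewrite s10 s20.
  by rewrite /s1 /d1; field.
- transitivity (s2 ^+ 2 - d2 ^+ 2); first by field; rewrite s10 s20.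
  by rewrite /s2 /d2; field.
- transitivity (s3 ^+ 2 - d3 ^+ 2); first by field; rewrite s10 s20.
  by rewrite /s3 /d3; field.
move=> f; rewrite !inE => /or4P [/eqP->|/eqP->|/eqP->|/or3P [] /eqP->].
- by rewrite !rmorphXn u1 u1' sqrrN.
- by rewrite !rmorphXn u2 u2' sqrrN.
- by rewrite !fmorph_div !rmorphM v1 v1' u1 u2 u1' u2'; split; field; rewrite ?oppr_eq0 ?s10 ?s20.
- by rewrite !fmorph_div !rmorphM v2 v2' u1 u2 u1' u2'; split; field; rewrite ?oppr_eq0 ?s10 ?s20.
- by rewrite !fmorph_div u3 u3' u2 u2' invrN mulrNN.
- by rewrite !fmorph_div v3 v3' u1 u1' invrN mulrNN.
Qed.

Hypotheses (na : forall s, s ^+ 2 != a) (nb : forall s, s ^+ 2 != b)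
  (nc : forall s, s ^+ 2 != - c) (nac : forall s, s ^+ 2 != - (a * c)).
Hypothesis norm_K : forall A B ka, A ^+ 2 - iota b * B ^+ 2 = iota ka ->
  exists al be, ka = al ^+ 2 - b * be ^+ 2.

(** Once s1^2 = A'^2 - b B'^2 with invariant A' and B', the factorization (A' + s1)(A' - s1) = b
    B'^2 exchanges the slots: [S1] negates s1 and [S2] fixes it, so h = (A' + s1)/B' has norm b and
    is fixed by [S2]. *)
Lemma invariant_norm_absurd ka A B : S1 A = A -> S2 A = A -> S1 B = B -> S2 B = B ->
  s1 ^+ 2 = iota ka * (A ^+ 2 - iota b * B ^+ 2) -> False.
Proof.
move=> A1 A2 B1 B2 e.
have [[u1 _ _] _] := S1_values; have [[u1' _ _] _] := S2_values.
have two' : 2%:R != 0 :> E by rewrite -(rmorph_nat iota) fmorph_eq0.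
have k0 : iota ka != 0.
  by apply: contraNneq (expf_neq0 2 s10) => k0; rewrite e k0 mul0r.
have [al [be eka]] : exists al be, ka^-1 = al ^+ 2 - b * be ^+ 2.
  apply: (norm_K (A := A / s1) (B := B / s1)); rewrite fmorphV.
  apply: (mulfI k0); rewrite mulfV //.
  transitivity (iota ka * (A ^+ 2 - iota b * B ^+ 2) / s1 ^+ 2); first by field.
  by rewrite -e mulfV // expf_neq0.
have ekb : (iota al) ^+ 2 - iota b * (iota be) ^+ 2 = (iota ka)^-1.
  by rewrite -fmorphV eka rmorphB !(rmorphXn, rmorphM).
set n := (iota ka)^-1 in ekb; have n0 : n != 0 by rewrite invr_eq0.
(* The coordinates of (al + be sqrt(b))(A + B sqrt(b))/n, whose norm is that of A + B sqrt(b)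
   divided by n = 1/ka. *)
pose A' := (iota al * A + iota b * iota be * B) / n; pose B' := (iota al * B + iota be * A) / n.
have e' : s1 ^+ 2 = A' ^+ 2 - iota b * B' ^+ 2.
  rewrite e -[iota ka]invrK -/n.
  transitivity (((iota al) ^+ 2 - iota b * (iota be) ^+ 2) * (A ^+ 2 - iota b * B ^+ 2) / n ^+ 2).
    by rewrite ekb; field.
  by rewrite /A' /B'; field.
have Sn1 : S1 n = n by rewrite fmorphV Sk1.
have Sn2 : S2 n = n by rewrite fmorphV Sk2.
have SA1 : S1 A' = A' by rewrite fmorph_div rmorphD !rmorphM !Sk1 A1 B1 Sn1.
have SA2 : S2 A' = A' by rewrite fmorph_div rmorphD !rmorphM !Sk2 A2 B2 Sn2.
have SB1 : S1 B' = B' by rewrite fmorph_div rmorphD !rmorphM !Sk1 A1 B1 Sn1.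
have SB2 : S2 B' = B' by rewrite fmorph_div rmorphD !rmorphM !Sk2 A2 B2 Sn2.
clearbody A' B'.
have B'0 : B' != 0.
  apply/eqP => z; move: e'; rewrite z expr0n mulr0 subr0 => /eqP; rewrite eqf_sqr => /orP h.
  have Ss : S1 s1 = s1 by case: h => /eqP->; rewrite ?rmorphN SA1.
  have : 2%:R * s1 = 0 by rewrite mulr_natl mulr2n -{2}Ss u1 subrr.
  by move/eqP; rewrite mulf_eq0 (negPf two') (negPf s10).
apply: (no_invariant_norm two a0 b0 c0 na nb nc nac bx Sk1 Sk2 S11 S12 S13 S21 S22 S23 (h := (A' + s1) / B')).
  rewrite fmorph_div rmorphD SA1 SB1 u1.
  transitivity ((A' ^+ 2 - s1 ^+ 2) / B' ^+ 2); first by field.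
  by rewrite e'; field.
by rewrite fmorph_div rmorphD SA2 SB2 u1'.
Qed.

End AllMinus.

Lemma adjoin_finite (K F : fieldType) (iota : {rmorphism K -> F}) (B : F -> Prop) f :
  adjoin iota B f -> exists s : seq F, (forall g, g \in s -> B g) /\ adjoin iota (fun g => g \in s) f.
Proof.
move=> Bf; pose L f := exists s : seq F, (forall g, g \in s -> B g) /\ adjoin iota (fun g => g \in s) f.
have catB (s s' : seq F) : (forall g, g \in s -> B g) -> (forall g, g \in s' -> B g) ->
    forall g, g \in s ++ s' -> B g.
  by move=> h h' g; rewrite mem_cat => /orP [/h|/h'].
have lel (s s' : seq F) g : adjoin iota (fun g => g \in s) g -> adjoin iota (fun g => g \in s ++ s') g.
  by apply: adjoin_le => u us; apply: adjoin_mem; rewrite mem_cat us.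
have ler (s s' : seq F) g : adjoin iota (fun g => g \in s') g -> adjoin iota (fun g => g \in s ++ s') g.
  by apply: adjoin_le => u us; apply: adjoin_mem; rewrite mem_cat us orbT.
apply: (Bf L) => [|x|g Bg].
- split=> [|u v [s [hs us]] [s' [hs' vs]]|u v [s [hs us]] [s' [hs' vs]]|u [s [hs us]]].
  + by exists [::]; split=> //; apply: (subfield1 (adjoin_subfield _ _)).
  + exists (s ++ s'); split; first exact: catB.
    by apply: (subfieldB (adjoin_subfield _ _)); [apply: lel|apply: ler].
  + exists (s ++ s'); split; first exact: catB.
    by apply: (subfieldM (adjoin_subfield _ _)); [apply: lel|apply: ler].
  + by exists s; split=> //; apply: (subfieldV (adjoin_subfield _ _)).
- by exists [::]; split=> //; apply: adjoin_const.
- exists [:: g]; split; first by move=> u; rewrite inE => /eqP->.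
  by apply: adjoin_mem; rewrite inE.
Qed.

(** A transcendence basis is an arbitrary set, whereas the tower adjoins a finite list; the six
    invariants involve only finitely many generators. *)
Lemma adjoin_finite_seq (K F : fieldType) (iota : {rmorphism K -> F}) (B : F -> Prop) (fs : seq F) :
  (forall f, f \in fs -> adjoin iota B f) ->
  exists s : seq F, [/\ uniq s, forall g, g \in s -> B g &
    forall f, f \in fs -> adjoin iota (fun g => g \in s) f].
Proof.
elim: fs => [|f fs IH] h; first by exists [::].
have [|s [us hs hfs]] := IH; first by move=> g gf; apply: h; rewrite inE gf orbT.
have [s' [hs' fs']] := adjoin_finite (h f (mem_head _ _)).
exists (undup (s ++ s')); split; first exact: undup_uniq.
  by move=> g; rewrite mem_undup mem_cat => /orP [/hs|/hs'].
move=> g; rewrite inE => /orP [/eqP->|/hfs].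
  by apply: adjoin_le fs' => u us'; apply: adjoin_mem; rewrite mem_undup mem_cat us' orbT.
by apply: adjoin_le => u us'; apply: adjoin_mem; rewrite mem_undup mem_cat us'.
Qed.


(** * Base change to a quadratic extension of K *)

Section BaseChange.
Variables (K K' : fieldType) (lam : {rmorphism K -> K'}).

Lemma base_change_emb : exists Phi : {rmorphism ratF K -> ratF K'},
  (forall x, Phi (constF x) = constF (lam x)) /\ (forall i, Phi (varF K i) = varF K' i).
Proof.
pose iota : {rmorphism K -> ratF K'} := @constF K' \o lam.
suff iX : indep iota (varF K') by exact: (rat_emb iX).
move=> p h.
have : map_mpoly lam p = 0.
  apply: (@indep_varF K'); rewrite -h /map_mpoly rmorph_mmap.
  by apply: eq_mmap => [x|i] /=; rewrite ?mmapC // mmapX mmap1U.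
move=> e; apply/mpolyP => m; apply: (fmorph_inj lam).
by rewrite -mcoeff_map_mpoly e !mcoeff0 rmorph0.
Qed.

Variable Phi : {rmorphism ratF K -> ratF K'}.
Hypotheses (Pk : forall x, Phi (constF x) = constF (lam x)).

Lemma mmap_base_change n (y : 'I_n -> ratF K) p :
  mmap (@constF K') (Phi \o y) (map_mpoly lam p) = Phi (mmap (@constF K) y p).
Proof.
rewrite /map_mpoly !rmorph_mmap; apply: eq_mmap => [x|i] /=; first by rewrite mmapC Pk.
by rewrite mmapX mmap1U.
Qed.

(** A relation over K' = K + rK splits as f0 + r f1 = 0 with f0 and f1 over K. If f1 were nonzero, e
    would be a square in K(x1,x2,x3), hence in K. *)
Lemma indep_base_change (e : K) (r : K') n (y : 'I_n -> ratF K) :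
  (forall s, s ^+ 2 != e) -> r ^+ 2 = lam e ->
  (forall z, exists u v, z = lam u + r * lam v) ->
  indep (@constF K) y -> indep (@constF K') (Phi \o y).
Proof.
move=> ne er dec iy p.
have [p0 [p1 ->]] : exists p0 p1, p = map_mpoly lam p0 + r%:MP * map_mpoly lam p1.
  elim/mpolyind: p => [|z m p _ _ [p0 [p1 ->]]].
    by exists 0, 0; rewrite !rmorph0 mulr0 addr0.
  have [u [v ->]] := dec z; exists (u *: 'X_[m] + p0), (v *: 'X_[m] + p1).
  rewrite !rmorphD /= !map_mpolyZ !map_mpolyX -!mul_mpolyC !(mpolyCD, mpolyCM); ring.
rewrite rmorphD rmorphM /= !mmap_base_change mmapC.
set f0 := mmap _ _ p0; set f1 := mmap _ _ p1 => h.
have f10 : f1 = 0.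
  apply/eqP; apply/negPn/negP => f1n.
  have nsq := @nonsquare_const K 3 (ratF K) (@FracField.tofrac {mpoly K[3]}).
  suff /eqP : (f0 / f1) ^+ 2 != constF e.
    apply; apply: (fmorph_inj Phi).
    rewrite rmorphXn fmorph_div Pk -er rmorphXn -sqrrN; congr (_ ^+ 2).
    have Pf1 : Phi f1 != 0 by rewrite fmorph_eq0.
    apply: (mulIf Pf1); rewrite mulNr divfK //; apply/eqP; rewrite eq_sym -subr_eq0 opprK addrC.
    exact/eqP.
  apply: nsq => [p' /eqP|f'|//]; first by rewrite tofrac_eq0 => /eqP.
  exists (\n_(repr f')), (\d_(repr f')); split; first exact: denom_ratioP.
  exact: frac_numden.
move: h; rewrite f10 rmorph0 mulr0 addr0 => /eqP; rewrite fmorph_eq0 => /eqP f00.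
by rewrite (iy p0 f00) (iy p1 f10) !rmorph0 mulr0 addr0.
Qed.

End BaseChange.

(** It is not claimed that the image of [B] generates the fixed field over K'. It is enough that the
    six invariants lie in the field that it generates, and that all elements of that field are
    invariant. *)
Lemma irrational_over (K K' : fieldType) (lam : {rmorphism K -> K'})
    (Phi : {rmorphism ratF K -> ratF K'}) (a b c : K) (B : ratF K -> Prop) :
  2%:R != 0 :> K -> a != 0 -> b != 0 -> c != 0 ->
  (forall x, Phi (constF x) = constF (lam x)) -> (forall i, Phi (varF K i) = varF K' i) ->
  (forall n (y : 'I_n -> ratF K), injective y -> (forall i, B (y i)) ->
     indep (@constF K') (Phi \o y)) ->
  (forall f, fixed_by (groupG a b c (-1) (-1) (-1)) f <-> adjoin (@constF K) B f) ->
  (forall s, s ^+ 2 != lam a) -> (forall s, s ^+ 2 != lam b) ->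
  (forall s, s ^+ 2 != lam (- c)) -> (forall s, s ^+ 2 != lam (- (a * c))) ->
  (exists i, i ^+ 2 = -1 :> K') \/ (exists r, r ^+ 2 = lam (- (a * b))) -> False.
Proof.
move=> two a0 b0 c0 Pk PX iB hB na nb nc nac hsq.
have two' : 2%:R != 0 :> K' by rewrite -(rmorph_nat lam) fmorph_eq0.
have a0' : lam a != 0 by rewrite fmorph_eq0.
have b0' : lam b != 0 by rewrite fmorph_eq0.
have c0' : lam c != 0 by rewrite fmorph_eq0.
have m2 (k : fieldType) : (-1) ^+ 2 = 1 :> k by rewrite sqrrN expr1n.
have m0 (k : fieldType) : -1 != 0 :> k by rewrite oppr_eq0 oner_eq0.
have [S [T [Sk Tk [S1 S2 S3] [T1 T2 T3] hG]]] := groupG_fixed a0 b0 c0 (m2 K) (m2 K) (m0 K).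
have [S' [T' [Sk' Tk' [S1' S2' S3'] [T1' T2' T3'] _]]] := groupG_fixed a0' b0' c0' (m2 K') (m2 K') (m0 K').
have PS f : Phi (S f) = S' (Phi f).
  apply: (@rat_ext _ _ (Phi \o S) (S' \o Phi)) => [x|] /=; first by rewrite Sk Pk Sk'.
  apply: forall_ord3; rewrite PX.
  - by rewrite -/(x1 K) -/(x1 K') S1 S1' rmorphM Pk PX !rmorphN1.
  - by rewrite -/(x2 K) -/(x2 K') S2 S2' fmorph_div Pk PX.
  - by rewrite -/(x3 K) -/(x3 K') S3 S3' fmorph_div Pk PX.
have PT f : Phi (T f) = T' (Phi f).
  apply: (@rat_ext _ _ (Phi \o T) (T' \o Phi)) => [x|] /=; first by rewrite Tk Pk Tk'.
  apply: forall_ord3; rewrite PX.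
  - by rewrite -/(x1 K) -/(x1 K') T1 T1' fmorph_div Pk PX.
  - by rewrite -/(x2 K) -/(x2 K') T2 T2' rmorphM Pk PX !rmorphN1.
  - by rewrite -/(x3 K) -/(x3 K') T3 T3' fmorph_div Pk PX !mulN1r rmorphN.
have neg (k : fieldType) z : constF (-1 : k) * z = - z by rewrite rmorphN1 mulN1r.
rewrite neg in S1; rewrite neg in T2; rewrite mulN1r in T3.
rewrite neg in S1'; rewrite neg in T2'; rewrite mulN1r in T3'.
have [P [Q [e1 [e2 [e3 [e4 [eP r1 r2 r3 hinv]]]]]]] :=
  invariant_relations a0 b0 c0 (@basis_x K) Sk Tk S1 S2 S3 T1 T2 T3.
have [|s [us hs hfs]] := @adjoin_finite_seq _ _ (@constF K) B [:: P; Q; e1; e2; e3; e4].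
  by move=> f /hinv hf; apply/hB/hG.
pose y i := Phi (nth 0 s i).
have iy : indep (@constF K') (fun i : 'I_(size s) => y i).
  apply: (iB _ (fun i : 'I_(size s) => nth 0 s i)) => [i l /eqP|i].
    by rewrite nth_uniq // => /eqP/val_inj.
  by apply: hs; apply: mem_nth.
have hsq' : (exists i, i ^+ 2 = -1 :> K') \/ (exists r, r ^+ 2 = - (lam a * lam b)).
  by rewrite -rmorphM -rmorphN.
have [k [j [phi [pj uj _ hy hphi]]]] := tower two' a0' b0' c0' hsq' iy.
have pj' x : phi (j x) = constF x by exact: pj.
have lift f : f \in [:: P; Q; e1; e2; e3; e4] -> exists z, phi z = Phi f.
  move=> /hfs Af; apply: (Af (fun f => exists z, phi z = Phi f)) => [|x|g gs].
  - split=> [|u v [z ez] [z' ez']|u v [z ez] [z' ez']|u [z ez]].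
    + by exists 1; rewrite !rmorph1.
    + by exists (z - z'); rewrite !rmorphB ez ez'.
    + by exists (z * z'); rewrite !rmorphM ez ez'.
    + by exists z^-1; rewrite !fmorphV ez.
  - by exists (j (lam x)); rewrite pj' Pk.
  - have [|z ez] := hy (index g s); first by rewrite index_mem.
    by exists z; rewrite ez /y nth_index.
have [P' hP] := lift P (mem_head _ _).
have [Q' hQ] : exists z, phi z = Phi Q by apply: lift; rewrite !inE eqxx ?orbT.
have [e1' h1] : exists z, phi z = Phi e1 by apply: lift; rewrite !inE eqxx ?orbT.
have [e2' h2] : exists z, phi z = Phi e2 by apply: lift; rewrite !inE eqxx ?orbT.
have [e3' h3] : exists z, phi z = Phi e3 by apply: lift; rewrite !inE eqxx ?orbT.
have [e4' h4] : exists z, phi z = Phi e4 by apply: lift; rewrite !inE eqxx ?orbT.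
have [|||ka [A [C eA]]] := uj P' Q' e1' e2' e3' e4'.
- apply: (fmorph_inj phi); rewrite rmorphB !(rmorphXn, rmorphM) hP hQ h1 rmorph_nat pj' -Pk.
  by rewrite -(rmorph_nat Phi) -!(rmorphXn, rmorphM) -rmorphB r1.
- apply: (fmorph_inj phi); rewrite rmorphB !(rmorphXn, rmorphM) hP hQ h2 rmorph_nat pj' -Pk.
  by rewrite -(rmorph_nat Phi) -!(rmorphXn, rmorphM) -rmorphB r2.
- apply: (fmorph_inj phi); rewrite rmorphB !(rmorphXn, rmorphM) hP hQ h3 h4 rmorph_nat pj' -Pk.
  by rewrite -(rmorph_nat Phi) -!(rmorphXn, rmorphM) -rmorphB r3.
have fixS (R : {rmorphism ratF K -> ratF K}) (R' : {rmorphism ratF K' -> ratF K'}) z :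
    (forall x, R' (constF x) = constF x) -> (forall f, Phi (R f) = R' (Phi f)) ->
    (forall g, g \in s -> R g = g) -> R' (phi z) = phi z.
  move=> Rk PR Rs; have [p [q [q0 e]]] := hphi z.
  have fix_mmap (t : {mpoly K'[size s]}) : R' (mmap (@constF K') (fun i : 'I_(size s) => y i) t) = mmap (@constF K') (fun i : 'I_(size s) => y i) t.
    rewrite rmorph_mmap; apply: eq_mmap => [x|i] /=; first exact: Rk.
    by rewrite /y -PR Rs // mem_nth.
  by apply: (mulIf q0); rewrite -{1}(fix_mmap q) -rmorphM e fix_mmap.
have Ss g : g \in s -> S g = g by move=> /hs Bg; have /hB/hG [] := adjoin_mem (iota := @constF K) Bg.
have Ts g : g \in s -> T g = g by move=> /hs Bg; have /hB/hG [] := adjoin_mem (iota := @constF K) Bg.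
have nc' r : r ^+ 2 != - lam c by rewrite -rmorphN nc.
have nac' r : r ^+ 2 != - (lam a * lam c) by rewrite -rmorphM -rmorphN nac.
apply: (@invariant_norm_absurd K' _ (@constF K') (x1 K') (x2 K') (x3 K') (lam a) (lam b) (lam c) S' T'
  two' a0' b0' c0' (@basis_x K') Sk' Tk' S1' S2' S3' T1' T2' T3' na nb nc' nac' _ ka (phi A) (phi C)).
- move=> A0 B0 ka0; apply: (@norm_const K' 3 (ratF K') (@FracField.tofrac {mpoly K'[3]})) nb.
    by move=> p /eqP; rewrite tofrac_eq0 => /eqP.
  move=> f'; exists (\n_(repr f')), (\d_(repr f')); split; first exact: denom_ratioP.
  exact: frac_numden.
- exact: fixS Sk' PS Ss.
- exact: fixS Tk' PT Ts.
- exact: fixS Sk' PS Ss.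
- exact: fixS Tk' PT Ts.
have -> : constF ka * (phi A ^+ 2 - constF (lam b) * phi C ^+ 2) = Phi P.
  by rewrite -hP eA rmorphM rmorphB !(rmorphXn, rmorphM) !pj'.
by rewrite eP rmorphXn rmorphD fmorph_div Pk PX.
Qed.


(** If (u + r v)^2 lies in K then uv = 0, so it is u^2 or e v^2. *)
Lemma nonsquare_quadratic (K K' : fieldType) (lam : {rmorphism K -> K'}) (e x : K) (r : K') :
  2%:R != 0 :> K -> e != 0 -> r ^+ 2 = lam e ->
  (forall z, exists u v, z = lam u + r * lam v) -> (forall s, s ^+ 2 != e) ->
  (forall s, s ^+ 2 != x) -> (forall s, s ^+ 2 != e * x) -> forall s, s ^+ 2 != lam x.
Proof.
move=> two e0 er dec ne nx nex s; apply/eqP => es; have [u [v eu]] := dec s.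
have h : lam (u ^+ 2 + e * v ^+ 2 - x) + r * lam (2%:R * (u * v)) = 0.
  rewrite rmorphB rmorphD !(rmorphXn, rmorphM) rmorph_nat -er -es eu; ring.
have uv : u * v = 0.
  apply/eqP; apply/negPn/negP => uv0; have uv2 := mulf_neq0 two uv0.
  have /eqP := ne ((u ^+ 2 + e * v ^+ 2 - x) / (2%:R * (u * v))); apply.
  apply: (fmorph_inj lam); rewrite -er rmorphXn fmorph_div.
  have l0 : lam (2%:R * (u * v)) != 0 by rewrite fmorph_eq0.
  rewrite -[RHS]sqrrN; congr (_ ^+ 2); apply: (mulIf l0); rewrite divfK // mulNr.
  by apply/eqP; rewrite -addr_eq0 h.
move: h; rewrite uv mulr0 rmorph0 mulr0 addr0 => /eqP; rewrite fmorph_eq0 subr_eq0 => /eqP h.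
move/eqP: uv; rewrite mulf_eq0 => /orP [] /eqP z; rewrite z expr0n ?mulr0 ?addr0 ?add0r in h.
  by have /eqP := nex (e * v); apply; rewrite -h; ring.
by have /eqP := nx u.
Qed.

Lemma all_minus_irrational (K : fieldType) (a b c : K) : 2%:R != 0 :> K ->
  a != 0 -> b != 0 -> c != 0 ->
  (forall t, t \in [:: a; - a; b; - b; c; - c; a * b; - (a * c); b * c] ->
     forall s, s ^+ 2 != t) ->
  ~ rational (fixed_by (groupG a b c (-1) (-1) (-1))).
Proof.
move=> two a0 b0 c0 ns [B [iB hB]].
have na : forall s, s ^+ 2 != a by apply: ns; rewrite !inE eqxx ?orbT.
have na' : forall s, s ^+ 2 != - a by apply: ns; rewrite !inE eqxx ?orbT.
have nb : forall s, s ^+ 2 != b by apply: ns; rewrite !inE eqxx ?orbT.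
have nb' : forall s, s ^+ 2 != - b by apply: ns; rewrite !inE eqxx ?orbT.
have nc : forall s, s ^+ 2 != c by apply: ns; rewrite !inE eqxx ?orbT.
have nc' : forall s, s ^+ 2 != - c by apply: ns; rewrite !inE eqxx ?orbT.
have nac : forall s, s ^+ 2 != - (a * c) by apply: ns; rewrite !inE eqxx ?orbT.
have nbc : forall s, s ^+ 2 != b * c by apply: ns; rewrite !inE eqxx ?orbT.
have [hsq|hsq] := classic ((exists i, i ^+ 2 = -1 :> K) \/ (exists r, r ^+ 2 = - (a * b))).
  by apply: (irrational_over (lam := idfun) (Phi := idfun) two a0 b0 c0 _ _ _ hB na nb nc' nac hsq).
have quad (e : K) : e != 0 -> (forall s, s ^+ 2 != e) ->
    (forall s, s ^+ 2 != e * a) -> (forall s, s ^+ 2 != e * b) ->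
    (forall s, s ^+ 2 != e * - c) -> (forall s, s ^+ 2 != e * - (a * c)) ->
    e = -1 \/ e = - (a * b) -> False.
  move=> e0 ne nea neb nec neac ecase.
  have [K' [lam [r [er dec]]]] := sqrt_ext e; have {}dec := dec ne.
  have [Phi [Pk PX]] := base_change_emb lam.
  have nq x := @nonsquare_quadratic K K' lam e x r two e0 er dec ne.
  apply: (@irrational_over K K' lam Phi a b c B) => //; try exact: nq.
    by move=> n y yI By; apply: (indep_base_change Pk ne er dec); apply: iB.
  by case: ecase er => -> er; [left|right]; exists r; rewrite er ?rmorphN1.
have nm1 : forall s : K, s ^+ 2 != -1 by move=> s; apply/eqP => es; apply: hsq; left; exists s.
have nab : forall s : K, s ^+ 2 != - (a * b) by move=> s; apply/eqP => es; apply: hsq; right; exists s.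
have scale (t u v : K) : v != 0 -> (forall s, s ^+ 2 != u) -> t = u * v ^+ 2 -> forall s, s ^+ 2 != t.
  move=> v0 nu -> s; apply/eqP => es; have /eqP := nu (s / v); apply.
  by rewrite expr_div_n es mulfK // expf_neq0.
have [[s0 es0]|nsac] := classic (exists s, s ^+ 2 = a * c).
  have s00 : s0 != 0.
    by apply: contraNneq (mulf_neq0 a0 c0) => z; rewrite -es0 z expr0n.
  apply: (quad (- (a * b))) => //; last by right.
  - by rewrite oppr_eq0 mulf_neq0.
  - by apply: (scale _ _ a a0 nb'); ring.
  - by apply: (scale _ _ b b0 na'); ring.
  - by apply: (scale _ _ s0 s00 nb); rewrite es0; ring.
  - by apply: (scale _ _ a a0 nbc); ring.
apply: (quad (-1)) => //; last by left.
- by rewrite oppr_eq0 oner_eq0.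
- by move=> s; rewrite mulN1r.
- by move=> s; rewrite mulN1r.
- by move=> s; rewrite mulN1r opprK.
- by move=> s; rewrite mulN1r opprK; apply/eqP => es; apply: nsac; exists s.
Qed.

Theorem theorem5 (K : fieldType) (hchar : 2%N \notin [pchar K])
    (a b c : K) (ha : a != 0) (hb : b != 0) (hc : c != 0)
    (e1 e2 e3 : K)
    (he1 : e1 = 1 \/ e1 = -1) (he2 : e2 = 1 \/ e2 = -1)
    (he3 : e3 = 1 \/ e3 = -1) :
  let FG_rational := rational (fixed_by (groupG a b c e1 e2 e3)) in
  (* (1) *)
  ([/\ e1 = 1, e2 = 1 & e3 = 1] -> (FG_rational <-> Ruvw a b c)) /\
  (* (2) *)
  [/\ [/\ e1 = -1, e2 = -1 & e3 = 1] -> (FG_rational <-> Ruvw a b c),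
      [/\ e1 = -1, e3 = -1 & e2 = 1] -> (FG_rational <-> Ruvw (- a) b c)
    & [/\ e2 = -1, e3 = -1 & e1 = 1] ->
        (FG_rational <-> Ruvw a (- b) (- c))] /\
  (* (3) *)
  (count_mem (-1) [:: e1; e2; e3] = 1%N -> FG_rational) /\
  (* (4) *)
  ([/\ e1 = -1, e2 = -1 & e3 = -1] ->
    (* (i) *)
    [/\ (a = 1 \/ a = -1 -> (FG_rational <-> Ruvw b (-1) c)),
        (b = 1 \/ b = -1 -> (FG_rational <-> Ruvw a (-1) (- c)))
      & (c = 1 \/ c = -1 -> (FG_rational <-> Ruvw a (-1) b))] /\
    (* (ii) *)
    [/\ (a * b = 1 -> (FG_rational <-> Ruvw a c (- (a * c)))),
        (a * c = -1 -> (FG_rational <-> Ruvw (- a) b (a * b)))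
      & (b * c = 1 -> (FG_rational <-> Ruvw (- b) a (a * b)))] /\
    (* (iii) *)
    ((forall t, t \in [:: a; - a; b; - b; c; - c; a * b; - (a * c); b * c] ->
        ~ nonzero_square t) ->
      ~ FG_rational)).
Proof.
move=> FG.
have two : 2%:R != 0 :> K by apply: contra hchar => h; rewrite inE.
have m1 : (-1 == 1 :> K) = false.
  by rewrite eq_sym -subr_eq0 opprK -(mulr2n 1) (negPf two).
have m2 : (-1) ^+ 2 = 1 :> K by rewrite sqrrN expr1n.
have o2 : 1 ^+ 2 = 1 :> K by rewrite expr1n.
have sq1 (x : K) : x = 1 \/ x = -1 -> x ^+ 2 = 1 by case=> ->.
have nz (x : K) : x = 1 \/ x = -1 -> x != 0 by case=> ->; rewrite ?oppr_eq0 oner_eq0.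
have [S [T [Sk Tk [S1 S2 S3] [T1 T2 T3] hG]]] :=
  groupG_fixed ha hb hc (sq1 _ he1) (sq1 _ he2) (nz _ he3).
have bx := @basis_x K.
have pos (z : ratF K) : constF (1 : K) * z = z by rewrite rmorph1 mul1r.
have neg (z : ratF K) : constF (-1 : K) * z = - z by rewrite rmorphN1 mulN1r.
split; [|split; [split|split]].
- move=> [E1 E2 E3]; rewrite E1 pos in S1; rewrite E2 in T2; rewrite E3 in T3.
  have := monomial_plus two ha hb hc bx Sk Tk S2 S3 T1 hG S1 o2 T2 T3.
  by rewrite !mul1r.
- move=> [E1 E2 E3]; rewrite E1 neg in S1; rewrite E2 neg in T2; rewrite E3 mul1r in T3.
  exact: (monomial_minus_minus two ha hb hc bx Sk Tk S2 S3 T1 hG S1 T2 T3).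
- move=> [E1 E3 E2]; rewrite E1 neg in S1; rewrite E2 pos in T2; rewrite E3 mulN1r in T3.
  exact: (monomial_minus_plus two ha hb hc bx Sk Tk S2 S3 T1 hG S1 T2 T3).
- move=> [E2 E3 E1]; rewrite E1 pos in S1; rewrite E2 in T2; rewrite E3 in T3.
  have := monomial_plus two ha hb hc bx Sk Tk S2 S3 T1 hG S1 m2 T2 T3.
  by rewrite !mulN1r.
- rewrite /= addn0.
  case: he1 => E1; case: he2 => E2; case: he3 => E3; rewrite E1 E2 E3 ?eqxx ?[1 == -1]eq_sym ?m1 // => _.
  + rewrite E1 pos in S1; rewrite E2 in T2; rewrite E3 in T3.
    apply: (monomial_plus_rational two ha hb hc bx Sk Tk S2 S3 T1 hG S1 m2 _ T3).
    by rewrite opprK.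
  + rewrite E1 pos in S1; rewrite E2 in T2; rewrite E3 in T3.
    exact: (monomial_plus_rational two ha hb hc bx Sk Tk S2 S3 T1 hG S1 o2 T2 T3).
  + rewrite E1 neg in S1; rewrite E2 pos in T2; rewrite E3 mul1r in T3.
    exact: (monomial_minus_plus_rational two ha hb hc bx Sk Tk S2 S3 T1 hG S1 T2 T3).
move=> [E1 E2 E3]; rewrite E1 neg in S1; rewrite E2 neg in T2; rewrite E3 mulN1r in T3.
split; [split|split; [split|]].
- exact: (minus_a1 two hb hc bx Sk Tk S2 S3 T1 hG S1 T2 T3).
- exact: (minus_b1 two ha hc bx Sk Tk S2 S3 T1 hG S1 T2 T3).
- exact: (minus_c1 two ha hb hc bx Sk Tk S2 S3 T1 hG S1 T2 T3).
- exact: (minus_ab two ha hc bx Sk Tk S2 S3 T1 hG S1 T2 T3).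
- exact: (minus_ac two ha hb bx Sk Tk S2 S3 T1 hG S1 T2 T3).
- exact: (minus_bc two ha hb bx Sk Tk S2 S3 T1 hG S1 T2 T3).
move=> ns; rewrite /FG E1 E2 E3.
apply: all_minus_irrational => // t tin s; apply/eqP => es; apply: (ns t tin).
(* The root is nonzero because no entry of the list is zero. *)
exists s => //; apply: contraTneq tin => s0; rewrite -es s0 expr0n !inE.
by rewrite ![0 == _]eq_sym !(oppr_eq0, mulf_eq0) (negPf ha) (negPf hb) (negPf hc).
Qed.
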